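(* Let $m$ be a positive integer, let $\ell_1,\ell_2\in\mathbb{Z}\cup\{\pm\infty\}$, $\ell_1\le\ell_2$, and let $E=\{x_i\}_{i=\ell_1}^{\ell_2}$ be a strictly increasing sequence of points in $\mathbb{R}$ (finite, one-sided infinite or bi-infinite) which is a closed subset of $\mathbb{R}$. Let $m_E=\min\{m,\#E-1\}$, and let $f$ be a function on $E$. (i) For $p\in(1,\infty)$, $f$ belongs to the trace space $W^m_p(\mathbb{R})|_E$ if and only if the quantity $$\widetilde{\mathcal{W}}_{m,p}(f:E)=\left(\sum_{k=0}^{m_E}\ \sum_{i=\ell_1}^{\ell_2-k}\min\{1,x_{i+m}-x_i\}\,|\Delta^kf[x_i,\dots,x_{i+k}]|^p\right)^{1/p}$$ is finite, where $x_i=+\infty$ for every $i>\ell_2$. (ii) $f$ belongs to $W^m_\infty(\mathbb{R})|_E$ if and only if the quantity $$\widetilde{\mathcal{W}}_{m,\infty}(f:E)=\sup_{k=0,\dots,m_E,\ i=\ell_1,\dots,\ell_2-k}|\Delta^kf[x_i,\dots,x_{i+k}]|$$ is finite. (iii) For every $p\in(1,\infty]$, $\|f\|_{W^m_p(\mathbb{R})|_E}\sim\widetilde{\mathcal{W}}_{m,p}(f:E)$ with constants depending only on $m$; i.e., there is $C\ge1$ depending only on $m$ such that $C^{-1}\widetilde{\mathcal{W}}_{m,p}(f:E)\le\|f\|_{W^m_p(\mathbb{R})|_E}\le C\,\widetilde{\mathcal{W}}_{m,p}(f:E)$.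
   Context: Sobolev spaces. $L^m_p(\mathbb{R})$ is the space of all functions $F:\mathbb{R}\to\mathbb{R}$ such that $F^{(m-1)}$ is absolutely continuous on $\mathbb{R}$ and the weak derivative $F^{(m)}$ belongs to $L_p(\mathbb{R})$. $W^m_p(\mathbb{R})$ is the space of all $F\in L^m_p(\mathbb{R})$ whose derivatives of all orders $0,\dots,m$ belong to $L_p(\mathbb{R})$, normed by $\|F\|_{W^m_p(\mathbb{R})}=\sum_{k=0}^m\|F^{(k)}\|_{L_p(\mathbb{R})}$. The trace space is $W^m_p(\mathbb{R})|_E=\{f:E\to\mathbb{R}:\ \exists F\in W^m_p(\mathbb{R}),\ F|_E=f\}$, with trace norm $\|f\|_{W^m_p(\mathbb{R})|_E}=\inf\{\|F\|_{W^m_p(\mathbb{R})}: F\in W^m_p(\mathbb{R}),\ F|_E=f\}$. Divided differences. For distinct points $x_0,\dots,x_k$, $\Delta^kf[x_0,\dots,x_k]=\sum_{i=0}^k f(x_i)\big/\prod_{j\ne i}(x_i-x_j)$ (so $\Delta^0f[x_0]=f(x_0)$). The index $i$ always runs over integers; $m_E=m$ if $E$ is infinite. *)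

(* Defs.v *)
From HB Require Import structures.
From mathcomp Require Import all_boot all_order all_algebra finmap.
From mathcomp Require Import all_classical all_reals all_analysis.
Set Implicit Arguments.
Unset Strict Implicit.
Unset Printing Implicit Defensive.
Import Order.TTheory GRing.Theory Num.Theory.
Import numFieldNormedType.Exports.
Local Open Scope classical_set_scope.
Local Open Scope ring_scope.

Section Sobolev.
Context {R : realType}.
Implicit Types (F G f g : R -> R) (a b t : R) (p : \bar R) (m k : nat).

Local Notation mu := (@lebesgue_measure R).

Definition abs_continuous_itv a b F : Prop :=
  forall e : R, 0 < e -> exists2 d : R, 0 < d &
    forall (n : nat) (u v : 'I_n -> R),
      (forall i, [/\ a <= u i, u i <= v i & v i <= b]) ->
      trivIset [set: 'I_n] (fun i => `]u i, v i[%classic) ->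
      \sum_(i < n) (v i - u i) < d ->
      \sum_(i < n) `|F (v i) - F (u i)| < e.

(* On the whole line this means absolute continuity on every compact
   interval, as usual for Sobolev spaces. *)
Definition abs_continuous F : Prop := forall a b, abs_continuous_itv a b F.

Definition test_function (phi : R -> R) : Prop :=
  (forall k t, derivable (derive1n k phi) t 1) /\
  compact (closure [set t | phi t != 0]).

Definition is_weak_derive f g : Prop :=
  [/\ locally_integrable [set: R] f, locally_integrable [set: R] g &
   forall phi, test_function phi ->
     (\int[mu]_t (f t * derive1 phi t)%:E = - \int[mu]_t (g t * phi t)%:E)%E].

(* A weak derivative is only determined almost everywhere; the L_p-norms below
   do not depend on which one is chosen. *)
Definition weak_derive f : R -> R := xget (fun=> 0) [set g | is_weak_derive f g].

(* The derivatives of order k <= m of a function F in L^m_p: the classical ones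
   for k < m, and the weak derivative of F^(m-1) for k = m. *)
Definition sobolev_derive m F k : R -> R :=
  if (k < m)%N then derive1n k F else weak_derive (derive1n m.-1 F).

(* L^m_p(R), for m > 0 *)
Definition homogeneous_sobolev m p F : Prop :=
  [/\ forall k t, (k < m.-1)%N -> derivable (derive1n k F) t 1,
      abs_continuous (derive1n m.-1 F),
      is_weak_derive (derive1n m.-1 F) (sobolev_derive m F m) &
      sobolev_derive m F m \in Lfun mu p].

(* W^m_p(R), for m > 0 *)
Definition sobolev m p F : Prop :=
  homogeneous_sobolev m p F /\
  forall k, (k <= m)%N -> sobolev_derive m F k \in Lfun mu p.

Definition sobolev_norm m p F : \bar R :=
  (\sum_(k < m.+1) 'N[mu]_p[EFin \o sobolev_derive m F k])%E.

(* A function on E is represented by any f : R -> R extending it: nothing below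
   depends on the values of f outside E. *)
Definition extensions m p (E : set R) f : set (R -> R) :=
  [set F | sobolev m p F /\ forall t, E t -> F t = f t].

Definition in_trace_space m p (E : set R) f : Prop :=
  exists F, extensions m p E f F.

(* equal to +oo when f is not in the trace space *)
Definition trace_norm m p (E : set R) f : \bar R :=
  ereal_inf [set sobolev_norm m p F | F in extensions m p E f].

End Sobolev.

Section DividedDifferences.
Context {R : realType}.
Implicit Types (l : \bar int) (i : int) (x : int -> R) (f : R -> R).
Implicit Types (m k : nat).

Definition divided_difference k f (y : 'I_k.+1 -> R) : R :=
  \sum_(i < k.+1) f (y i) / \prod_(j < k.+1 | j != i) (y i - y j).

(* Delta^k f[x_i, ..., x_{i+k}] *)
Definition consecutive_difference x f k i : R :=
  divided_difference f (fun j : 'I_k.+1 => x (i + j%:Z)).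

(* A sequence (x_i), l1 <= i <= l2, is represented by any x : int -> R: its
   values outside this range are irrelevant. *)
Definition index_range l1 l2 : set int :=
  [set i | (l1 <= i%:E)%E /\ (i%:E <= l2)%E].

Definition point_set l1 l2 x : set R := [set x i | i in index_range l1 l2].

(* the indices i = l1, ..., l2 - k *)
Definition difference_range l1 l2 k : set int :=
  [set i | (l1 <= i%:E)%E /\ ((i + k%:Z)%:E <= l2)%E].

(* x_i, with the convention x_i = +oo for i > l2 *)
Definition extended_point l2 x i : \bar R :=
  if (i%:E <= l2)%E then (x i)%:E else +oo%E.

(* m_E; if E is empty, the truncated predecessor gives 0 instead of -1, which is
   harmless since the ranges of indices are then empty *)
Definition max_difference_order m (E : set R) : nat :=
  if `[< finite_set E >] then minn m (#|` fset_set E|%fset).-1 else m.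

Definition Wtilde_fin m (p : R) l1 l2 x f : \bar R :=
  ((\sum_(k < (max_difference_order m (point_set l1 l2 x)).+1)
     \esum_(i in difference_range l1 l2 k)
       (mine 1 (extended_point l2 x (i + m%:Z) - (x i)%:E) *
        (`|consecutive_difference x f k i| `^ p)%:E)) `^ p^-1)%E.

(* The supremum is taken in [0, +oo], hence is 0 for the empty family. *)
Definition Wtilde_oo m l1 l2 x f : \bar R :=
  maxe 0%E (ereal_sup [set y | exists k i,
    [/\ (k <= max_difference_order m (point_set l1 l2 x))%N,
        difference_range l1 l2 k i &
        y = `|consecutive_difference x f k i|%:E]]).

(* used for 1 < p only *)
Definition Wtilde m (p : \bar R) l1 l2 x f : \bar R :=
  if p is r%:E then Wtilde_fin m r l1 l2 x f else Wtilde_oo m l1 l2 x f.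

End DividedDifferences.

(* Main.v *)
Require Import Defs.
From HB Require Import structures.
From mathcomp Require Import all_boot all_order all_algebra finmap.
From mathcomp Require Import all_classical all_reals all_analysis.
From mathcomp Require Import measurable_realfun ess_sup_inf.
From mathcomp Require Import ring lra zify.
Set Implicit Arguments.
Unset Strict Implicit.
Unset Printing Implicit Defensive.
Import Order.TTheory GRing.Theory Num.Theory.
Import numFieldNormedType.Exports.
Local Open Scope classical_set_scope.
Local Open Scope ring_scope.

(** The two inequalities between the trace norm and the discrete quantity are proved
    separately. Both are reduced to a bi-infinite sequence [X] without accumulation
    points, obtained from [x] by adding points at mutual distance 2
    ([extended_sequence]): a closed increasing sequence that has infinitely many terms
    in one direction is unbounded in that direction, since its limit would have to be
    one of its terms.

    From functions to divided differences ([dd_energy_le], [dd_le_ess_bound]). For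
    [k < m] the [k]-th divided difference of [F] is, up to a factorial, the value of
    the [k]-th derivative at a point of its window; for [k = m] it is a difference of
    two values of the derivative of order [m - 1], divided by the length of the
    window, and hence is bounded by an average of the weak derivative. A value of the
    [k]-th derivative is bounded by the averages of the derivatives of orders [k] and
    [k + 1] over any interval of length at most 1 that contains the point. This
    interval is taken inside [[x_i, x_(i + m)]], with the length
    [min 1 (x_(i + m) - x_i)], which is the weight in the discrete quantity. A point
    lies in at most [m + 1] of these windows, so summation over [i] gives an integral
    over the line.

    From divided differences to functions ([smooth_extension]). Divided differences
    whose window contains a gap longer than 1 are replaced by 0 ([short_dd]). Every
    node gets the Newton polynomial of a window of [m] nodes, and two consecutive
    polynomials are glued by smooth steps: over the whole gap if it is short, near
    its two ends, with 0 in between, if it is long. Everything depends on the choice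
    of the windows: a window is passed over between two nodes only if the gap between
    these nodes is its longest gap ([transition_gap]). In that gap, the difference of
    the two polynomials is then a combination of [m]-th divided differences whose
    coefficients are of the size of the [m]-th power of the gap
    ([node_poly_step_bound]), and this pays for the negative powers of the gap in the
    derivatives of the step. So the derivatives up to order [m] are bounded on every
    gap by the divided differences of the [m] windows before it, and the gap is at
    most as long as these windows. Only the first node after a long gap lacks this
    balance: the extension reaches it from a distance 1, while its window may have a
    much smaller weight. A discrete Sobolev inequality ([embedding]) bounds its
    divided differences by weighted sums over the nodes within distance 1 after it.

    Powers of averages are always estimated through [a <= tau + tau ^ (1 - p) * a ^ p]
    ([threshold_bound]). All constants then occur as [c ^ p] with [c] depending on [m]
    only, so that the roots do not depend on [p]. *)

(** * Smooth functions on the line *)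

(** Products and inverses are differentiated by induction on a finite order: the
    formula for a derivative involves the factors themselves, at one order less. *)
Definition nderivable {R : realType} (n : nat) (f : R -> R) : Prop :=
  forall k t, (k <= n)%N -> derivable (derive1n k f) t 1.

Definition smooth {R : realType} (f : R -> R) : Prop :=
  forall k t, derivable (derive1n k f) t 1.

Section SmoothFunctions.
Context {R : realType}.
Implicit Types (f g : R -> R) (t : R) (k n : nat).

Lemma smooth_nderivable f : smooth f <-> forall n, nderivable n f.
Proof. by split=> [sf n k t _|nf k t]; [exact: sf|exact: (nf k)]. Qed.

Lemma nderivable_le n k f : (k <= n)%N -> nderivable n f -> nderivable k f.
Proof. by move=> kn nf i t ik; apply: nf; exact: leq_trans kn. Qed.

Lemma nderivableS n f :
  nderivable n.+1 f <-> (forall t, derivable f t 1) /\ nderivable n (derive1 f).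
Proof.
split=> [nf|[f0 nf] [|k] t kn]; last 2 first.
- exact: f0.
- by rewrite derive1Sn; exact: nf.
- split=> [t|k t kn]; first exact: (nf 0%N).
  by rewrite -derive1Sn; exact: nf.
Qed.

Lemma derive1_addf f g : (forall t, derivable f t 1) -> (forall t, derivable g t 1) ->
  (derive1 (f + g)) = (derive1 f) + (derive1 g).
Proof.
move=> df dg; apply/funext => t; transitivity (derive1 f t + derive1 g t) => //.
by rewrite !derive1E (deriveD (df t) (dg t)).
Qed.

Lemma derive1_mulf f g : (forall t, derivable f t 1) -> (forall t, derivable g t 1) ->
  (derive1 (f * g)) = (derive1 f) * g + f * (derive1 g).
Proof.
move=> df dg; apply/funext => t.
transitivity (derive1 f t * g t + f t * derive1 g t) => //.
rewrite !derive1E (deriveM (df t) (dg t)).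
by rewrite addrC; congr (_ + _); exact: mulrC.
Qed.

Lemma derive1nD n f g : nderivable n f -> nderivable n g ->
  derive1n n.+1 (f + g) = derive1n n.+1 f + derive1n n.+1 g.
Proof.
elim: n f g => [|n IH] f g nf ng.
  by rewrite !derive1n1 derive1_addf// => t; [exact: (nf 0%N)|exact: (ng 0%N)].
have [f0 f1] := (nderivableS n f).1 nf; have [g0 g1] := (nderivableS n g).1 ng.
by rewrite derive1Sn (derive1_addf f0 g0) (IH _ _ f1 g1) -!derive1Sn.
Qed.

Lemma nderivableD n f g : nderivable n f -> nderivable n g ->
  nderivable n (f + g).
Proof.
elim: n f g => [|n IH] f g nf ng.
  by move=> [|//] t _; apply: derivableD; [exact: (nf 0%N)|exact: (ng 0%N)].
have [f0 f1] := (nderivableS n f).1 nf; have [g0 g1] := (nderivableS n g).1 ng.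
apply/nderivableS; split; first by move=> t; exact: derivableD.
by rewrite (derive1_addf f0 g0); exact: (IH _ _ f1 g1).
Qed.

Lemma nderivableM n f g : nderivable n f -> nderivable n g ->
  nderivable n (f * g).
Proof.
elim: n f g => [|n IH] f g nf ng.
  by move=> [|//] t _; apply: derivableM; [exact: (nf 0%N)|exact: (ng 0%N)].
have [f0 f1] := (nderivableS n f).1 nf; have [g0 g1] := (nderivableS n g).1 ng.
apply/nderivableS; split; first by move=> t; exact: derivableM.
rewrite (derive1_mulf f0 g0); apply: nderivableD.
  exact: (IH _ _ f1 (nderivable_le (leqnSn n) ng)).
exact: (IH _ _ (nderivable_le (leqnSn n) nf) g1).
Qed.

Lemma smoothD f g : smooth f -> smooth g -> smooth (f + g).
Proof.
move=> /smooth_nderivable sf /smooth_nderivable sg.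
by apply/smooth_nderivable => n; exact: nderivableD.
Qed.

Lemma smoothM f g : smooth f -> smooth g -> smooth (f * g).
Proof.
move=> /smooth_nderivable sf /smooth_nderivable sg.
by apply/smooth_nderivable => n; exact: nderivableM.
Qed.

Lemma smooth_derive1 f : smooth f -> smooth (derive1 f).
Proof. by move=> sf k t; rewrite -derive1Sn. Qed.

Lemma smooth_derive1n n f : smooth f -> smooth (derive1n n f).
Proof. by elim: n => [//|n IH] sf; rewrite derive1nS; apply: smooth_derive1; exact: IH. Qed.

Lemma derivable_continuous f t : derivable f t 1 -> {for t, continuous f}.
Proof. by move=> /derivable1_diffP/differentiable_continuous. Qed.

Lemma smooth_continuous f : smooth f -> continuous f.
Proof. by move=> sf t; apply: derivable_continuous; exact: (sf 0%N). Qed.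

Lemma derive1_cst_fun (c : R) : (derive1 (cst c : R -> R)) = cst 0.
Proof. by apply/funext => t; rewrite derive1_cst. Qed.

Lemma derive1n_cst0 k : derive1n k (cst 0 : R -> R) = cst 0.
Proof. by elim: k => [//|k IH]; rewrite derive1nS IH derive1_cst_fun. Qed.

Lemma smooth_cst (c : R) : smooth (cst c).
Proof.
move=> [|k] t; first exact: derivable_cst.
by rewrite derive1Sn derive1_cst_fun derive1n_cst0; exact: derivable_cst.
Qed.

Lemma derive1_oppf f : (forall t, derivable f t 1) -> (derive1 (- f)) = - (derive1 f).
Proof. move=> df; apply/funext => t; transitivity (- derive1 f t) => //.
by rewrite !derive1E deriveN. Qed.

Lemma derive1n_oppf k f : smooth f -> derive1n k (- f) = - derive1n k f.
Proof.
elim: k f => [//|k IH] f sf.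
by rewrite derive1Sn (derive1_oppf (sf 0%N)) (IH _ (smooth_derive1 sf)) -derive1Sn.
Qed.

Lemma smoothN f : smooth f -> smooth (- f).
Proof.
move=> sf; have -> : - f = (cst (-1) : R -> R) * f.
  by apply/funext => t /=; rewrite fctE /= mulN1r.
exact: (smoothM (@smooth_cst (-1)) sf).
Qed.

(** Functions defined by cases are differentiated with this: near a point inside
    one of the cases only its formula counts. *)
Lemma near_eq_derive1n k f g t : {near t, f =1 g} ->
  {near t, derive1n k f =1 derive1n k g}.
Proof.
elim: k f g t => [//|k IH] f g t fg; rewrite !derive1nS.
have /near_join := IH _ _ _ fg; apply: filterS => s fgs.
by rewrite !derive1E; exact: near_eq_derive.
Qed.

Lemma is_derive_affine (a b t : R) : is_derive t 1 (fun s => a * s + b) a.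
Proof.
apply: is_derive_eq; rewrite /GRing.scale/=; ring.
Qed.

Lemma derive1_affine_comp (a b : R) f : (forall t, derivable f t 1) ->
  (derive1 (fun t => f (a * t + b))) = (cst a : R -> R) * (fun t => (derive1 f) (a * t + b)).
Proof.
move=> df; apply/funext => t.
have Ha := is_derive_affine a b t.
have : is_derive (a * t + b) 1 f ((derive1 f) (a * t + b)).
  by rewrite derive1E; exact: derivableP.
move=> Hf; have := @is_derive1_comp R f (fun s => a * s + b) t _ _ Hf Ha => /@derive_val H.
transitivity (a * derive1 f (a * t + b)) => //.
by rewrite derive1E (mulrC a) -H.
Qed.

Lemma derivable_affine_comp (a b : R) f t : derivable f (a * t + b) 1 ->
  derivable (fun t => f (a * t + b)) t 1.
Proof.
move=> df; have Ha := is_derive_affine a b t.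
by have := @is_derive1_comp R f (fun s => a * s + b) t _ _ (derivableP df) Ha => /@ex_derive.
Qed.

Lemma derive1n_affine_comp k (a b : R) f : smooth f ->
  derive1n k (fun t => f (a * t + b)) =
  (cst (a ^+ k) : R -> R) * (fun t => derive1n k f (a * t + b)).
Proof.
elim: k f => [|k IH] f sf.
  by apply/funext => t; rewrite /= fctE /= expr0 mul1r.
rewrite derive1nS IH// derive1_mulf; last 2 first.
- by move=> t; exact: derivable_cst.
- by move=> t; apply: derivable_affine_comp; exact: sf.
rewrite derive1_cst_fun derive1_affine_comp; last by move=> t; exact: sf.
by apply/funext => t; rewrite /= !fctE /= mul0r add0r exprSr mulrA -derive1nS.
Qed.

Lemma smooth_affine_comp (a b : R) f : smooth f -> smooth (fun t => f (a * t + b)).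
Proof.
move=> sf k t; rewrite derive1n_affine_comp//.
apply: derivableM; first exact: derivable_cst.
by apply: derivable_affine_comp; exact: sf.
Qed.

Lemma nderivableV n g : (forall t, g t != 0) -> nderivable n g ->
  nderivable n (fun t => (g t)^-1).
Proof.
move=> g0; have dV t : derivable g t 1 -> derivable (fun t => (g t)^-1) t 1.
  by move=> dg; exact: derivableV.
elim: n => [ng|n IH ng]; first by move=> [|//] t _; apply: dV; exact: (ng 0%N).
have [d0 d1] := (nderivableS n g).1 ng.
apply/nderivableS; split=> [t|]; first exact: dV.
have -> : (derive1 (fun t => (g t)^-1)) =
    (cst (-1) : R -> R) * (derive1 g) * ((fun t => (g t)^-1) * (fun t => (g t)^-1)).
  apply/funext => t; rewrite derive1E deriveV//= fctE/= -derive1E.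
  rewrite /GRing.scale/= !fctE/= -exprVn; ring.
have nV := IH (nderivable_le (leqnSn n) ng).
have nc := (smooth_nderivable _).1 (@smooth_cst (-1)) n.
exact: (nderivableM (nderivableM nc d1) (nderivableM nV nV)).
Qed.

End SmoothFunctions.

(** * A smooth step *)

Section FlatFunctions.
Context {R : realType}.
Implicit Types (p : {poly R}) (t u : R) (n k : nat).

(** Treats the origin, the only point near which [flat] has no elementary formula. *)
Lemma is_derive0_quadratic (f : R -> R) (C : R) : f 0 = 0 ->
  (forall t, `|t| <= 1 -> `|f t| <= C * t ^+ 2) -> is_derive (0 : R) 1 f 0.
Proof.
move=> f0 fC.
have C0 : 0 <= C.
  have /(le_trans (normr_ge0 _)) : `|f 1| <= C * 1 ^+ 2 by apply: fC; rewrite normr1.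
  by rewrite expr1n mulr1.
have cv : (fun h : R => h^-1 *: (f (h *: (1 : R) + 0) - f 0)) @ 0^' --> (0 : R).
  apply/cvgrPdist_le => e e0; near=> h.
  rewrite sub0r normrN f0 subr0 addr0 /GRing.scale/= mulr1 normrM normfV.
  have h0 : 0 < `|h| by rewrite normr_gt0; near: h; exact: nbhs_dnbhs_neq.
  rewrite ler_pdivrMl// (le_trans (fC h _))//.
    by near: h; apply: dnbhs0_le.
  rewrite -real_normK ?num_real// expr2 mulrA -[leRHS]mulrC ler_pM2r//.
  rewrite (@le_trans _ _ ((C + 1) * `|h|))// ?ler_pM2r ?lerDl//.
  rewrite -ler_pdivlMl ?ltr_wpDl//; near: h; apply: dnbhs0_le.
  by rewrite mulr_gt0// invr_gt0 ltr_wpDl.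
apply: DeriveDef; first exact: cvgP cv.
exact: (cvg_lim _ cv).
Unshelve. all: by end_near. Qed.

Lemma exprn_le_expR n u : 0 <= u -> u ^+ n <= n%:R ^+ n * expR u.
Proof.
case: n => [|n] u0; first by rewrite !expr0 mul1r -expR0 ler_expR.
have n0 : 0 < (n.+1%:R : R) by rewrite ltr0n.
rewrite -ler_pdivrMl ?exprn_gt0// mulrC -exprVn -exprMn.
have {2}-> : u = n.+1%:R * (u / n.+1%:R).
  by rewrite mulrCA divff ?mulr1// lt0r_neq0.
rewrite (expRM_natl n.+1) lerXn2r ?nnegrE ?expR_ge0 ?divr_ge0 ?(ltW n0)//.
by rewrite (le_trans _ (expR_ge1Dx _))// lerDr.
Qed.

Lemma horner_le_exprn p u : 1 <= u ->
  `|p.[u]| <= (\sum_(i < size p) `|p`_i|) * u ^+ size p.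
Proof.
move=> u1; rewrite horner_coef (le_trans (ler_norm_sum _ _ _))// mulr_suml.
apply: ler_sum => i _; rewrite normrM ler_wpM2l// normrX ger0_norm ?(le_trans _ u1)//.
by rewrite ler_weXn2l// ltnW.
Qed.

(** The derivatives of [exp (- 1 / t)], extended by 0 to [t <= 0], are of this
    form: as the family is stable under derivation, one derivative is enough for
    smoothness. *)
Definition flat p t : R := if 0 < t then p.[t^-1] * expR (- t^-1) else 0.

(** The exponential beats the power [size p + 2] of [1 / t], which leaves a factor
    [t ^ 2]. *)
Lemma flat_quadratic p : exists C : R,
  forall t, `|t| <= 1 -> `|flat p t| <= C * t ^+ 2.
Proof.
have [n En] : exists n, n = (size p).+2 by eexists.
have [S ES] : exists S, S = \sum_(i < size p) `|p`_i| by eexists.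
have S0 : 0 <= S by rewrite ES; apply: sumr_ge0.
exists (S * n%:R ^+ n) => t t1; rewrite /flat; case: ifPn => t0; last first.
  by rewrite normr0 mulr_ge0 ?sqr_ge0// mulr_ge0// exprn_ge0.
have u1 : 1 <= t^-1 by rewrite invf_ge1// -(ger0_norm (ltW t0)).
rewrite normrM (ger0_norm (expR_ge0 _)) expRN.
rewrite ler_pdivrMr ?expR_gt0// (le_trans (horner_le_exprn p u1))// -ES.
rewrite -!(mulrA S) ler_wpM2l//.
rewrite (_ : t^-1 ^+ size p = t ^+ 2 * t^-1 ^+ n); last first.
  have tz : t * t^-1 = 1 by rewrite divff// lt0r_neq0.
  rewrite En (exprS t^-1 (size p).+1) (exprS t^-1 (size p)).
  rewrite (_ : _ * _ = (t * t^-1) * ((t * t^-1) * t^-1 ^+ size p)); last by ring.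
  by rewrite tz !mul1r.
rewrite -mulrA (mulrCA _ (t ^+ 2)) ler_wpM2l ?sqr_ge0//.
by apply: exprn_le_expR; rewrite invr_ge0 ltW.
Qed.

Lemma is_derive_flat p t : is_derive t 1 (flat p) (flat ('X^2 * (p - p^`())) t).
Proof.
have [t0|t0|->] := ltgtP t 0.
- rewrite {2}/flat ltNge (ltW t0)/=.
  apply: (@near_eq_is_derive _ _ _ (cst (0 : R))).
    near=> s; rewrite /flat ltNge ltW//=.
    by near: s; exact: lt_nbhsl.
- rewrite {2}/flat t0.
  apply: (@near_eq_is_derive R R^o R^o (fun s : R => p.[s^-1] * expR (- s^-1) : R^o) (flat p)).
    near=> s; rewrite /flat ifT//.
    by near: s; exact: lt_nbhsr.
  have di : is_derive t 1 (fun s : R => s^-1) (- t ^- 2).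
    have := @is_deriveV _ id t 1 1 (lt0r_neq0 t0) (is_derive_id _ _).
    by rewrite /GRing.scale/= mulr1.
  have dp := @is_derive1_comp _ (horner p) (fun s : R => s^-1) t _ _
    (is_derive_poly p t^-1) di.
  have dn : is_derive t 1 (fun s : R => - s^-1) (t ^- 2).
    by apply: is_derive_eq; rewrite opprK.
  have de := @is_derive1_comp _ expR (fun s : R => - s^-1) t _ _
    (is_derive_expR (- t^-1)) dn.
  have := is_deriveM dp de.
  rewrite /GRing.scale/= => H; apply: (@is_derive_eq _ _ _ _ _ _ _ _ H).
  rewrite hornerM hornerXn hornerD hornerN exprVn; ring.
- rewrite [flat _ 0]/flat ltxx.
  have [C fC] := flat_quadratic p.
  by apply: is_derive0_quadratic fC; rewrite /flat ltxx.
Unshelve. all: by end_near. Qed.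

Lemma derive1_flat p : derive1 (flat p) = flat ('X^2 * (p - p^`())).
Proof. by apply/funext => t; rewrite derive1E; case: (is_derive_flat p t). Qed.

Lemma smooth_flat p : smooth (flat p).
Proof.
move=> k; elim: k p => [|k IH] p t; first by case: (is_derive_flat p t).
by rewrite derive1Sn derive1_flat.
Qed.

(** The denominator is positive, since one of the two flat functions is; the quotient
    is 0 for [t <= 0] and 1 for [1 <= t]. *)
Definition step : R -> R :=
  flat 1 * (fun t => (flat 1 t + flat 1 (-1 * t + 1))^-1).

Lemma flat1_ge0 t : 0 <= flat 1 t.
Proof. by rewrite /flat; case: ifP => // _; rewrite hornerE mul1r expR_ge0. Qed.

Lemma flat1_gt0 t : 0 < t -> 0 < flat 1 t.
Proof. by move=> t0; rewrite /flat t0 hornerE mul1r expR_gt0. Qed.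

Lemma flat1_le0 t : t <= 0 -> flat 1 t = 0.
Proof. by rewrite /flat ltNge => ->. Qed.

Lemma step_den_gt0 t : 0 < flat 1 t + flat 1 (-1 * t + 1).
Proof.
have [t0|t0] := ltP 0 t.
  by rewrite ltr_pwDl ?flat1_gt0 ?flat1_ge0.
by rewrite ltr_wpDl ?flat1_ge0// flat1_gt0//; lra.
Qed.

Lemma smooth_step : smooth step.
Proof.
have sf := @smooth_flat 1.
have := smoothD sf (@smooth_affine_comp R (-1) 1 _ sf).
move=> /smooth_nderivable sD; apply: (smoothM sf); apply/smooth_nderivable => n.
by apply: nderivableV (sD n) => t; rewrite lt0r_neq0// step_den_gt0.
Qed.

Lemma step_le0 t : t <= 0 -> step t = 0.
Proof. by move=> t0; rewrite /step fctE /= flat1_le0// mul0r. Qed.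

Lemma step_ge1 t : 1 <= t -> step t = 1.
Proof.
move=> t1; rewrite /step fctE /= (@flat1_le0 (-1 * t + 1)); last by lra.
by rewrite addr0 divff// lt0r_neq0// flat1_gt0// (lt_le_trans _ t1).
Qed.

Lemma derive1n_step_out k t : (t < 0) || (1 < t) -> derive1n k.+1 step t = 0.
Proof.
move=> /orP[t0|t1].
- have : {near t, step =1 cst 0}.
    near=> s; apply: step_le0; apply: ltW; near: s; exact: lt_nbhsl.
  move=> /(near_eq_derive1n k.+1)/nbhs_singleton ->.
  by rewrite derive1n_cst0.
- have : {near t, step =1 cst 1}.
    near=> s; apply: step_ge1; apply: ltW; near: s; exact: lt_nbhsr.
  move=> /(near_eq_derive1n k.+1)/nbhs_singleton ->.
  by rewrite derive1Sn derive1_cst_fun derive1n_cst0.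
Unshelve. all: by end_near. Qed.

(** The derivatives are continuous on the unit interval and vanish outside. *)
Lemma derive1n_step_bounded N : exists2 M : R, 1 <= M &
  forall k t, (k <= N)%N -> `|derive1n k step t| <= M.
Proof.
have bnd k : exists M : R, forall t, 0 <= t <= 1 -> `|derive1n k step t| <= M.
  have : {within `[0 : R, 1], continuous (derive1n k step)}.
    apply: continuous_subspaceT => t.
    exact: (smooth_continuous (@smooth_derive1n R k _ smooth_step)).
  move=> cs; have cn : {within `[0 : R, 1], continuous (fun t => `|derive1n k step t|)}.
    move=> t; apply: continuous_comp; first exact: cs.
    exact: norm_continuous.
  have [c _ H] := EVT_max ler01 cn.
  by exists `|derive1n k step c| => t t01; apply: H; rewrite in_itv.
have bnd' k : exists M : R, forall t, `|derive1n k step t| <= M.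
  have [M HM] := bnd k; exists (`|M| + 1) => t.
  have [/andP[t0 t1]|] := boolP ((0 <= t) && (t <= 1)).
    rewrite (le_trans (HM t _)) ?t0// (le_trans (ler_norm M))// lerDl.
    exact: ler01.
  rewrite negb_and -!ltNge => out; case: k HM => [|k] HM; first rewrite derive1n0.
    case/orP: out => /ltW.
      by move=> /step_le0 ->; rewrite normr0 addr_ge0.
    by move=> /step_ge1 ->; rewrite normr1 lerDr.
  by rewrite (derive1n_step_out k out) normr0 addr_ge0.
elim: N => [|N [M M1 HM]].
  have [M HM] := bnd' 0%N; exists (`|M| + 1); first by rewrite lerDr.
  move=> [|//] t _; rewrite (le_trans (HM t))// (le_trans (ler_norm M))// lerDl.
  exact: ler01.
have [M' HM'] := bnd' N.+1; exists (M + `|M'|); first by rewrite (le_trans M1)// lerDl.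
move=> k t; rewrite leq_eqVlt ltnS => /orP[/eqP ->|kN].
  by rewrite (le_trans (HM' t))// (le_trans (ler_norm M'))// lerDr (le_trans ler01).
by rewrite (le_trans (HM _ t kN))// lerDl.
Qed.

End FlatFunctions.

(** * Weak derivatives and the fundamental theorem of calculus *)

Section WeakDerivatives.
Context {R : realType}.
Local Notation mu := (@lebesgue_measure R).
Implicit Types (f g F G phi : R -> R) (a b t e : R).

Lemma lebesgue_measure_segment a b : a <= b -> mu `[a, b] = (b - a)%:E.
Proof.
rewrite lebesgue_measure_itv/= lte_fin le_eqVlt => /predU1P[->|->] //.
by rewrite ltxx subrr.
Qed.

Lemma locally_integrable_itv f a b : locally_integrable [set: R] f ->
  mu.-integrable `[a, b] (EFin \o f).
Proof.
move=> [mf _ lf]; apply/integrableP; split.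
  by apply/measurable_EFinP; exact: (measurable_funS measurableT (@subsetT _ _) mf).
exact: (lf _ (@subsetT _ _) (@segment_compact R a b)).
Qed.

Lemma continuous_integrable_itv f a b : continuous f ->
  mu.-integrable `[a, b] (EFin \o f).
Proof.
move=> cf; apply: continuous_compact_integrable; first exact: segment_compact.
exact: continuous_subspaceT.
Qed.

Lemma continuous_locally_integrable f : continuous f ->
  locally_integrable [set: R] f.
Proof.
move=> cf; split; [exact: continuous_measurable_fun|exact: openT|].
move=> K _ cK; have /integrableP[_] : mu.-integrable K (EFin \o f).
  by apply: continuous_compact_integrable => //; exact: continuous_subspaceT.
by [].
Qed.

Lemma integral_support f a b : (forall t, f t != 0 -> t \in `[a, b]) ->
  (\int[mu]_t (f t)%:E = \int[mu]_(t in `[a, b]) (f t)%:E)%E.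
Proof.
move=> fab; rewrite [RHS]integral_mkcond; apply: eq_integral => t _.
rewrite patchE; case: ifPn => //; rewrite mem_setE => tab.
by have [->//|/fab] := eqVneq (f t) 0; rewrite (negbTE tab).
Qed.

Lemma derivable_LRcontinuous F a b : (forall t, derivable F t 1) ->
  derivable_oo_LRcontinuous F a b.
Proof.
move=> dF; have cF : continuous F by move=> t; apply: derivable_continuous.
split=> [t _||]; first exact: dF.
- exact: (cvg_at_right_filter (cF a)).
- exact: (cvg_at_left_filter (cF b)).
Qed.

Lemma Rintegral_derive1 F a b : a <= b -> (forall t, derivable F t 1) ->
  continuous (derive1 F) ->
  (\int[mu]_(t in `[a, b]) (derive1 F t)%:E)%E = (F b - F a)%:E.
Proof.
rewrite le_eqVlt => /predU1P[<-|ab] dF cF.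
  by rewrite set_itv1 integral_set1 subrr.
rewrite EFinB; apply: (continuous_FTC2 ab).
- exact: continuous_subspaceT.
- exact: derivable_LRcontinuous.
- by [].
Qed.

Lemma test_function_bounded phi : test_function phi ->
  exists2 a, 0 < a & forall t, phi t != 0 -> t \in `[- a, a].
Proof.
move=> [_ /compact_bounded[M [_ HM]]].
exists (`|M| + 1); first by rewrite ltr_wpDl.
move=> t phit; rewrite in_itv/= -ler_norml; apply: HM.
  by rewrite (le_lt_trans (ler_norm M))// ltrDl.
exact: subset_closure.
Qed.

Lemma derive1_support phi a : (forall t, phi t != 0 -> t \in `[- a, a]) ->
  forall t, derive1 phi t != 0 -> t \in `[- a, a].
Proof.
move=> supp t; apply: contraNT => tout; apply/eqP.
have : {near t, phi =1 cst 0}.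
  have : t \in [set s | s \notin `[- a, a]] by rewrite inE.
  rewrite (_ : [set s | _] = ~` `[- a, a]); last first.
    by apply/seteqP; split=> s /= /negP.
  have oS : open (~` `[- a, a]%classic) by apply: closed_openC; exact: interval_closed.
  rewrite inE => tS; have := open_nbhs_nbhs (conj oS tS); apply: filterS => s /= sout.
  by apply/eqP; apply: contraT => /supp.
move=> /(near_eq_derive1n 1)/nbhs_singleton; rewrite !derive1n1 => ->.
by rewrite derive1_cst_fun.
Qed.

(** Integration by parts: no boundary term survives against a test function. *)
Lemma is_weak_derive_classical F : (forall t, derivable F t 1) ->
  continuous (derive1 F) -> is_weak_derive F (derive1 F).
Proof.
move=> dF cF'; have cF : continuous F by move=> t; apply: derivable_continuous.
split; [exact: continuous_locally_integrable..|move=> phi tphi].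
have [a a0 supp] := test_function_bounded tphi.
have sphi : smooth phi by case: tphi.
have suppE t : phi t != 0 -> t \in `[- (a + 1), a + 1].
  by move=> /supp; rewrite !in_itv/= => /andP[? ?]; apply/andP; split; lra.
have phi0 t : t \notin `[- a, a] -> phi t = 0.
  by move=> tout; apply/eqP; apply: contraT => /supp; rewrite (negbTE tout).
rewrite (@integral_support _ (- (a + 1)) (a + 1)); last first.
  move=> t; have [->|H _] := eqVneq (derive1 phi t) 0; first by rewrite mulr0 eqxx.
  exact: (derive1_support suppE).
rewrite (@integral_support (fun t => derive1 F t * phi t) (- (a + 1)) (a + 1)); last first.
  by move=> t; have [->|H _] := eqVneq (phi t) 0; [rewrite mulr0 eqxx|exact: suppE].
have ab : - (a + 1) < a + 1 by lra.
have cab f : continuous f -> {within `[- (a + 1), a + 1], continuous f}.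
  exact: continuous_subspaceT.
have cphi' := smooth_continuous (smooth_derive1 sphi).
rewrite (@integration_by_parts _ F phi (derive1 F) (derive1 phi) _ _ ab (cab _ cF')
  (derivable_LRcontinuous _ _ dF) (fun _ _ => erefl) (cab _ cphi')
  (derivable_LRcontinuous _ _ (sphi 0%N)) (fun _ _ => erefl)).
rewrite !phi0 ?mulr0 ?subrr ?sub0e//; rewrite in_itv/=; apply/negP => /andP[]; lra.
Qed.

(** [ramp e a] climbs from 0 to 1 on [[a, a + e]]. *)
Definition ramp e a t : R := step (e^-1 * t + - (e^-1 * a)).

Lemma rampE e a t : ramp e a t = step ((t - a) / e).
Proof. by rewrite /ramp -mulrBr mulrC. Qed.

Lemma smooth_ramp e a : smooth (ramp e a).
Proof. exact: (smooth_affine_comp (@smooth_step R)). Qed.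

Lemma ramp_le e a t : 0 < e -> t <= a -> ramp e a t = 0.
Proof. by move=> e0 ta; rewrite rampE step_le0// pmulr_lle0 ?invr_gt0// subr_le0. Qed.

Lemma ramp_ge e a t : 0 < e -> a + e <= t -> ramp e a t = 1.
Proof. by move=> e0 ta; rewrite rampE step_ge1// ler_pdivlMr// mul1r lerBrDl. Qed.

Lemma derive1_rampE e a t : derive1 (ramp e a) t = e^-1 * derive1 step ((t - a) / e).
Proof.
rewrite /ramp (derive1_affine_comp _ _ (@smooth_step R 0%N)).
by rewrite fctE/= -mulrBr (mulrC e^-1 (t - a)).
Qed.

Lemma derive1_ramp_out e a t : 0 < e -> (t < a) || (a + e < t) ->
  derive1 (ramp e a) t = 0.
Proof.
move=> e0 out; rewrite derive1_rampE -derive1n1 derive1n_step_out ?mulr0//.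
by rewrite pmulr_llt0 ?invr_gt0// subr_lt0 ltr_pdivlMr// mul1r ltrBrDl.
Qed.

(** These test functions tend to the indicator of the segment from [a] to [b] as
    [e] tends to 0. *)
Lemma test_function_trapezoid e a b : 0 < e -> a <= b ->
  test_function (ramp e a - ramp e b).
Proof.
move=> e0 ab; split; first exact: (smoothD (@smooth_ramp e a) (smoothN (@smooth_ramp e b))).
apply: (@subclosed_compact _ _ `[a, b + e]); [exact: closed_closure|exact: segment_compact|].
have /closure_id -> : closed `[a, b + e]%classic by exact: interval_closed.
apply: closureS => t; apply: contra_neqP => /negP.
rewrite in_itv/= negb_and -!ltNge => /orP[ta|tb].
- have tb := lt_le_trans ta ab.
  by rewrite -[LHS]/(ramp e a t - ramp e b t) !ramp_le ?subrr// ltW.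
- have ta : a + e < t by rewrite (le_lt_trans _ tb)// lerD2r.
  by rewrite -[LHS]/(ramp e a t - ramp e b t) !ramp_ge ?subrr// ltW.
Qed.

Lemma smooth_derive1_continuous F : smooth F -> continuous (derive1 F).
Proof. by move=> sF; exact: (smooth_continuous (smooth_derive1 sF)). Qed.

Lemma Rintegral_ramp e a : 0 < e ->
  \int[mu]_(t in `[a, a + e]) derive1 (ramp e a) t = 1.
Proof.
move=> e0; rewrite /Rintegral Rintegral_derive1/=.
- by rewrite ramp_ge// ramp_le// subr0.
- by rewrite lerDl ltW.
- exact: (@smooth_ramp e a 0%N).
- exact: (smooth_derive1_continuous (@smooth_ramp e a)).
Qed.

(** The derivatives of the ramps are an approximate identity. *)
Lemma mollify_ramp G a (d : R) : continuous G -> 0 < d ->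
  exists2 r : R, 0 < r & forall e, 0 < e -> e < r ->
    `|\int[mu]_(t in `[a, a + e]) (G t * derive1 (ramp e a) t) - G a| <= d.
Proof.
move=> cG d0; have [M M1 HM] := @derive1n_step_bounded R 1.
have M0 : 0 < M by exact: lt_le_trans M1.
have /cvgrPdist_le /(_ (d / M) (divr_gt0 d0 M0)) := cG a.
move=> /nbhs_ballP[r /= r0 Hr]; exists r => // e e0 er.
have cr := smooth_derive1_continuous (@smooth_ramp e a).
have cGr : continuous (fun t => G t * derive1 (ramp e a) t).
  by move=> t; apply: cvgM; [exact: cG|exact: cr].
have cGa : continuous (fun t => G a * derive1 (ramp e a) t).
  by move=> t; apply: cvgM; [exact: cvg_cst|exact: cr].
have -> : G a = \int[mu]_(t in `[a, a + e]) (G a * derive1 (ramp e a) t).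
  rewrite RintegralZl ?Rintegral_ramp ?mulr1//.
  exact: continuous_integrable_itv.
rewrite -RintegralB; [|by []|exact: continuous_integrable_itv..].
apply: le_trans (le_normr_Rintegral _ _) _ => //.
  apply: continuous_integrable_itv => t.
  by apply: cvgB; [exact: cGr|exact: cGa].
apply: (@le_trans _ _ (\int[mu]_(t in `[a, a + e]) (d / e))).
  apply: le_Rintegral => //.
  - apply: continuous_integrable_itv => t.
    apply: cvg_norm; apply: cvgB; [exact: cGr|exact: cGa].
  - apply: continuous_integrable_itv => t; exact: cvg_cst.
  - move=> t /=; rewrite in_itv/= => /andP[ta tae].
    rewrite -mulrBl normrM derive1_rampE normrM (@gtr0_norm _ e^-1) ?invr_gt0//.
    rewrite mulrCA mulrC ler_pM2r ?invr_gt0// -[d](@divfK _ M) ?lt0r_neq0//.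
    apply: ler_pM => //; last by rewrite -derive1n1 HM.
    rewrite distrC; apply: Hr; rewrite /ball/= distrC ger0_norm ?subr_ge0//.
    by rewrite ltrBlDl (le_lt_trans tae)// ltrD2l.
rewrite (Rintegral_cst mu (measurable_itv `[a, a + e])).
have aae : a <= a + e by rewrite lerDl ltW.
rewrite [X in fine X](lebesgue_measure_segment aae).
by rewrite addrAC subrr add0r/= divfK// lt0r_neq0.
Qed.

(** As [e] tends to 0, the two sides tend to the increment of [G] and to the
    integral of [g]. *)
Lemma weak_derive_ramps G g a b e : continuous G -> is_weak_derive G g ->
  0 < e -> a <= b ->
  ((\int[mu]_(t in `[b, b + e]) (G t * derive1 (ramp e b) t) -
    \int[mu]_(t in `[a, a + e]) (G t * derive1 (ramp e a) t))%:E =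
  \int[mu]_t (g t * (ramp e a - ramp e b) t)%:E)%E.
Proof.
move=> cG [_ _ wG] e0 ab; have := wG _ (test_function_trapezoid e0 ab).
rewrite derive1_addf; [|exact: (@smooth_ramp e a 0%N)|exact: (@smoothN R _ (@smooth_ramp e b) 0%N)].
rewrite (derive1_oppf (@smooth_ramp e b 0%N)).
move=> /(congr1 oppe); rewrite oppeK => <-.
have cr c : continuous (fun t => G t * derive1 (ramp e c) t).
  move=> t; apply: cvgM; first exact: cG.
  exact: (smooth_derive1_continuous (@smooth_ramp e c)).
have suppr c t : G t * derive1 (ramp e c) t != 0 -> t \in `[c, c + e].
  apply: contraNT; rewrite in_itv/= negb_and -!ltNge => out.
  by rewrite derive1_ramp_out ?mulr0.
have loc c : a <= c -> c <= b ->
    \int[mu]_(t in `[c, c + e]) (G t * derive1 (ramp e c) t) =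
    \int[mu]_(t in `[a, b + e]) (G t * derive1 (ramp e c) t).
  move=> ac cb; congr fine.
  transitivity (\int[mu]_t (G t * derive1 (ramp e c) t)%:E)%E.
    by symmetry; apply: integral_support => t; exact: suppr.
  apply: integral_support => t /suppr; rewrite !in_itv/= => /andP[ct tc].
  by rewrite (le_trans ac ct)/= (le_trans tc)// lerD2r.
rewrite !loc// -RintegralB//; [|exact: continuous_integrable_itv..].
rewrite (@integral_support _ a (b + e)); last first.
  move=> t; rewrite -[(_ - _) t]/(derive1 (ramp e a) t - derive1 (ramp e b) t) mulrBr.
  have [->|H] := eqVneq (G t * derive1 (ramp e a) t) 0; last first.
    have := suppr _ _ H; rewrite !in_itv/= => /andP[ct tc] _.
    by rewrite ct/= (le_trans tc)// lerD2r.
  rewrite sub0r oppr_eq0 => /suppr; rewrite !in_itv/= => /andP[ct tc].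
  by rewrite tc (le_trans ab).
rewrite /Rintegral fineK; last first.
  apply: integrable_fin_num => //; apply: continuous_integrable_itv => t.
  by apply: cvgB; exact: cr.
rewrite -integralN/=; last first.
  have H : mu.-integrable `[a, b + e]
      (EFin \o (fun t => G t * (derive1 (ramp e a) - derive1 (ramp e b)) t)).
    apply: continuous_integrable_itv => t; apply: cvgM; first exact: cG.
    by apply: cvgB; exact: (smooth_derive1_continuous (@smooth_ramp _ _)).
  by apply: integrable_add_def; [exact: measurable_itv|exact: H].
apply: eq_integral => t _ /=; congr EFin.
rewrite -[(_ - _) t]/(derive1 (ramp e a) t - derive1 (ramp e b) t).
by rewrite mulrBr opprB.
Qed.

(** Testing against trapezoids that converge to an indicator recovers the
    fundamental theorem of calculus. *)
Lemma weak_derive_FTC G g a b : continuous G -> is_weak_derive G g -> a <= b ->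
  (\int[mu]_(t in `[a, b]) (g t)%:E)%E = (G b - G a)%:E.
Proof.
move=> cG wG ab; have [_ lg _] := wG.
have [M M1 HM] := @derive1n_step_bounded R 0.
have M0 : 0 < M by exact: lt_le_trans M1.
pose e n : R := n.+1%:R^-1.
have e0 n : 0 < e n by rewrite invr_gt0.
have e1 n : e n <= 1 by rewrite invf_le1// ler1n.
pose fn n t := (g t * (ramp (e n) a - ramp (e n) b) t)%:E.
pose f := (EFin \o g) \_ `]a, b].
have mg : measurable_fun `[a, b + 1] g.
  by have [mg _ _] := lg; exact: (measurable_funS measurableT (@subsetT _ _) mg).
(* As [e n <= 1], all the trapezoids are supported by the segment up to [b + 1]. *)
have [] := @dominated_convergence _ _ _ mu `[a, b + 1] _ fn f
  (fun t => (2 * M * `|g t|)%:E).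
- exact: measurable_itv.
- move=> n; apply/measurable_EFinP; apply: measurable_funM => //.
  apply: (measurable_funS measurableT (@subsetT _ _)).
  apply: continuous_measurable_fun.
  exact: (smooth_continuous (smoothD (@smooth_ramp _ _) (smoothN (@smooth_ramp _ _)))).
- apply: (iffLR (measurable_restrict (EFin \o g) (measurable_itv _) (measurable_itv _))).
  apply: (@measurable_funS _ _ _ _ `[a, b + 1]) => //.
  exact/measurable_EFinP.
- apply: aeW => t; rewrite /= in_itv/= => /andP[at1 tb1].
  rewrite /f patchE; case: ifPn; rewrite mem_setE in_itv/=.
    move=> /andP[at2 tb2]; have ta0 : 0 < t - a by rewrite subr_gt0.
    apply: cvg_near_cst; near=> n.
    rewrite /fn -[(_ - _) t]/(ramp (e n) a t - ramp (e n) b t).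
    rewrite ramp_ge// ?ramp_le ?subr0 ?mulr1//.
    by rewrite -lerBrDl; apply: ltW; near: n; exact: (near_infty_natSinv_lt (PosNum ta0)).
  rewrite negb_and -leNgt -ltNge => /orP[ta|bt].
    apply: cvg_near_cst; near=> n.
    rewrite /fn -[(_ - _) t]/(ramp (e n) a t - ramp (e n) b t).
    by rewrite !ramp_le ?subrr ?mulr0// (le_trans ta).
  have tb0 : 0 < t - b by rewrite subr_gt0.
  apply: cvg_near_cst; near=> n.
  rewrite /fn -[(_ - _) t]/(ramp (e n) a t - ramp (e n) b t).
  have : b + e n <= t.
    by rewrite -lerBrDl; apply: ltW; near: n; exact: (near_infty_natSinv_lt (PosNum tb0)).
  move=> bt'; rewrite !ramp_ge ?subrr ?mulr0//.
  by rewrite (le_trans _ bt')// lerD2r.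
- have := locally_integrable_itv a (b + 1) lg => /integrable_norm.
  by move=> /(integrableZl _ (2 * M)); exact.
- apply: aeW => t n _; rewrite /fn lee_fin normrM mulrC ler_wpM2r//.
  rewrite -[(_ - _) t]/(ramp (e n) a t - ramp (e n) b t).
  rewrite (le_trans (ler_normB _ _))// mulr_natl mulr2n lerD// rampE; exact: (HM 0%N).
move=> _ _; rewrite (_ : (\int[mu]_(t in `[a, (b + 1)%R]) f t = \int[mu]_(t in `[a, b]) (g t)%:E)%E); last first.
  rewrite /f -integral_mkcondr (_ : _ `&` _ = `]a, b]%classic).
    apply: (@integral_itv_obnd_cbnd R a (BRight b) (EFin \o g)).
    apply/measurable_EFinP; have [mg' _ _] := lg.
    exact: (measurable_funS measurableT (@subsetT _ _) mg').
  apply/seteqP; split=> t /=; rewrite !in_itv/=; first by case.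
  move=> /andP[at1 tb]; rewrite at1 tb; split=> //.
  by rewrite (ltW at1) (le_trans tb)// lerDl.
move=> cvI; have gfin : (\int[mu]_(t in `[a, b]) (g t)%:E)%E \is a fin_num.
  apply: integrable_fin_num => //; exact: locally_integrable_itv.
rewrite -(fineK gfin); congr EFin; rewrite -(fineK gfin) in cvI.
apply/eqP; rewrite -subr_eq0 -normr_le0; apply/ler_addgt0Pr => d d0; rewrite add0r.
have d3 : 0 < d / 3 by rewrite divr_gt0.
have [ra ra0 Ha] := mollify_ramp a cG d3.
have [rb rb0 Hb] := mollify_ramp b cG d3.
have /fine_cvgP[_ /cvgrPdist_le/(_ _ d3)] := cvI.
move=> [N _ HN].
have [n [nN na nb]] : exists n, [/\ (N <= n)%N, e n < ra & e n < rb].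
  have H1 : \forall n \near \oo, e n < ra by exact: (near_infty_natSinv_lt (PosNum ra0)).
  have H2 : \forall n \near \oo, e n < rb by exact: (near_infty_natSinv_lt (PosNum rb0)).
  have H3 : \forall n \near \oo, (N <= n)%N by exact: nbhs_infty_ge.
  near \oo => n; exists n; split; near: n; by [].
have := HN n nN; rewrite /= /fn.
rewrite -(@integral_support (fun t => g t * (ramp (e n) a - ramp (e n) b) t)); last first.
  move=> t.
  rewrite -[(_ - _) t]/(ramp (e n) a t - ramp (e n) b t).
  apply: contraNT; rewrite in_itv/= negb_and -!ltNge => /orP[ta|tb].
    by rewrite !ramp_le ?subrr ?mulr0// ltW// (lt_le_trans ta).
  have bt' : b + e n <= t by rewrite (le_trans _ (ltW tb))// lerD2l.
  rewrite !ramp_ge ?subrr ?mulr0//.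
  by rewrite (le_trans _ bt')// lerD2r.
rewrite -(weak_derive_ramps cG wG (e0 n) ab)/=.
have := Ha _ (e0 n) na; have := Hb _ (e0 n) nb.
move: (\int[mu]_(t in `[b, b + e n]) _) (\int[mu]_(t in `[a, a + e n]) _) (fine _).
move=> I1 I2 I3 {}Hb {}Ha HI.
have -> : I3 - (G b - G a) = (I3 - (I1 - I2)) + (I1 - G b) - (I2 - G a) by ring.
have -> : d = d / 3 + d / 3 + d / 3 by field.
by rewrite (le_trans (ler_normB _ _))// lerD// (le_trans (ler_normD _ _))// lerD.
Unshelve. all: by end_near. Qed.

#[global] Instance ae_lebesgue_filter : Filter (nbhs (almost_everywhere mu)).
Proof. exact: (ae_filter_ringOfSetsType mu). Qed.

(** At almost every point the integrand is the derivative of its integral. *)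
Lemma FTC_ae_unique g1 g2 a :
  locally_integrable [set: R] g1 -> locally_integrable [set: R] g2 ->
  (forall b, \int[mu]_(t in `[a, b]) g1 t = \int[mu]_(t in `[a, b]) g2 t) ->
  {ae mu, forall t, a < t -> g1 t = g2 t}.
Proof.
move=> l1 l2 g12.
have A1 := FTC1 (a := BLeft a) (fun y => locally_integrable_itv a y l1) l1.
have A2 := FTC1 (a := BLeft a) (fun y => locally_integrable_itv a y l2) l2.
move: A1 A2; apply: filterS2 => t /= H1 H2 at1.
have aB : (a%:E < t%:E)%E by rewrite lte_fin.
have [_ <-] := H1 aB; have [_ <-] := H2 aB.
by congr (derive1 _ t); apply/funext => b; exact: g12.
Qed.

(** Two weak derivatives have the same integrals over all segments, so they agree
    at every Lebesgue point. *)
Lemma weak_derive_unique G g1 g2 : continuous G ->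
  is_weak_derive G g1 -> is_weak_derive G g2 -> g1 = g2 %[ae mu].
Proof.
move=> cG w1 w2; have [_ l1 _] := w1; have [_ l2 _] := w2.
have H n : {ae mu, forall t, - n%:R < t -> g1 t = g2 t}.
  apply: FTC_ae_unique => // b; congr fine.
  have [nb|bn] := leP (- n%:R) b.
    by rewrite (weak_derive_FTC cG w1 nb) (weak_derive_FTC cG w2 nb).
  by rewrite !set_itv_ge ?integral_set0// bnd_simp -ltNge.
have := ae_foralln H.
apply: filterS => t Ht _; apply: (Ht (Num.truncn `|t|).+1).
by rewrite ltrNl (le_lt_trans (ler_norm _))// normrN Num.Theory.truncnS_gt.
Qed.

Lemma weak_derive_spec G g : is_weak_derive G g -> is_weak_derive G (weak_derive G).
Proof. by move=> wg; rewrite /weak_derive; case: xgetP => [h -> //|/(_ g)]. Qed.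

(** [weak_derive] is an arbitrary weak derivative; this lets the norms be computed
    with the classical one. *)
Lemma weak_derive_classical_ae F : (forall t, derivable F t 1) ->
  continuous (derive1 F) -> weak_derive F = derive1 F %[ae mu].
Proof.
move=> dF cF'; have cF : continuous F by move=> t; apply: derivable_continuous.
have wF := is_weak_derive_classical dF cF'.
exact: (weak_derive_unique cF (weak_derive_spec wF) wF).
Qed.

End WeakDerivatives.

(** * Divided differences and interpolating polynomials *)

Section DividedDifferences.
Context {R : realType}.
Implicit Types (f F G : R -> R) (y : nat -> R) (k i j l n : nat) (p q : {poly R}).

(** The nodes are indexed by all natural numbers, so that a shift of the window is
    a composition with [succn]. *)
Definition dd k f y : R := divided_difference f (fun j : 'I_k.+1 => y j).

Definition nodal k y : {poly R} := \prod_(l < k) ('X - (y l)%:P).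

Definition interpolant k f y : {poly R} :=
  \sum_(i < k.+1) (f (y i) / \prod_(j < k.+1 | j != i) (y i - y j)) *:
    \prod_(j < k.+1 | j != i) ('X - (y j)%:P).

Lemma horner_nodal k y t : (nodal k y).[t] = \prod_(l < k) (t - y l).
Proof.
by rewrite /nodal horner_prod; apply: eq_bigr => l _; rewrite !hornerE.
Qed.

Lemma nodal_root k y i : (i < k)%N -> (nodal k y).[y i] = 0.
Proof.
move=> ik; rewrite horner_nodal (bigD1 (Ordinal ik))//= subrr mul0r.
by [].
Qed.

Lemma monic_nodal k y : nodal k y \is monic.
Proof. by apply: monic_prod => l _; exact: monicXsubC. Qed.

Lemma size_nodal k y : size (nodal k y) = k.+1.
Proof. by rewrite /nodal size_prod_XsubC /index_enum -enumT size_enum_ord. Qed.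

Lemma nodalS k y : nodal k.+1 y = ('X - (y 0%N)%:P) * nodal k (y \o succn).
Proof. by rewrite /nodal big_ord_recl. Qed.

Lemma nodalSr k y : nodal k.+1 y = nodal k y * ('X - (y k)%:P).
Proof. by rewrite /nodal big_ord_recr. Qed.

Lemma size_nodal_others k y (i : 'I_k.+1) :
  size (\prod_(j < k.+1 | j != i) ('X - (y j)%:P)) = k.+1.
Proof.
rewrite -big_filter size_prod_XsubC -sum1_size big_filter.
by rewrite (sum1_card (predC1 i)) cardC1 card_ord.
Qed.

Lemma size_interpolant k f y : (size (interpolant k f y) <= k.+1)%N.
Proof.
apply: (leq_trans (size_sum _ _ _)); apply/bigmax_leqP => i _.
apply: (leq_trans (size_scale_leq _ _)).
by rewrite size_nodal_others.
Qed.

Lemma coef_interpolant k f y : (interpolant k f y)`_k = dd k f y.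
Proof.
rewrite /interpolant coef_sum /dd /divided_difference; apply: eq_bigr => i _.
rewrite coefZ [X in _ * X](_ : _ = 1) ?mulr1//.
set q := \prod_(j < _ | _) _.
have sq : size q = k.+1 by exact: size_nodal_others.
have : q \is monic by apply: monic_prod => l _; exact: monicXsubC.
by rewrite monicE lead_coefE sq => /eqP.
Qed.

Section InjectiveNodes.
Variable y : nat -> R.
Hypothesis yI : injective y.

Lemma horner_interpolant k f i : (i <= k)%N -> (interpolant k f y).[y i] = f (y i).
Proof.
rewrite -ltnS => ik; rewrite /interpolant horner_sum (bigD1 (Ordinal ik))//=.
rewrite [X in _ + X]big1 ?addr0; last first.
  move=> j ji; rewrite hornerZ horner_prod [X in _ * X](bigD1 (Ordinal ik)) 1?eq_sym//=.
  by rewrite (hornerXsubC (y i) (y i)) subrr mul0r mulr0.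
rewrite hornerZ horner_prod; under [X in _ * X]eq_bigr do rewrite !hornerE.
rewrite divfK//; apply/prodf_neq0 => j; rewrite subr_eq0; apply: contraNneq.
by move=> /yI ij; apply/eqP/val_inj.
Qed.

Lemma poly_nodes_eq0 k p : (size p <= k)%N ->
  (forall i, (i < k)%N -> p.[y i] = 0) -> p = 0.
Proof.
move=> sp p0; apply/eqP; apply: contraTT sp => pn0; rewrite -ltnNge.
have := @max_poly_roots _ p (map y (iota 0 k)) pn0; rewrite size_map size_iota; apply.
- apply/allP => _ /mapP[i + ->]; rewrite mem_iota add0n => /andP[_ ik].
  by apply/eqP; exact: p0.
- by rewrite map_inj_uniq// iota_uniq.
Qed.

Lemma interpolant_unique k f p : (size p <= k.+1)%N ->
  (forall i, (i <= k)%N -> p.[y i] = f (y i)) -> p = interpolant k f y.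
Proof.
move=> sp pf; apply/eqP; rewrite -subr_eq0; apply/eqP.
apply: (@poly_nodes_eq0 k.+1) => [|i ik].
  by rewrite (leq_trans (size_polyD _ _))// geq_max sp size_polyN size_interpolant.
by rewrite !hornerE pf// horner_interpolant// subrr.
Qed.

Lemma size_sub_top k f z : (size (interpolant k.+1 f y - dd k.+1 f y *: nodal k.+1 z)%R <= k.+1)%N.
Proof.
apply/leq_sizeP => j; rewrite leq_eqVlt => /predU1P[<-|kj].
  rewrite coefB coefZ coef_interpolant.
  have := monic_nodal k.+1 z; rewrite monicE lead_coefE size_nodal => /eqP ->.
  by rewrite mulr1 subrr.
rewrite coefB coefZ !nth_default ?mulr0 ?subrr ?size_nodal//.
by rewrite (leq_trans (size_interpolant _ _ _)).
Qed.

End InjectiveNodes.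

(** Both sides have degree [k + 1] with the same leading coefficient, so their
    difference is determined by the first [k + 1] nodes. *)
Lemma interpolantSr k f y : injective y ->
  interpolant k.+1 f y = interpolant k f y + dd k.+1 f y *: nodal k.+1 y.
Proof.
move=> yI; apply/eqP; rewrite -subr_eq; apply/eqP; apply: interpolant_unique => //.
  exact: size_sub_top.
move=> i ik; rewrite !hornerE horner_interpolant ?(leq_trans ik)//.
by rewrite nodal_root// mulr0 subr0.
Qed.

Lemma interpolantSl k f y : injective y ->
  interpolant k.+1 f y = interpolant k f (y \o succn) + dd k.+1 f y *: nodal k.+1 (y \o succn).
Proof.
move=> yI; have ySI : injective (y \o succn) by apply: inj_comp => // ? ? [].
apply/eqP; rewrite -subr_eq; apply/eqP; apply: (interpolant_unique ySI).
  exact: size_sub_top.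
move=> i ik; rewrite !hornerE /= (horner_interpolant yI)//.
by rewrite (@nodal_root k.+1 (y \o succn) i)// mulr0 subr0.
Qed.

(** Two Lagrange interpolants on consecutive windows agree on the nodes that the
    windows share, so their difference is a multiple of the nodal polynomial. *)
Lemma interpolant_shift k f y : injective y ->
  interpolant k f (y \o succn) - interpolant k f y =
  ((y k.+1 - y 0%N) * dd k.+1 f y) *: nodal k (y \o succn).
Proof.
move=> yI; have := interpolantSl k f yI; rewrite interpolantSr// nodalS nodalSr.
move: (interpolant k f y) (interpolant k f (y \o succn)) (nodal k (y \o succn)) => A B N.
move: (dd k.+1 f y) => d E.
have {E}-> : B = A + d *: (('X - (y 0%N)%:P) * N) - d *: (N * ('X - (y k.+1)%:P)).
  by rewrite E addrK.
rewrite -!mul_polyC polyCM polyCB; ring.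
Qed.

(** Leading coefficients in [interpolant_shift]. *)
Lemma ddS k f y : injective y ->
  dd k f (y \o succn) - dd k f y = (y k.+1 - y 0%N) * dd k.+1 f y.
Proof.
move=> yI; have := congr1 (coefp k) (interpolant_shift k f yI).
rewrite /coefp coefB !coef_interpolant coefZ.
have := monic_nodal k (y \o succn); rewrite monicE lead_coefE size_nodal => /eqP ->.
by rewrite mulr1.
Qed.

Lemma interpolant_newton k f y : injective y ->
  interpolant k f y = \sum_(i < k.+1) dd i f y *: nodal i y.
Proof.
move=> yI; elim: k => [|k IH]; last by rewrite big_ord_recr/= interpolantSr// IH.
rewrite big_ord_recl big_ord0 addr0 /= /nodal big_ord0.
symmetry; apply: (interpolant_unique yI).
  by rewrite (leq_trans (size_scale_leq _ _))// size_poly1.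
move=> [|//] _; rewrite hornerZ hornerC mulr1 /dd /divided_difference.
by rewrite big_ord_recl big_ord0 addr0 big_pred0 ?divr1// => -[[]].
Qed.

(** Each derivation loses one zero and keeps the others between the first and the
    last. *)
Lemma Rolle_iter k (g : R -> R) y : (forall i, (i < k)%N -> y i < y i.+1) ->
  (forall j t, (j < k)%N -> derivable (derive1n j g) t 1) ->
  (forall i, (i <= k)%N -> g (y i) = 0) ->
  exists2 xi, y 0%N <= xi <= y k & derive1n k g xi = 0.
Proof.
elim: k g y => [|k IH] g y yinc dg g0.
  by exists (y 0%N); rewrite ?lexx//; exact: g0.
have rolle i : exists z, (i <= k)%N -> y i < z < y i.+1 /\ derive1 g z = 0.
  case: (leqP i k) => ik; last by exists 0.
  have := @Rolle R g (y i) (y i.+1) (yinc i ik) (fun t _ => dg 0%N t (ltn0Sn k)).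
  case.
  - apply: continuous_subspaceT => t; apply: derivable_continuous; exact: (dg 0%N).
  - by rewrite !g0// ltnW.
  - move=> z; rewrite in_itv/= => zi [dz dz0]; exists z => _; split=> //.
    by rewrite derive1E.
have /choice[z Hz] := rolle.
have [i ik|j t jk|i ik|xi xiz dxi] := IH (derive1 g) z.
- have [/andP[_ H1] _] := Hz i (ltnW ik); have [/andP[H2 _] _] := Hz i.+1 ik.
  exact: lt_trans H1 H2.
- by rewrite -derive1Sn; exact: dg.
- by have [] := Hz i ik.
- exists xi; last by rewrite derive1Sn.
  have [/andP[H1 _] _] := Hz 0%N (leq0n k); have [/andP[_ H2] _] := Hz k (leqnn k).
  case/andP: xiz => xi0 xik.
  by rewrite (le_trans (ltW H1) xi0) (le_trans xik (ltW H2)).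
Qed.

Lemma derive1n_horner k p : derive1n k (horner p) = horner (p^`(k)).
Proof.
by elim: k => [|k IH]; [rewrite derivn0|rewrite derive1nS IH derivnS -derivE].
Qed.

Lemma derive1n_subf k f (g : R -> R) :
  (forall j t, (j < k)%N -> derivable (derive1n j f) t 1) ->
  smooth g ->
  derive1n k (f - g) = derive1n k f - derive1n k g /\
  (forall j t, (j < k)%N -> derivable (derive1n j (f - g)) t 1).
Proof.
case: k => [|k] df sg; first by split=> // j t; rewrite ltn0.
have nf : nderivable k f by move=> j t jk; exact: df.
have nN : nderivable k (- g) := (smooth_nderivable _).1 (smoothN sg) k.
split; last by move=> j t jk; exact: (nderivableD nf nN).
rewrite derive1nD//; congr (_ + _).
exact: derive1n_oppf.
Qed.

Lemma smooth_horner p : smooth (horner p).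
Proof. by move=> k t; rewrite derive1n_horner; exact: derivable_horner. Qed.

(** Mean value form of divided differences: the error of Lagrange interpolation
    has [k + 1] zeros, so its [k]-th derivative has one. *)
Lemma dd_mean_value k F y : injective y -> (forall i, (i < k)%N -> y i < y i.+1) ->
  (forall j t, (j < k)%N -> derivable (derive1n j F) t 1) ->
  exists2 xi, y 0%N <= xi <= y k & derive1n k F xi = dd k F y * k`!%:R.
Proof.
move=> yI yinc dF.
have [E dE] := derive1n_subf dF (@smooth_horner (interpolant k F y)).
have [i ik|xi xik] := Rolle_iter yinc dE.
  rewrite -[LHS]/(F (y i) - (interpolant k F y).[y i]).
  by rewrite horner_interpolant// subrr.
rewrite E => /eqP.
rewrite -[(_ - _) xi]/(derive1n k F xi - derive1n k (horner (interpolant k F y)) xi).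
rewrite subr_eq0 => /eqP Fxi; exists xi => //; rewrite Fxi derive1n_horner.
have -> : (interpolant k F y)^`(k) = (dd k F y * k`!%:R)%:P; last by rewrite hornerC.
apply/polyP => j; rewrite coef_derivn coefC; case: j => [|j].
  by rewrite addn0 ffactnn coef_interpolant mulr_natr.
by rewrite nth_default ?mul0rn// (leq_trans (size_interpolant _ _ _))// addnS ltnS leq_addr.
Qed.

End DividedDifferences.

(** * Windows of nodes *)

Section Windows.
Context {R : realType}.
Variables (m : nat) (X : int -> R) (f : R -> R).
Hypothesis XS : forall i : int, X i < X (i + 1).
Implicit Types (i j a b : int) (k l n r s q : nat).

Definition gap j : R := X (j + 1) - X j.

Definition short i n : bool := all (fun s => gap (i + s%:Z) <= 1) (iota 0 n).

Definition window i : nat -> R := fun s => X (i + s%:Z).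

(** Divided differences are discarded as soon as their window crosses a gap
    longer than 1: polynomials are never continued across such a gap. *)
Definition short_dd k i : R := if short i k then dd k f (window i) else 0.

Lemma gap_gt0 j : 0 < gap j.
Proof. by rewrite subr_gt0. Qed.

Lemma shortP i n : reflect (forall s, (s < n)%N -> gap (i + s%:Z) <= 1) (short i n).
Proof.
apply: (iffP allP) => [H s sn|H s]; first by apply: H; rewrite mem_iota add0n.
by rewrite mem_iota add0n => /andP[_ sn]; exact: H.
Qed.

Lemma short_sub i n j k : short i n -> (i <= j)%R -> (j + k%:Z <= i + n%:Z)%R ->
  short j k.
Proof.
move=> /shortP H ij jk; apply/shortP => s sk.
have -> : j + s%:Z = i + (`|j - i|%N + s)%:Z by lia.
by apply: H; lia.
Qed.

Lemma sequence_leD i n : X i <= X (i + n%:Z).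
Proof.
elim: n => [|n IH]; first by rewrite addr0.
by rewrite (le_trans IH)// -addn1 PoszD addrA ltW.
Qed.

Lemma sequence_mono i j : (i <= j)%R -> X i <= X j.
Proof. by move=> ij; rewrite (_ : j = i + (`|j - i|%N)%:Z); [exact: sequence_leD|lia]. Qed.

Lemma sequence_incr i j : (i < j)%R -> X i < X j.
Proof. by move=> ij; apply: lt_le_trans (XS i) (sequence_mono _); lia. Qed.

Lemma sequence_lt_inv i j : X i < X j -> (i < j)%R.
Proof. by move=> Xij; rewrite ltNge; apply: contraTN Xij => /sequence_mono; rewrite leNgt. Qed.

Lemma sequence_le_inv i j : X i <= X j -> (i <= j)%R.
Proof. by move=> Xij; rewrite leNgt; apply: contraTN Xij => /sequence_incr; rewrite ltNge. Qed.

Lemma window_inj i : injective (window i).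
Proof.
move=> s s' /eqP; rewrite eq_le => /andP[/sequence_le_inv H1 /sequence_le_inv H2].
by apply/eqP; lia.
Qed.

Lemma windowS i : window i \o succn = window (i + 1).
Proof. by apply/funext => s; rewrite /window /=; congr X; lia. Qed.

Lemma window_diam i n c : (forall s, (s < n)%N -> gap (i + s%:Z) <= c) ->
  X (i + n%:Z) - X i <= n%:R * c.
Proof.
elim: n => [|n IH] H; first by rewrite addr0 subrr mul0r.
rewrite -[X in X%:R]addn1 natrD mulrDl mul1r.
have -> : X (i + n.+1%:Z) - X i = (X (i + n%:Z) - X i) + gap (i + n%:Z).
  rewrite /gap (_ : i + n%:Z + 1 = i + n.+1%:Z); last by lia.
  by rewrite [RHS]addrC addrA subrK.
apply: lerD; last exact: H.
by apply: IH => s sn; apply: H; rewrite ltnS ltnW.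
Qed.

Lemma short_diam i n : short i n -> X (i + n%:Z) - X i <= n%:R.
Proof. by move=> /shortP /window_diam; rewrite mulr1. Qed.

Lemma short_of_diam i n : X (i + n%:Z) - X i <= 1 -> short i n.
Proof.
move=> H; apply/shortP => s sn; apply: le_trans H; rewrite /gap.
by apply: lerB; apply: sequence_mono; lia.
Qed.

Lemma short_ddS k i : X (i + k.+1%:Z) - X i <= 1 ->
  short_dd k (i + 1) - short_dd k i = (X (i + k.+1%:Z) - X i) * short_dd k.+1 i.
Proof.
move=> /short_of_diam H; rewrite /short_dd.
rewrite (short_sub H) ?(short_sub (i:=i) (n:=k.+1) (j:=i) (k:=k) H) ?H; try lia.
rewrite -windowS (ddS _ _ (@window_inj i)) /window; congr (_ * _).
by congr (_ - X _); lia.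
Qed.

Hypothesis m_gt0 : (0 < m)%N.

(** Tells whether the window of [m] nodes that starts at [a] may serve the node [a
    + n]: the two nodes must be linked by short gaps, and the longest gap of the
    window must not lie between them. The window is then left while crossing its
    longest gap, where the change of polynomial is cheapest. *)
Definition valid a n : bool := short a n &&
  has (fun r => all (fun s => gap (a + s%:Z) < gap (a + r%:Z)) (iota 0 n))
      (iota n (m - n)).

Lemma validP a n : (n < m)%N -> reflect (short a n /\
  exists2 r, (n <= r < m)%N & forall s, (s < n)%N -> gap (a + s%:Z) < gap (a + r%:Z))
  (valid a n).
Proof.
move=> nm; apply: (iffP andP) => [[sh /hasP[r]]|[sh [r rm H]]].
- rewrite mem_iota => rn /allP H; split=> //; exists r; first by lia.
  by move=> s sn; apply: H; rewrite mem_iota add0n.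
- split=> //; apply/hasP; exists r; first by rewrite mem_iota; lia.
  by apply/allP => s; rewrite mem_iota add0n => /andP[_ sn]; exact: H.
Qed.

Lemma valid0 a : valid a 0.
Proof. by apply/validP => //; split=> //; exists 0%N. Qed.

(** The window of a node starts as far to the left as validity permits. *)
Lemma offset_exists : exists off : int -> nat, forall j,
  [/\ (off j < m)%N, valid (j - (off j)%:Z) (off j) &
      forall n, (off j < n < m)%N -> ~~ valid (j - n%:Z) n].
Proof.
have H j : exists n, [/\ (n < m)%N, valid (j - n%:Z) n &
    forall n', (n < n' < m)%N -> ~~ valid (j - n'%:Z) n'].
  have Hex : exists n, (n < m)%N && valid (j - n%:Z) n.
    by exists 0%N; rewrite m_gt0 subr0 valid0.
  have Hub n : (n < m)%N && valid (j - n%:Z) n -> (n <= m)%N by move=> /andP[/ltnW].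
  case: (ex_maxnP Hex Hub) => n /andP[nm vn] nmax; exists n; split=> // n' /andP[nn' n'm].
  by apply/negP => vn'; have := nmax n'; rewrite n'm vn' => /(_ isT); rewrite leqNgt nn'.
by have /choice[off] := H; exists off.
Qed.

Variable off : int -> nat.
Hypothesis offP : forall j,
  [/\ (off j < m)%N, valid (j - (off j)%:Z) (off j) &
      forall n, (off j < n < m)%N -> ~~ valid (j - n%:Z) n].

Lemma off_lt j : (off j < m)%N.
Proof. by have [] := offP j. Qed.

Lemma off_short j : short (j - (off j)%:Z) (off j).
Proof. by have [H /validP-/(_ H)[]] := offP j. Qed.

(** All the gaps between the start of a window and its node are short. *)
Lemma off_long j : 1 < gap j -> off (j + 1) = 0%N.
Proof.
move=> lj; apply/eqP; rewrite -leqn0 leqNgt; apply/negP => o0.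
have /shortP/(_ (off (j + 1)).-1) := off_short (j + 1).
rewrite (_ : j + 1 - _ + _ = j); last by lia.
by rewrite leNgt lj prednK// leqnn => /(_ isT).
Qed.

Lemma off_step j : (off (j + 1) <= (off j).+1)%N.
Proof.
rewrite leqNgt; apply/negP => o1.
have [nm /validP-/(_ nm)[sh [r rm Hr]] _] := offP (j + 1).
have [_ _ mx] := offP j.
suff : valid (j - ((off (j + 1)).-1)%:Z) (off (j + 1)).-1 by apply/negP/mx; lia.
apply/validP; first by lia.
have E : j - ((off (j + 1)).-1)%:Z = j + 1 - (off (j + 1))%:Z by lia.
rewrite E; split; first by apply: (short_sub sh); lia.
by exists r; [lia|move=> s sn; apply: Hr; lia].
Qed.

(** The maximality of [off (j + 1)] excludes that the window at [j - q] serves the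
    node [j + 1], so none of its gaps after [j] exceeds all the earlier ones; that
    [j - off j] serves [j] excludes that a gap before [j] is the longest one. *)
Lemma transition_gap j q : gap j <= 1 -> (off (j + 1) <= q <= off j)%N ->
  forall s, (s < m)%N -> gap (j - q%:Z + s%:Z) <= gap j.
Proof.
move=> gj /andP[q1 q2]; set n := off j in q2 *; set a := j - q%:Z.
have [nm /validP-/(_ nm)[shn [r0 rm Hr0]] _] := offP j; rewrite -/n in nm shn rm Hr0.
have [_ _ max1] := offP (j + 1).
have sha : short a q.+1.
  apply/shortP => s; rewrite ltnS leq_eqVlt => /predU1P[->|sq].
    by rewrite /a subrK.
  have /shortP/(_ (n - q + s)%N) := shn; rewrite (_ : j - n%:Z + _ = a + s%:Z).
    by apply; lia.
  by rewrite /a; lia.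
have below s : (s < q)%N -> gap (a + s%:Z) < gap j \/ gap (a + s%:Z) < gap (j - n%:Z + r0%:Z).
  move=> sq; right; have := Hr0 (n - q + s)%N; rewrite (_ : j - n%:Z + _ = a + s%:Z).
    by apply; lia.
  by rewrite /a; lia.
(* If [q + 1 = m] the gap [j] is the last one of the window, hence the longest one
   by the validity of the window of [j]. *)
have [qm|qm] := eqVneq q.+1 m.
  have r0n : r0 = n by lia.
  move=> s; rewrite -qm ltnS leq_eqVlt => /predU1P[->|sq]; first by rewrite /a subrK.
  by case: (below _ sq); rewrite ?r0n ?subrK => /ltW.
have nv r : (q < r < m)%N -> exists2 s, (s <= q)%N & gap (a + r%:Z) <= gap (a + s%:Z).
  move=> /andP[qr rm'].
  have : ~~ valid a q.+1.
    by have := max1 q.+1; rewrite (_ : j + 1 - _ = a); [apply; lia|rewrite /a; lia].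
  move=> /validP H; apply: contrapT => Hno; apply: H; first by lia.
  split=> //; exists r; first by lia.
  move=> s sq; rewrite ltNge; apply/negP => H; apply: Hno; exists s => //.
(* If the gap [r0] that makes the window of [j] valid lies beyond [j], it is at most
   some gap up to [j], which validity forces to be [j] itself. *)
have jmax s : (s < q)%N -> gap (a + s%:Z) < gap j.
  move=> sq; case: (below _ sq) => // H; have [r0n|r0n] := eqVneq r0 n.
    by move: H; rewrite r0n subrK.
  have [|s0 s0q] := nv (r0 - n + q)%N; first by lia.
  rewrite (_ : a + _ = j - n%:Z + r0%:Z); last by rewrite /a; lia.
  move: s0q; rewrite leq_eqVlt => /predU1P[->|s0q].
    by rewrite /a subrK => H'; exact: lt_le_trans H H'.
  have := Hr0 (n - q + s0)%N; rewrite (_ : j - n%:Z + _ = a + s0%:Z); last by rewrite /a; lia.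
  move=> H1 H2; have : (n - q + s0 < n)%N by lia.
  by move=> /H1; rewrite ltNge H2.
have jmax' s : (s <= q)%N -> gap (a + s%:Z) <= gap j.
  rewrite leq_eqVlt => /predU1P[->|sq]; first by rewrite /a subrK.
  exact: ltW (jmax _ sq).
move=> s sm; have [sq|qs] := leqP s q; first exact: jmax'.
have [|s0 s0q H] := nv s; first by rewrite qs sm.
exact: le_trans H (jmax' _ s0q).
Qed.

(** In Newton form a discarded divided difference only drops a term that vanishes
    at the nodes before its window is complete. *)
Definition piece_poly i : {poly R} := \sum_(k < m) short_dd k i *: nodal k (window i).

Definition node_poly j : {poly R} := piece_poly (j - (off j)%:Z).

(** The terms of order greater than [n] vanish at the node [n], and the others
    belong to windows with short gaps. *)
Lemma piece_poly_interpolates b n : (n < m)%N -> short b n ->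
  (piece_poly b).[window b n] = f (window b n).
Proof.
move=> nm sh; rewrite -(horner_interpolant (@window_inj b) f (leqnn n)).
rewrite interpolant_newton; last exact: window_inj.
rewrite /piece_poly !horner_sum.
rewrite -(big_mkord xpredT (fun k => (short_dd k b *: nodal k (window b)).[window b n])).
rewrite (@big_cat_nat _ _ _ n.+1)//= [X in _ + X]big1_seq ?addr0; last first.
  move=> k /=; rewrite mem_index_iota => /andP[nk _].
  by rewrite hornerZ nodal_root// mulr0.
rewrite big_mkord; apply: eq_bigr => k _; rewrite /short_dd (short_sub sh)//.
by have := ltn_ord k; lia.
Qed.

Lemma node_poly_interpolates j : (node_poly j).[X j] = f (X j).
Proof.
have := piece_poly_interpolates (off_lt j) (off_short j).
by rewrite /window subrK.
Qed.

Lemma piece_poly_interpolant a : short a m.-1 ->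
  piece_poly a = interpolant m.-1 f (window a).
Proof.
move=> sh; rewrite interpolant_newton; last exact: window_inj.
rewrite prednK//; apply: eq_bigr => k _; rewrite /short_dd (short_sub sh)//.
by have := ltn_ord k; lia.
Qed.

Lemma piece_poly_shift a : short a m -> piece_poly (a + 1) - piece_poly a =
  ((X (a + m%:Z) - X a) * short_dd m a) *: nodal m.-1 (window (a + 1)).
Proof.
move=> sh; rewrite !piece_poly_interpolant; [|by apply: (short_sub sh); lia..].
rewrite -windowS interpolant_shift; last exact: window_inj.
rewrite prednK// /window addr0 /short_dd sh windowS.
by congr (_ *: nodal _ _).
Qed.

(** The sum telescopes over the windows that are passed over between the two nodes. *)
Lemma node_poly_step j : gap j <= 1 ->
  node_poly (j + 1) - node_poly j =
  \sum_(off (j + 1) <= q < (off j).+1)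
     (piece_poly (j - q%:Z + 1) - piece_poly (j - q%:Z)).
Proof.
move=> gj; rewrite /node_poly.
have -> : j + 1 - (off (j + 1))%:Z = j - (off (j + 1))%:Z + 1 by lia.
have := off_step j.
have -> : j - (off j)%:Z = j - (off j).+1%:Z + 1 by lia.
move: (off (j + 1)) (off j).+1 => n1 n2 n12.
have := @telescope_sumr _ n1 n2 (fun q => piece_poly (j - q%:Z + 1)) n12.
move=> /(congr1 -%R); rewrite opprB => <-; rewrite -sumrN.
apply: eq_bigr => q _; rewrite opprB; congr (_ - piece_poly _); lia.
Qed.

Definition weight i : R := Num.min 1 (X (i + m%:Z) - X i).

Lemma weight_ge0 i : 0 <= weight i.
Proof. by rewrite le_min ler01 subr_ge0 sequence_leD. Qed.

Lemma weight_gap i : Num.min 1 (gap i) <= weight i.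
Proof.
rewrite /weight le_min ge_min lexx/= ge_min; apply/orP; right.
by rewrite lerB// sequence_mono//; lia.
Qed.

Lemma weight_min_gap j s : (s < m)%N -> Num.min 1 (gap j) <= weight (j - s%:Z).
Proof.
move=> sm; rewrite /weight le_min ge_min lexx/= ge_min; apply/orP; right.
by rewrite lerB// sequence_mono//; lia.
Qed.

(** If the window has length at least 1 the weight is 1; otherwise all its gaps are
    short and the recursion for divided differences applies. *)
Lemma short_dd_step k j : (k < m)%N ->
  `|short_dd k j| <= weight j * (`|short_dd k j| + `|short_dd k.+1 j|) + `|short_dd k (j + 1)|.
Proof.
move=> km; have [w1|w1] := leP 1 (X (j + m%:Z) - X j).
  by rewrite /weight min_l// mul1r -addrA lerDl addr_ge0.
have d1 : X (j + k.+1%:Z) - X j <= X (j + m%:Z) - X j.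
  by rewrite lerB// sequence_mono//; lia.
have d0 : 0 <= X (j + k.+1%:Z) - X j by rewrite subr_ge0 sequence_leD.
have := short_ddS (le_trans d1 (ltW w1)) => E.
have -> : short_dd k j = short_dd k (j + 1) - (X (j + k.+1%:Z) - X j) * short_dd k.+1 j.
  by rewrite -E; ring.
rewrite (le_trans (ler_normB _ _))// addrC lerD// normrM (ger0_norm d0).
rewrite /weight min_r ?(ltW w1)// mulrDr -[leLHS]add0r lerD//.
  by rewrite mulr_ge0// subr_ge0 sequence_leD.
by rewrite ler_wpM2r.
Qed.

Lemma short_dd_telescope k i n : (k < m)%N ->
  `|short_dd k i| <= \sum_(s < n) weight (i + s%:Z) *
     (`|short_dd k (i + s%:Z)| + `|short_dd k.+1 (i + s%:Z)|) + `|short_dd k (i + n%:Z)|.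
Proof.
move=> km; elim: n => [|n IH]; first by rewrite big_ord0 add0r addr0.
rewrite (le_trans IH)// big_ord_recr/= -!addrA lerD2l.
by rewrite (le_trans (short_dd_step _ km))// lerD2l (_ : i + n%:Z + 1 = i + n.+1%:Z)//; lia.
Qed.

Lemma sum_min_gap i n : Num.min 1 (X (i + n%:Z) - X i) <=
  \sum_(s < n) Num.min 1 (gap (i + s%:Z)).
Proof.
elim: n => [|n IH]; first by rewrite addr0 subrr big_ord0 ge_min lexx orbT.
rewrite big_ord_recr/= (le_trans _ (lerD IH (lexx _)))//.
have g0 := gap_gt0 (i + n%:Z).
have d0 : 0 <= X (i + n%:Z) - X i by rewrite subr_ge0 sequence_leD.
have -> : X (i + n.+1%:Z) - X i = (X (i + n%:Z) - X i) + gap (i + n%:Z).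
  rewrite /gap (_ : i + n%:Z + 1 = i + n.+1%:Z); last by lia.
  by rewrite [RHS]addrC addrA subrK.
move: (X (i + n%:Z) - X i) (gap _) d0 g0 => a b a0 b0.
by rewrite /Num.min; do ! case: ifP; lra.
Qed.

(** For these nodes a weight is at most the increment of [min (X i + 2) (X _)] over
    [m] steps, and these increments telescope. *)
Lemma sum_weight_le i n : (forall s, (s < n)%N -> X (i + s%:Z) <= X i + 1) ->
  \sum_(s < n) weight (i + s%:Z) <= 2 * m%:R.
Proof.
move=> Hn; pose z s := Num.min (X (i + s%:Z)) (X i + 2).
have zge s : X i <= z s by rewrite le_min sequence_leD/= lerDl.
have zle s : z s <= X i + 2 by rewrite ge_min lexx orbT.
apply: (@le_trans _ _ (\sum_(s < n) (z (s + m)%N - z s))).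
  apply: ler_sum => s _; have := Hn s (ltn_ord s); rewrite /z /weight.
  rewrite (_ : i + s%:Z + m%:Z = i + (s + m)%:Z); last by lia.
  have : X (i + s%:Z) <= X (i + (s + m)%:Z) by apply: sequence_mono; lia.
  move: (X (i + (s + m)%:Z)) (X (i + s%:Z)) (X i) => a b c ab bc.
  by rewrite /Num.min; do ! case: ifP; lra.
have -> : \sum_(s < n) (z (s + m)%N - z s) = \sum_(s < m) (z (n + s)%N - z s).
  rewrite !sumrB; apply/eqP; rewrite subr_eq addrAC eq_sym subr_eq; apply/eqP.
  have := @big_split_ord R 0 +%R m n xpredT (fun s : 'I_(m + n) => z s).
  have := @big_split_ord R 0 +%R n m xpredT (fun s : 'I_(n + m) => z s).
  rewrite /= addnC => ->; rewrite addrC => ->; rewrite addrC; congr (_ + _).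
  by apply: eq_bigr => s _; rewrite addnC.
apply: (@le_trans _ _ (\sum_(s < m) 2)); last by rewrite sumr_const card_ord mulr_natr.
apply: ler_sum => s _; rewrite lerBlDr (le_trans (zle _))// addrC lerD2l.
exact: zge.
Qed.

(** The discrete counterpart of the embedding of [W^1_1] into bounded functions:
    a value differs from its weighted average by at most the weighted sum of the
    increments, and the weights of the nodes within distance 1 on the right have sum
    at least 1. *)
Lemma embedding i : (forall c : R, exists n, c < X (i + n%:Z)) ->
  exists2 n, (forall s, (s < n)%N -> X (i + s%:Z) <= X i + 1) &
    forall k, (k < m)%N -> `|short_dd k i| <= 2 * \sum_(s < n) weight (i + s%:Z) *
       (`|short_dd k (i + s%:Z)| + `|short_dd k.+1 (i + s%:Z)|).
Proof.
move=> unb; have [n Xn nmin] := ex_minnP (unb (X i + 1)).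
exists n => [s sn|k km].
  by rewrite leNgt; apply/negP => /nmin; rewrite leqNgt sn.
set U := \sum_(s < n) _.
have W1 : 1 <= \sum_(s < n) weight (i + s%:Z).
  apply: (@le_trans _ _ (\sum_(s < n) Num.min 1 (gap (i + s%:Z)))); last first.
    by apply: ler_sum => s _; exact: weight_gap.
  apply: le_trans (sum_min_gap i n); rewrite le_min lexx/=.
  by rewrite lerBrDl ltW.
have tele s : (s <= n)%N -> `|short_dd k i| <= U + `|short_dd k (i + s%:Z)|.
  move=> sn; rewrite (le_trans (short_dd_telescope i s km))// lerD2r /U.
  rewrite -(big_mkord xpredT (fun s => weight (i + s%:Z) * (`|short_dd k (i + s%:Z)| + `|short_dd k.+1 (i + s%:Z)|))).
  rewrite -(big_mkord xpredT (fun s => weight (i + s%:Z) * (`|short_dd k (i + s%:Z)| + `|short_dd k.+1 (i + s%:Z)|))).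
  rewrite [leRHS](@big_cat_nat _ _ _ s)//= lerDl sumr_ge0// => r _.
  by rewrite mulr_ge0 ?weight_ge0// addr_ge0.
have wU : \sum_(s < n) weight (i + s%:Z) * `|short_dd k (i + s%:Z)| <= U.
  by apply: ler_sum => s _; rewrite ler_wpM2l ?weight_ge0// lerDl.
have : (\sum_(s < n) weight (i + s%:Z)) * `|short_dd k i| <=
       (\sum_(s < n) weight (i + s%:Z)) * U + U.
  apply: (@le_trans _ _ (\sum_(s < n) weight (i + s%:Z) * (U + `|short_dd k (i + s%:Z)|))).
    rewrite mulr_suml; apply: ler_sum => s _; rewrite ler_wpM2l ?weight_ge0//.
    by apply: tele; exact: ltnW.
  under eq_bigr do rewrite mulrDr.
  by rewrite big_split/= -mulr_suml lerD2l.
have U0 : 0 <= U by apply: sumr_ge0 => s _; rewrite mulr_ge0 ?weight_ge0// addr_ge0.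
move: (\sum_(s < n) weight _) W1 => W W1 H.
rewrite -(@ler_pM2l _ W) ?(lt_le_trans _ W1)// (le_trans H)//.
rewrite mulrCA mulr_natl mulr2n lerD2l.
by rewrite ler_peMl.
Qed.

End Windows.

(** * Gluing the polynomials *)

(** [scaled_bound N h K G t] bounds the derivatives of [G] at [t] as for a function
    of size [K] that varies on the scale [h]. *)
Definition scaled_bound {R : realType} (N : nat) (h K : R) (G : R -> R) (t : R) :=
  forall l, (l <= N)%N -> `|derive1n l G t| <= K * h^-1 ^+ l.

Section ScaledBounds.
Context {R : realType}.
Implicit Types (G u v : R -> R) (h K t : R) (N l : nat).

Lemma derive1n_addf l u v : smooth u -> smooth v ->
  derive1n l (u + v) = derive1n l u + derive1n l v.
Proof.
case: l => [//|l] su sv; apply: derive1nD; apply/smooth_nderivable: l => //.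
Qed.

(** Induction on the order with the product rule, each step of which doubles the
    number of terms. *)
Lemma derive1n_mulf_le N h K1 K2 u v t : 0 < h -> 0 <= K1 -> 0 <= K2 ->
  smooth u -> smooth v -> scaled_bound N h K1 u t -> scaled_bound N h K2 v t ->
  `|derive1n N (u * v) t| <= 2 ^+ N * (K1 * K2) * h^-1 ^+ N.
Proof.
move=> h0; elim: N u v K1 K2 => [|N IH] u v K1 K2 K10 K20 su sv bu bv.
  have := bu 0%N isT; have := bv 0%N isT; rewrite !expr0 !mulr1 mul1r => H2 H1.
  by rewrite -[X in `|X|]/(u t * v t) normrM ler_pM.
rewrite derive1Sn (derive1_mulf (su 0%N) (sv 0%N)).
rewrite derive1n_addf; last 2 first.
- exact: (smoothM (smooth_derive1 su) sv).
- exact: (smoothM su (smooth_derive1 sv)).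
have hi : 0 <= h^-1 by rewrite invr_ge0 ltW.
have bS w K : scaled_bound N.+1 h K w t -> scaled_bound N h (K * h^-1) (derive1 w) t.
  by move=> bw l lN; rewrite -derive1Sn -mulrA -exprS; exact: bw.
have bW w K : scaled_bound N.+1 h K w t -> scaled_bound N h K w t.
  by move=> bw l lN; apply: bw; exact: leqW.
have H1 := IH _ _ _ _ (mulr_ge0 K10 hi) K20 (smooth_derive1 su) sv (bS _ _ bu) (bW _ _ bv).
have H2 := IH _ _ _ _ K10 (mulr_ge0 K20 hi) su (smooth_derive1 sv) (bW _ _ bu) (bS _ _ bv).
rewrite -[X in `|X|]/(derive1n N (derive1 u * v) t + derive1n N (u * derive1 v) t).
apply: (le_trans (ler_normD _ _)); apply: (le_trans (lerD H1 H2)).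
by rewrite !exprS le_eqVlt; apply/orP; left; apply/eqP; ring.
Qed.

Lemma scaled_boundM N h K1 K2 u v t : 0 < h -> 0 <= K1 -> 0 <= K2 ->
  smooth u -> smooth v -> scaled_bound N h K1 u t -> scaled_bound N h K2 v t ->
  scaled_bound N h (2 ^+ N * (K1 * K2)) (u * v) t.
Proof.
move=> h0 K10 K20 su sv bu bv l lN.
apply: (le_trans (derive1n_mulf_le h0 K10 K20 su sv _ _)).
- by move=> k kl; apply: bu; exact: leq_trans lN.
- by move=> k kl; apply: bv; exact: leq_trans lN.
rewrite ler_wpM2r ?exprn_ge0 ?invr_ge0 ?(ltW h0)//.
by rewrite ler_wpM2r ?mulr_ge0// ler_weXn2l// ler1n.
Qed.

Lemma scaled_boundD N h K1 K2 u v t : smooth u -> smooth v ->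
  scaled_bound N h K1 u t -> scaled_bound N h K2 v t ->
  scaled_bound N h (K1 + K2) (u + v) t.
Proof.
move=> su sv bu bv l lN; rewrite (derive1n_addf _ su sv) mulrDl.
by apply: (le_trans (ler_normD _ _)); apply: lerD; [exact: bu|exact: bv].
Qed.

Lemma scaled_boundN N h K u t : smooth u -> scaled_bound N h K u t ->
  scaled_bound N h K (- u) t.
Proof.
move=> su bu l lN; rewrite (derive1n_oppf _ su) -[X in `|X|]/(- derive1n l u t).
by rewrite normrN; exact: bu.
Qed.

Lemma scaled_bound_cst N h (c t : R) : 0 < h -> scaled_bound N h `|c| (cst c) t.
Proof.
move=> h0 [|l] lN; first by rewrite expr0 mulr1.
rewrite derive1Sn derive1_cst_fun derive1n_cst0 normr0.
by rewrite mulr_ge0// exprn_ge0// invr_ge0 ltW.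
Qed.

Lemma scaled_boundW N h K K' G t : 0 < h -> K <= K' ->
  scaled_bound N h K G t -> scaled_bound N h K' G t.
Proof.
move=> h0 KK bG l lN; apply: (le_trans (bG l lN)).
by rewrite ler_wpM2r// exprn_ge0// invr_ge0 ltW.
Qed.

Lemma scaled_bound_linear N h (L c t : R) : 0 < h -> 1 <= L -> `|t - c| <= L * h ->
  scaled_bound N h (L * h) (horner ('X - c%:P)) t.
Proof.
move=> h0 L1 tc [|[|l]] lN; rewrite derive1n_horner.
- by rewrite derivn0 hornerXsubC expr0 mulr1.
- rewrite derivn1 derivXsubC hornerC normr1 expr1 mulfK ?lt0r_neq0//.
- rewrite derivSn derivXsubC derivn_poly0 ?size_poly1// horner0 normr0.
  by rewrite mulr_ge0 ?exprn_ge0 ?invr_ge0 ?(ltW h0)// mulr_ge0 ?(ltW h0)// (le_trans ler01).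
Qed.

Lemma hornerM_fun (p q : {poly R}) : horner (p * q) = horner p * horner q :> (R -> R).
Proof. by apply/funext => t; rewrite hornerM. Qed.

Lemma hornerD_fun (p q : {poly R}) : horner (p + q) = horner p + horner q :> (R -> R).
Proof. by apply/funext => t; rewrite hornerD. Qed.

Lemma scaled_boundZ N h (c K : R) p t : 0 < h ->
  scaled_bound N h K (horner p) t -> scaled_bound N h (`|c| * K) (horner (c *: p)) t.
Proof.
move=> h0 bp l lN; rewrite derive1n_horner derivnZ hornerZ normrM -mulrA.
by rewrite ler_wpM2l// -derive1n_horner; exact: bp.
Qed.

Lemma scaled_bound_poly_sum N h (I : eqType) (s : seq I) (K : I -> R)
    (p : I -> {poly R}) t : 0 < h ->
  (forall i, i \in s -> scaled_bound N h (K i) (horner (p i)) t) ->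
  scaled_bound N h (\sum_(i <- s) K i) (horner (\sum_(i <- s) p i)) t.
Proof.
move=> h0; elim: s => [|i s IH] H.
  rewrite !big_nil => l lN; rewrite derive1n_horner derivn_poly0 ?size_poly0//.
  by rewrite horner0 normr0 mul0r.
rewrite !big_cons hornerD_fun; apply: scaled_boundD.
- exact: smooth_horner.
- exact: smooth_horner.
- by apply: H; rewrite mem_head.
- by apply: IH => j js; apply: H; rewrite inE js orbT.
Qed.

(** Every linear factor has size at most [L * h] and derivative [1 <= L]. *)
Lemma scaled_bound_nodal N h (L t : R) k (y : nat -> R) : 0 < h -> 1 <= L ->
  (forall l, (l < k)%N -> `|t - y l| <= L * h) ->
  scaled_bound N h ((2 ^+ N * (L * h)) ^+ k) (horner (nodal k y)) t.
Proof.
move=> h0 L1; have L0 : 0 <= L by exact: le_trans ler01 L1.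
elim: k y => [|k IH] y Hy.
  rewrite expr0 /nodal big_ord0 => l lN; rewrite derive1n_horner.
  have -> : (1 : {poly R}) = 1%:P by [].
  rewrite -derive1n_horner; have := @scaled_bound_cst N h 1 t h0 l lN.
  rewrite normr1; have -> // : horner 1%:P = cst 1 :> (R -> R).
  by apply/funext => s; rewrite hornerC.
rewrite nodalS hornerM_fun exprS.
have -> : 2 ^+ N * (L * h) * (2 ^+ N * (L * h)) ^+ k =
  2 ^+ N * (L * h * (2 ^+ N * (L * h)) ^+ k) by rewrite -!mulrA.
apply: scaled_boundM => //.
- by rewrite mulr_ge0// ltW.
- by rewrite exprn_ge0// mulr_ge0 ?exprn_ge0 ?mulr_ge0// ltW.
- exact: smooth_horner.
- exact: smooth_horner.
- by apply: scaled_bound_linear => //; exact: Hy.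
- by apply: IH => l lk; exact: Hy.
Qed.

Lemma derive1n_rampE l e a t : derive1n l (ramp e a) t =
  e^-1 ^+ l * derive1n l step ((t - a) / e).
Proof.
rewrite /ramp derive1n_affine_comp; last exact: smooth_step.
by rewrite -[LHS]/(e^-1 ^+ l * derive1n l step (e^-1 * t - e^-1 * a)) -mulrBr (mulrC e^-1 (t - a)).
Qed.

Lemma scaled_bound_ramp N (M : R) e a t : 0 < e ->
  (forall l s, (l <= N)%N -> `|derive1n l (@step R) s| <= M) ->
  scaled_bound N e M (ramp e a) t.
Proof.
move=> e0 HM l lN; have e0' : 0 <= e^-1 ^+ l by rewrite exprn_ge0// invr_ge0 ltW.
by rewrite derive1n_rampE normrM mulrC (ger0_norm e0') ler_wpM2r ?HM.
Qed.

End ScaledBounds.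

Section Extension.
Context {R : realType}.
Variables (m : nat) (X : int -> R) (f : R -> R).
Hypothesis m_gt0 : (0 < m)%N.
Hypothesis XS : forall i : int, X i < X (i + 1).
Hypothesis Xcover : forall t : R, exists j : int, X j <= t < X (j + 1).
Variable off : int -> nat.
Hypothesis offP : forall j,
  [/\ (off j < m)%N, valid m X (j - (off j)%:Z) (off j) &
      forall n, (off j < n < m)%N -> ~~ valid m X (j - n%:Z) n].
Implicit Types (i j a b : int) (k l n r s q : nat) (t : R).

Local Notation Pi := (node_poly m X f off).

Definition ramp_width j : R := Num.min 1 (gap X j).

(** On a short gap the two ramps coincide and lead from one polynomial to the next;
    on a long gap the first polynomial is switched off before the second one is
    switched on. *)
Definition piece j : R -> R :=
  (cst 1 - ramp (ramp_width j) (X j)) * horner (Pi j) +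
  ramp (ramp_width j) (X (j + 1) - ramp_width j) * horner (Pi (j + 1)).

Lemma ramp_width_gt0 j : 0 < ramp_width j.
Proof. by rewrite lt_min ltr01 gap_gt0. Qed.

Lemma ramp_width_le j : ramp_width j <= gap X j.
Proof. by rewrite ge_min lexx orbT. Qed.

Lemma smooth_down j : smooth (cst 1 - ramp (ramp_width j) (X j) : R -> R).
Proof. exact: (smoothD (@smooth_cst R 1) (smoothN (@smooth_ramp R _ _))). Qed.

Lemma smooth_piece j : smooth (piece j).
Proof.
exact: (smoothD (smoothM (@smooth_down j) (@smooth_horner R (Pi j)))
  (smoothM (@smooth_ramp R _ _) (@smooth_horner R (Pi (j + 1))))).
Qed.

Lemma pieceE j t : piece j t = (1 - ramp (ramp_width j) (X j) t) * (Pi j).[t] +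
  ramp (ramp_width j) (X (j + 1) - ramp_width j) t * (Pi (j + 1)).[t].
Proof. by []. Qed.

Lemma piece_le j t : t <= X j -> piece j t = (Pi j).[t].
Proof.
move=> tX; rewrite pieceE !ramp_le ?ramp_width_gt0//; first by rewrite subr0 mul1r mul0r addr0.
by rewrite (le_trans tX)// lerBrDl addrC -lerBrDl ramp_width_le.
Qed.

Lemma piece_ge j t : X (j + 1) <= t -> piece j t = (Pi (j + 1)).[t].
Proof.
move=> tX; rewrite pieceE !ramp_ge ?ramp_width_gt0 ?subrK//.
  by rewrite subrr mul0r add0r mul1r.
by rewrite (le_trans _ tX)// -lerBrDl ramp_width_le.
Qed.

Lemma ext_exists : exists F : R -> R,
  forall j t, X j <= t < X (j + 1) -> F t = piece j t.
Proof.
have /choice[loc locP] := Xcover; exists (fun t => piece (loc t) t).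
move=> j t /andP[jt tj]; have /andP[lt tl] := locP t.
suff -> : loc t = j by [].
have := sequence_lt_inv XS (le_lt_trans lt tj); have := sequence_lt_inv XS (le_lt_trans jt tl).
lia.
Qed.

Variable F : R -> R.
Hypothesis FE : forall j t, X j <= t < X (j + 1) -> F t = piece j t.

Lemma ext_interpolates j : F (X j) = f (X j).
Proof.
rewrite (@FE j) ?lexx ?XS//= piece_le//.
exact: (node_poly_interpolates f XS m_gt0 offP).
Qed.

(** To the left of the node [X j] the piece [j] is the polynomial of the node, to
    the right the piece [j - 1] is: a single smooth formula holds on both sides. *)
Lemma ext_near j t : X j <= t < X (j + 1) ->
  {near t, piece (j - 1) + piece j - horner (Pi j) =1 F}.
Proof.
move=> /andP[jt tj].
have Xj1 : X (j - 1) < X j by have := XS (j - 1); rewrite subrK.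
near=> s.
have s1 : X (j - 1) < s by near: s; apply: lt_nbhsr; exact: lt_le_trans Xj1 jt.
have s2 : s < X (j + 1) by near: s; exact: lt_nbhsl.
rewrite -[LHS]/(piece (j - 1) s + piece j s - (Pi j).[s]).
have [sj|js] := ltP s (X j).
  rewrite (@FE (j - 1)) ?(ltW s1)/= ?subrK// (@piece_le j) ?(ltW sj)//.
  by rewrite addrK.
rewrite (@FE j) ?js// (@piece_ge (j - 1)) ?subrK//.
by rewrite addrAC subrr add0r.
Unshelve. all: by end_near. Qed.

Lemma smooth_ext : smooth F.
Proof.
move=> k t; have [j jt] := Xcover t.
have := near_eq_derive1n k (ext_near jt) => /near_eq_derivable; apply.
apply: (smoothD (smoothD (@smooth_piece _) (@smooth_piece _)) (smoothN (@smooth_horner _ _))).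
Qed.

Lemma ext_derive1n k j t : X j < t < X (j + 1) ->
  derive1n k F t = derive1n k (piece j) t.
Proof.
move=> /andP[jt tj]; have : {near t, F =1 piece j}.
  near=> s; apply: FE; apply/andP; split.
    by apply: ltW; near: s; exact: lt_nbhsr.
  by near: s; exact: lt_nbhsl.
by move=> /(near_eq_derive1n k)/nbhs_singleton.
Unshelve. all: by end_near. Qed.

Definition poly_const : R := (2 ^+ m * (2 * m%:R + 1)) ^+ m.

Lemma poly_const_ge1 : 1 <= 2 ^+ m * (2 * m%:R + 1) :> R.
Proof.
rewrite -[leLHS]mul1r ler_pM//; last by rewrite lerDr mulr_ge0.
by rewrite exprn_ege1// ler1n.
Qed.

(** The windows that count only contain gaps of length at most 1, so all their
    nodes are at a bounded distance. *)
Lemma node_poly_bound j t : `|t - X j| <= 1 ->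
  scaled_bound m 1 (poly_const * \sum_(k < m) `|short_dd X f k (j - (off j)%:Z)|)
    (horner (Pi j)) t.
Proof.
move=> tj; set b := j - (off j)%:Z; have := off_short m_gt0 offP j; rewrite -/b => sh.
have nm : (off j < m)%N by exact: (off_lt offP).
rewrite mulr_sumr; apply: scaled_bound_poly_sum => // k _.
have [->|ck] := eqVneq (short_dd X f k b) 0.
  rewrite scale0r normr0 mulr0 => l lN.
  by rewrite derive1n_horner derivn_poly0 ?size_poly0// horner0 normr0 mul0r.
rewrite mulrC; apply: scaled_boundZ => //.
have shk : short X b k by move: ck; rewrite /short_dd; case: ifP => //; rewrite eqxx.
apply: (@scaled_boundW _ _ _ ((2 ^+ m * ((2 * m%:R + 1) * 1)) ^+ k)) => //.
  rewrite mulr1 /poly_const ler_weXn2l ?poly_const_ge1//; exact: ltnW.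
apply: scaled_bound_nodal => //; first by rewrite lerDr mulr_ge0.
move=> l lk; rewrite mulr1 /window.
have d1 : `|X j - X b| <= m%:R.
  rewrite ger0_norm ?subr_ge0 ?(sequence_mono XS)//; last by rewrite /b; lia.
  have := short_diam sh; rewrite subrK => /le_trans; apply.
  by rewrite ler_nat ltnW.
have d2 : `|X b - X (b + l%:Z)| <= m%:R.
  rewrite distrC ger0_norm ?subr_ge0 ?(sequence_leD XS)//.
  have /short_diam : short X b l by apply: (short_sub shk); lia.
  by move=> /le_trans; apply; rewrite ler_nat (leq_trans (ltnW lk))// ltnW.
have -> : t - X (b + l%:Z) = (t - X j) + (X j - X b) + (X b - X (b + l%:Z)) by ring.
have -> : 2 * m%:R + 1 = 1 + m%:R + m%:R :> R by ring.
by rewrite (le_trans (ler_normD _ _))// lerD// (le_trans (ler_normD _ _))// lerD.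
Qed.

Definition step_const : R := m%:R * (2 ^+ m * m%:R) ^+ m.-1.

Lemma step_const_ge0 : 0 <= step_const.
Proof. by rewrite mulr_ge0// exprn_ge0// mulr_ge0// exprn_ge0. Qed.

(** Where two consecutive polynomials are glued their difference is as small as the
    Taylor remainder of order [m] on the scale of the gap. *)
Lemma node_poly_step_bound j t : gap X j <= 1 -> X j <= t <= X (j + 1) ->
  scaled_bound m (gap X j)
    (gap X j ^+ m * (step_const * \sum_(s < m) `|short_dd X f m (j - s%:Z)|))
    (horner (Pi (j + 1) - Pi j)) t.
Proof.
move=> gj /andP[jt tj].
have g0 : 0 < gap X j by exact: gap_gt0.
rewrite (node_poly_step f m_gt0 offP gj).
set c := gap X j ^+ m * step_const.
have c0 : 0 <= c by rewrite mulr_ge0 ?step_const_ge0// exprn_ge0// ltW.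
apply: (@scaled_boundW _ _ _ (\sum_(off (j + 1) <= q < (off j).+1) (c * `|short_dd X f m (j - q%:Z)|))) => //.
  rewrite -mulr_sumr mulrA ler_wpM2l//.
  rewrite -(big_mkord xpredT (fun s => `|short_dd X f m (j - s%:Z)|)).
  have offm : ((off j).+1 <= m)%N by exact: (off_lt offP).
  have off1 : (off (j + 1) <= (off j).+1)%N by exact: (off_step m_gt0 offP).
  rewrite [leRHS](@big_cat_nat _ _ _ (off (j + 1)))//=; last by exact: leq_trans offm.
  rewrite [X in _ <= _ + X](@big_cat_nat _ _ _ (off j).+1)//=.
  by rewrite addrCA lerDl addr_ge0// sumr_ge0.
apply: scaled_bound_poly_sum => // q; rewrite mem_index_iota => /andP[q1 q2].
set a := j - q%:Z.
have ga s : (s < m)%N -> gap X (a + s%:Z) <= gap X j.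
  by apply: (transition_gap m_gt0 offP) => //; rewrite q1.
have sha : short X a m by apply/shortP => s sm; exact: le_trans (ga s sm) gj.
rewrite (piece_poly_shift f XS m_gt0 sha) mulrC.
have D0 : 0 <= X (a + m%:Z) - X a by rewrite subr_ge0 (sequence_leD XS).
have D1 : X (a + m%:Z) - X a <= m%:R * gap X j by exact: window_diam ga.
have qm : (q < m)%N by rewrite (leq_trans q2)// (off_lt offP).
apply: (@scaled_boundW _ _ _ (`|(X (a + m%:Z) - X a) * short_dd X f m a| *
    (2 ^+ m * (m%:R * gap X j)) ^+ m.-1)) => //.
  rewrite normrM (ger0_norm D0) mulrAC [leRHS]mulrC ler_wpM2r//.
  have Eg : gap X j ^+ m = gap X j * gap X j ^+ m.-1 by rewrite -exprS prednK.
  rewrite /c /step_const Eg (mulrA (2 ^+ m)) [X in _ * X <= _]exprMn.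
  have -> : gap X j * gap X j ^+ m.-1 * (m%:R * (2 ^+ m * m%:R) ^+ m.-1) =
    (m%:R * gap X j) * ((2 ^+ m * m%:R) ^+ m.-1 * gap X j ^+ m.-1) by ring.
  apply: ler_wpM2r => //; apply: mulr_ge0; first by rewrite exprn_ge0// mulr_ge0// exprn_ge0.
  by rewrite exprn_ge0// ltW.
apply: scaled_boundZ => //; apply: scaled_bound_nodal => //.
  by rewrite ler1n.
move=> l lm; rewrite /window.
apply: (@le_trans _ _ (X (a + m%:Z) - X a)) => //.
have [ij1 ij2 ij3 ij4] : [/\ (a <= j)%R, (j + 1 <= a + m%:Z)%R,
    (a <= a + 1 + l%:Z)%R & (a + 1 + l%:Z <= a + m%:Z)%R].
  by clear -q1 q2 qm lm m_gt0; rewrite /a; split; lia.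
have H1 : X a <= t by apply: le_trans jt; exact: sequence_mono.
have H2 : t <= X (a + m%:Z) by apply: (le_trans tj); exact: sequence_mono.
have H3 : X a <= X (a + 1 + l%:Z) by exact: sequence_mono.
have H4 : X (a + 1 + l%:Z) <= X (a + m%:Z) by exact: sequence_mono.
by rewrite ler_norml; apply/andP; split; lra.
Qed.

Definition near_sum j : R := \sum_(s < m) \sum_(k < m.+1) `|short_dd X f k (j - s%:Z)|.

(** After a long gap the window starts at the node itself ([off_long]), and the
    [m]-th divided difference does not occur in its polynomial. *)
Definition end_sum j : R := \sum_(k < m) `|short_dd X f k j|.

Lemma end_sum_near j n : (n < m)%N -> end_sum (j - n%:Z) <= near_sum j.
Proof.
move=> nm; rewrite /near_sum (bigD1 (Ordinal nm))//= big_ord_recr/= -addrA lerDl.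
by rewrite addr_ge0// sumr_ge0// => i _; rewrite sumr_ge0.
Qed.

Lemma near_sum_top j : \sum_(s < m) `|short_dd X f m (j - s%:Z)| <= near_sum j.
Proof.
by apply: ler_sum => s _; rewrite big_ord_recr/= lerDr sumr_ge0.
Qed.

Lemma near_sum_ge0 j : 0 <= near_sum j.
Proof. by apply: sumr_ge0 => s _; exact: sumr_ge0. Qed.

Lemma end_sum_ge0 j : 0 <= end_sum j.
Proof. exact: sumr_ge0. Qed.

Section PieceBounds.
Variable M : R.
Hypothesis M_ge1 : 1 <= M.
Hypothesis stepM : forall l (s : R), (l <= m)%N -> `|derive1n l (@step R) s| <= M.

Definition ext_const : R :=
  2 ^+ m * ((1 + M) * poly_const) + 2 ^+ m * (M * step_const).

Let M_ge0 : 0 <= M.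
Proof. exact: le_trans ler01 M_ge1. Qed.

Let pc_ge0 : 0 <= poly_const.
Proof. by rewrite exprn_ge0// mulr_ge0// ?exprn_ge0// addr_ge0// mulr_ge0. Qed.

Lemma ext_const_ge0 : 0 <= ext_const.
Proof.
rewrite addr_ge0// mulr_ge0 ?exprn_ge0//; apply: mulr_ge0 => //.
  by rewrite addr_ge0.
exact: step_const_ge0.
Qed.

Lemma poly_const_le : poly_const <= 2 ^+ m * ((1 + M) * poly_const).
Proof.
rewrite mulrA -[leLHS]mul1r ler_wpM2r//.
by rewrite -[leLHS]mul1r ler_pM// ?exprn_ege1 ?lerDl// ler1n.
Qed.

(** The [k]-th derivative of the ramp has the size of the [- k]-th power of the
    gap, and the polynomial that it multiplies has the size of its [m]-th power. *)
Lemma piece_bound_short k j t : (k <= m)%N -> gap X j <= 1 ->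
  X j <= t <= X (j + 1) -> `|derive1n k (piece j) t| <= ext_const * near_sum j.
Proof.
move=> km gj jt; have g0 : 0 < gap X j by exact: gap_gt0.
have wj : ramp_width j = gap X j by rewrite /ramp_width min_r.
have -> : piece j = horner (Pi j) + ramp (gap X j) (X j) * horner (Pi (j + 1) - Pi j).
  apply/funext => s; rewrite pieceE wj.
  have -> : X (j + 1) - gap X j = X j by rewrite /gap opprB addrC subrK.
  rewrite -[RHS]/((Pi j).[s] + ramp (gap X j) (X j) s * (Pi (j + 1) - Pi j).[s]).
  by rewrite hornerD hornerN; ring.
have sr := @smooth_ramp R (gap X j) (X j).
have sd := @smooth_horner R (Pi (j + 1) - Pi j).
rewrite (derive1n_addf _ (@smooth_horner R (Pi j)) (smoothM sr sd)).
apply: (le_trans (ler_normD _ _)); rewrite mulrDl; apply: lerD.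
  have [jt1 jt2] := andP jt.
  have tj1 : `|t - X j| <= 1.
    rewrite ger0_norm ?subr_ge0// (le_trans _ gj)// /gap lerB//.
  apply: (le_trans (node_poly_bound tj1 km)).
  rewrite invr1 expr1n mulr1; apply: ler_pM => //.
  - exact: sumr_ge0.
  - exact: poly_const_le.
  - apply: end_sum_near; exact: (off_lt offP).
have bQ := node_poly_step_bound gj jt.
have K0 : 0 <= gap X j ^+ m * (step_const * \sum_(s < m) `|short_dd X f m (j - s%:Z)|).
  rewrite mulr_ge0 ?exprn_ge0 ?(ltW g0)// mulr_ge0 ?step_const_ge0// sumr_ge0//.
have := scaled_boundM g0 M_ge0 K0 sr sd (scaled_bound_ramp _ t g0 stepM) bQ => /(_ k km).
move=> /le_trans; apply.
have gk : gap X j ^+ m * (gap X j)^-1 ^+ k <= 1.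
  rewrite -(subnK km) exprD -mulrA -exprMn divff ?lt0r_neq0// expr1n mulr1.
  by rewrite exprn_ile1// ltW.
have -> : 2 ^+ m * (M * (gap X j ^+ m * (step_const * \sum_(s < m) `|short_dd X f m (j - s%:Z)|))) *
    (gap X j)^-1 ^+ k =
  2 ^+ m * (M * step_const) * (\sum_(s < m) `|short_dd X f m (j - s%:Z)|) *
    (gap X j ^+ m * (gap X j)^-1 ^+ k) by ring.
have c0 : 0 <= 2 ^+ m * (M * step_const).
  by rewrite mulr_ge0 ?exprn_ge0// mulr_ge0 ?step_const_ge0.
apply: (@le_trans _ _ (2 ^+ m * (M * step_const) * \sum_(s < m) `|short_dd X f m (j - s%:Z)|)).
  rewrite -[leRHS]mulr1; apply: ler_wpM2l => //.
  by rewrite mulr_ge0// sumr_ge0.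
by rewrite ler_wpM2l// near_sum_top.
Qed.

Lemma derive1n_vanish k (G : R -> R) t : {near t, G =1 cst 0} -> derive1n k G t = 0.
Proof. by move=> /(near_eq_derive1n k)/nbhs_singleton ->; rewrite derive1n_cst0. Qed.

Lemma piece_bound_long k j t : (k <= m)%N -> 1 < gap X j ->
  X j < t < X (j + 1) -> `|derive1n k (piece j) t| <=
  ext_const * near_sum j * (t <= X j + 1)%R%:R +
  ext_const * end_sum (j + 1) * (X (j + 1) - 1 <= t)%R%:R.
Proof.
move=> km gj /andP[jt tj].
have wj : ramp_width j = 1 by rewrite /ramp_width min_l// ltW.
have pl : 2 ^+ m * ((1 + M) * poly_const) <= ext_const.
  by rewrite lerDl mulr_ge0 ?exprn_ge0// mulr_ge0 ?step_const_ge0.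
have sd := @smooth_down j; have sr := @smooth_ramp R (ramp_width j) (X (j + 1) - ramp_width j).
have sp i := @smooth_horner R (Pi i).
rewrite /piece (derive1n_addf _ (smoothM sd (sp _)) (smoothM sr (sp _))).
apply: (le_trans (ler_normD _ _)); apply: lerD.
- have [tX|Xt] := leP t (X j + 1); last first.
    rewrite mulr0 derive1n_vanish ?normr0//; near=> s.
    rewrite -[LHS]/((1 - ramp (ramp_width j) (X j) s) * (Pi j).[s]).
    rewrite wj ramp_ge ?subrr ?mul0r//.
    by apply: ltW; near: s; exact: lt_nbhsr.
  rewrite mulr1; have tj1 : `|t - X j| <= 1.
    by rewrite ger0_norm ?subr_ge0 ?(ltW jt)// lerBlDl.
  have bd : scaled_bound m 1 (1 + M) (cst 1 - ramp (ramp_width j) (X j) : R -> R) t.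
    apply: scaled_boundD; [exact: smooth_cst|exact: (smoothN (@smooth_ramp R _ _))| |].
      by have := @scaled_bound_cst R m 1 1 t ltr01; rewrite normr1.
    rewrite -wj; apply: scaled_boundN; first exact: smooth_ramp.
    exact: scaled_bound_ramp (ramp_width_gt0 j) stepM.
  have K0 : 0 <= poly_const * \sum_(k < m) `|short_dd X f k (j - (off j)%:Z)|.
    by rewrite mulr_ge0// sumr_ge0.
  have M10 : 0 <= 1 + M by rewrite addr_ge0.
  have := scaled_boundM ltr01 M10 K0 sd (sp j) bd (node_poly_bound tj1) => /(_ k km).
  move=> H; apply: (le_trans H); rewrite invr1 expr1n mulr1 (mulrA (1 + M)) mulrA.
  apply: ler_pM => //; last by apply: end_sum_near; exact: (off_lt offP).
  - by rewrite !mulr_ge0 ?exprn_ge0.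
  - exact: sumr_ge0.
- have [tX|Xt] := leP (X (j + 1) - 1) t; last first.
    rewrite mulr0 derive1n_vanish ?normr0//; near=> s.
    rewrite -[LHS]/(ramp (ramp_width j) (X (j + 1) - ramp_width j) s * (Pi (j + 1)).[s]).
    rewrite wj ramp_le ?mul0r//.
    by apply: ltW; near: s; exact: lt_nbhsl.
  rewrite mulr1; have tj1 : `|t - X (j + 1)| <= 1.
    by rewrite ler0_norm ?subr_le0 ?(ltW tj)// opprB lerBlDl -lerBlDr.
  have K0 : 0 <= poly_const * \sum_(k < m) `|short_dd X f k (j + 1 - (off (j + 1))%:Z)|.
    by rewrite mulr_ge0// sumr_ge0.
  have br := scaled_bound_ramp (X (j + 1) - ramp_width j) t (ramp_width_gt0 j) stepM.
  rewrite {1}wj in br.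
  have := scaled_boundM ltr01 M_ge0 K0 sr (sp (j + 1)) br (node_poly_bound tj1) => /(_ k km).
  move=> H; apply: (le_trans H); rewrite invr1 expr1n mulr1.
  rewrite (off_long m_gt0 offP gj) subr0 (mulrA M) mulrA -/(end_sum (j + 1)).
  rewrite ler_wpM2r ?end_sum_ge0// (le_trans _ pl)// ler_wpM2l ?exprn_ge0//.
  by rewrite ler_wpM2r// lerDr.
Unshelve. all: by end_near. Qed.

End PieceBounds.

End Extension.

(** In a gap longer than 1 the extension vanishes at distance more than 1 from the
    two nodes, whence the truth values that multiply the bounds there. *)
Definition controlled_extension {R : realType} m (K : R) X f F : Prop :=
  [/\ smooth F, forall j, F (X j) = f (X j),
    forall k j t, (k <= m)%N -> gap X j <= 1 -> X j < t < X (j + 1) ->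
      `|derive1n k F t| <= K * near_sum m X f j &
    forall k j t, (k <= m)%N -> 1 < gap X j -> X j < t < X (j + 1) ->
      `|derive1n k F t| <= K * near_sum m X f j * (t <= X j + 1)%R%:R +
        K * end_sum m X f (j + 1) * (X (j + 1) - 1 <= t)%R%:R].

(** The constant comes from the bounds on the derivatives of [step] and does not
    depend on the sequence. *)
Lemma smooth_extension {R : realType} (m : nat) : (0 < m)%N ->
  exists2 K : R, 0 <= K & forall (X : int -> R) (f : R -> R),
    (forall i, X i < X (i + 1)) ->
    (forall t, exists j, X j <= t < X (j + 1)) ->
    exists F : R -> R, controlled_extension m K X f F.
Proof.
move=> m_gt0; have [M M1 HM] := @derive1n_step_bounded R m.
have HM' l s : (l <= m)%N -> `|derive1n l (@step R) s| <= M by exact: HM.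
exists (ext_const m M); first exact: ext_const_ge0.
move=> X f XS Xc; have [off offP] := offset_exists X m_gt0.
have [F FE] : exists F : R -> R, forall j t, X j <= t < X (j + 1) ->
    F t = piece m X f off j t by exact: ext_exists.
exists F; split.
- exact: (smooth_ext XS Xc FE).
- exact: (ext_interpolates m_gt0 XS offP FE).
- move=> k j t km gj jt; rewrite (ext_derive1n FE k jt).
  by apply: piece_bound_short => //; case/andP: jt => /ltW -> /ltW.
- move=> k j t km gj jt; rewrite (ext_derive1n FE k jt).
  exact: piece_bound_long.
Qed.

(** * Sums of powers *)

Section PowerSums.
Context {R : realType}.
Variable p : R.
Hypothesis p_gt1 : 1 < p.
Implicit Types (a b c t : R).

Let p_gt0 : 0 < p.
Proof. exact: lt_trans ltr01 p_gt1. Qed.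

Lemma ler_powR2 a b : 0 <= a -> a <= b -> a `^ p <= b `^ p.
Proof.
by move=> a0 ab; apply: ge0_ler_powR; rewrite ?nnegrE ?(ltW p_gt0)// (le_trans a0).
Qed.

Lemma powRK a : 0 <= a -> (a `^ p^-1) `^ p = a.
Proof. by move=> a0; rewrite -powRrM mulVf ?powRr1// lt0r_neq0. Qed.

Lemma ler_powR_root a b : 0 <= a -> a `^ p <= b -> a <= b `^ p^-1.
Proof.
move=> a0 ab; have -> : a = (a `^ p) `^ p^-1 by rewrite -powRrM divff ?powRr1// lt0r_neq0.
by apply: ge0_ler_powR; rewrite ?nnegrE ?invr_ge0 ?(ltW p_gt0) ?powR_ge0// (le_trans _ ab)// powR_ge0.
Qed.

Lemma sum_powR_le n (a : 'I_n -> R) : (forall i, 0 <= a i) ->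
  (\sum_(i < n) a i) `^ p <= n%:R `^ p * \sum_(i < n) a i `^ p.
Proof.
move=> a0; set S := \sum_(i < n) a i `^ p.
have S0 : 0 <= S by apply: sumr_ge0 => i _; exact: powR_ge0.
rewrite -[S in leRHS](powRK S0) -powRM// ?powR_ge0//.
apply: ler_powR2; first exact: sumr_ge0.
apply: (@le_trans _ _ (\sum_(i < n) S `^ p^-1)); last first.
  by rewrite sumr_const card_ord mulr_natl.
apply: ler_sum => i _; apply: ler_powR_root => //.
by rewrite /S (bigD1 i)//= lerDl sumr_ge0// => j _; exact: powR_ge0.
Qed.

Lemma powRD_le2 a b : 0 <= a -> 0 <= b -> (a + b) `^ p <= 2 `^ p * (a `^ p + b `^ p).
Proof.
move=> a0 b0; have := @sum_powR_le 2 (fun i => if i == ord0 then a else b).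
rewrite !big_ord_recl !big_ord0 /= !addr0; apply.
by move=> i; case: ifP.
Qed.

(** A pointwise substitute for the Hoelder inequality: if [a] exceeds [tau] then
    [a] is bounded by [tau ^ (1 - p) * a ^ p]. *)
Lemma young_threshold a tau : 0 <= a -> 0 < tau -> a <= tau + tau `^ (1 - p) * a `^ p.
Proof.
move=> a0 t0; have [ta|ta] := leP a tau.
  by rewrite (le_trans ta)// lerDl mulr_ge0// powR_ge0.
rewrite -[leLHS]add0r lerD ?(ltW t0)//.
have a1 : 0 < a by exact: lt_trans ta.
rewrite -(mulr_powRB1 a0 p_gt0) mulrCA -[leLHS]mulr1 ler_wpM2l//.
rewrite -opprB powRN mulrC ler_pdivlMr ?powR_gt0// mul1r.
by apply: ge0_ler_powR; rewrite ?nnegrE ?subr_ge0 ?ltW.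
Qed.

(** With [tau = x / (2 * W)] the first term is half of [x] and is absorbed by the
    left-hand side. *)
Lemma threshold_bound (W x S : R) : 0 < W -> 0 <= x -> 0 <= S ->
  (forall tau, 0 < tau -> x <= W * tau + tau `^ (1 - p) * S) ->
  W * x `^ p <= (2 * W) `^ p * S.
Proof.
move=> W0 x0 S0 H; have [->|xn0] := eqVneq x 0.
  by rewrite powR0 ?mulr0 ?mulr_ge0 ?powR_ge0// lt0r_neq0.
have xp : 0 < x by rewrite lt_neqAle eq_sym xn0.
have W2 : 0 < 2 * W by rewrite mulr_gt0.
have [tau t0 xE] : exists2 tau, 0 < tau & x = 2 * W * tau.
  by exists (x / (2 * W)); [rewrite divr_gt0|rewrite mulrCA divff ?mulr1// lt0r_neq0].
have := H _ t0; rewrite {1}xE => HH.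
have {HH} : W * tau <= tau `^ (1 - p) * S.
  by rewrite -(@lerD2l _ (W * tau)) (le_trans _ HH)// -mulrA mulr_natl mulr2n.
move=> H1; rewrite xE powRM ?(ltW t0) ?(ltW W2)// mulrCA; apply: ler_wpM2l; first exact: powR_ge0.
have -> : S = tau `^ (p - 1) * (tau `^ (1 - p) * S).
  rewrite mulrA -powRD; last by apply/implyP => _; rewrite lt0r_neq0.
  by rewrite addrA subrK subrr powRr0 mul1r.
rewrite -(mulr_powRB1 (ltW t0) p_gt0) [leLHS]mulrA [leLHS]mulrC.
by apply: ler_wpM2l; [exact: powR_ge0|].
Qed.

(** A form of Jensen's inequality for weights of bounded total mass. *)
Lemma weighted_sum_powR n (w a : 'I_n -> R) (W : R) : 1 <= W ->
  (forall i, 0 <= w i) -> (forall i, 0 <= a i) -> \sum_(i < n) w i <= W ->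
  (\sum_(i < n) w i * a i) `^ p <= (2 * W) `^ p * \sum_(i < n) w i * a i `^ p.
Proof.
move=> W1 w0 a0 wW.
apply: (@le_trans _ _ (W * (\sum_(i < n) w i * a i) `^ p)).
  by rewrite -[leLHS]mul1r ler_wpM2r// powR_ge0.
apply: threshold_bound.
- exact: lt_le_trans W1.
- by apply: sumr_ge0 => i _; exact: mulr_ge0.
- by apply: sumr_ge0 => i _; rewrite mulr_ge0// powR_ge0.
move=> tau t0; rewrite mulr_sumr.
apply: (@le_trans _ _ (\sum_(i < n) (w i * tau + tau `^ (1 - p) * (w i * a i `^ p)))).
  apply: ler_sum => i _; rewrite mulrCA -mulrDr ler_wpM2l//.
  exact: young_threshold.
by rewrite big_split/= -mulr_suml lerD2r ler_wpM2r// ltW.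
Qed.

End PowerSums.

Section DiscreteSums.
Context {R : realType}.
Variables (m : nat) (X : int -> R) (f : R -> R).
Hypothesis m_gt0 : (0 < m)%N.
Hypothesis XS : forall i : int, X i < X (i + 1).
Hypothesis Xcover : forall t : R, exists j : int, X j <= t < X (j + 1).
Variables (p B : R).
Hypothesis p_gt1 : 1 < p.
Implicit Types (i j : int) (J : seq int).

Definition local_energy i : R :=
  \sum_(k < m.+1) weight m X i * `|short_dd X f k i| `^ p.

(** The sum over all integers is replaced by its finite partial sums. *)
Hypothesis energy_le : forall J, uniq J -> \sum_(i <- J) local_energy i <= B.

Let p_gt0 : 0 < p.
Proof. exact: lt_trans ltr01 p_gt1. Qed.

Lemma energy_bound_ge0 : 0 <= B.
Proof. by have := @energy_le [::] isT; rewrite big_nil. Qed.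

(** The gap [j] belongs to all the windows of [near_sum], so its length, truncated
    at 1, is at most their weight. *)
Lemma near_sum_energy j : Num.min 1 (gap X j) * near_sum m X f j `^ p <=
  (m%:R * m.+1%:R) `^ p * \sum_(s < m) local_energy (j - s%:Z).
Proof.
have w0 : 0 <= Num.min 1 (gap X j) by rewrite le_min ler01 ltW// gap_gt0.
set w := Num.min 1 _ in w0 *.
pose I s := \sum_(k < m.+1) `|short_dd X f k (j - s%:Z)| `^ p.
apply: (@le_trans _ _ (w * (m%:R `^ p * \sum_(s < m) (m.+1%:R `^ p * I s)))).
  apply: ler_wpM2l => //; rewrite /near_sum.
  apply: (le_trans (sum_powR_le p_gt1 _)) => [s|]; first exact: sumr_ge0.
  rewrite ler_wpM2l ?powR_ge0//; apply: ler_sum => s _.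
  exact: sum_powR_le.
rewrite -mulr_sumr (_ : w * _ = m%:R `^ p * m.+1%:R `^ p * (w * \sum_(s < m) I s)); last by ring.
rewrite -powRM//; apply: ler_wpM2l; first exact: powR_ge0.
rewrite mulr_sumr; apply: ler_sum => s _; rewrite /local_energy -mulr_sumr.
apply: ler_wpM2r; first by apply: sumr_ge0 => k _; exact: powR_ge0.
exact: weight_min_gap.
Qed.

Lemma sequence_unbounded i (c : R) : exists n : nat, c < X (i + n%:Z).
Proof.
have [j /andP[_ cj]] := Xcover c; exists (absz (j + 1 - i)%R).
by apply: (lt_le_trans cj); apply: sequence_mono => //; lia.
Qed.

(** The embedding expresses [end_sum] as a weighted sum of total mass at most [2 *
    m]. *)
Lemma end_sum_energy i : exists2 n : nat,
  (forall s, (s < n)%N -> X (i + s%:Z) <= X i + 1) &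
  end_sum m X f i `^ p <=
    (16 * m%:R * m.+1%:R) `^ p * \sum_(s < n) local_energy (i + s%:Z).
Proof.
have [n Xn emb] := embedding f XS m_gt0 (sequence_unbounded i); exists n => //.
pose A s := \sum_(k < m.+1) `|short_dd X f k (i + s%:Z)|.
have A0 s : 0 <= A s by exact: sumr_ge0.
have w0 s : 0 <= weight m X (i + s%:Z) by exact: weight_ge0.
have H : end_sum m X f i <= \sum_(s < n) weight m X (i + s%:Z) * (4 * A s).
  apply: (@le_trans _ _ (\sum_(k < m) 2 * \sum_(s < n) weight m X (i + s%:Z) *
       (`|short_dd X f k (i + s%:Z)| + `|short_dd X f k.+1 (i + s%:Z)|))).
    by apply: ler_sum => k _; exact: emb.
  rewrite -mulr_sumr exchange_big/= mulr_sumr; apply: ler_sum => s _.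
  rewrite -mulr_sumr mulrCA; apply: ler_wpM2l => //.
  rewrite (_ : 4 * A s = 2 * (A s + A s)); last by ring.
  rewrite ler_wpM2l// big_split/=; apply: lerD.
    by rewrite /A big_ord_recr/= lerDl.
  by rewrite /A big_ord_recl/= lerDr.
apply: (@le_trans _ _ ((\sum_(s < n) weight m X (i + s%:Z) * (4 * A s)) `^ p)).
  by apply: (ler_powR2 p_gt1) => //; exact: end_sum_ge0.
have W1 : 1 <= 2 * m%:R :> R by rewrite -natrM ler1n muln_gt0.
apply: (le_trans (weighted_sum_powR p_gt1 W1 _ _ (sum_weight_le XS m_gt0 Xn))).
- by move=> s; exact: w0.
- by move=> s; rewrite mulr_ge0.
rewrite (_ : 16 * m%:R * m.+1%:R = 2 * (2 * m%:R) * 4 * m.+1%:R); last by ring.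
rewrite [in leRHS]powRM ?mulr_ge0// [in leRHS]powRM ?mulr_ge0//.
rewrite -!mulrA; apply: ler_wpM2l; first exact: powR_ge0.
rewrite !mulr_sumr; apply: ler_sum => s _.
rewrite powRM// mulrCA; apply: ler_wpM2l; first exact: powR_ge0.
rewrite /local_energy -mulr_sumr mulrCA; apply: ler_wpM2l => //.
exact: sum_powR_le.
Qed.

Lemma uniq_flatten_disjoint (T U : eqType) (h : T -> seq U) (s : seq T) :
  uniq s -> (forall x, uniq (h x)) ->
  (forall x y, x \in s -> y \in s -> forall z, z \in h x -> z \in h y -> x = y) ->
  uniq (flatten [seq h x | x <- s]).
Proof.
elim: s => [//|x s IH] /= /andP[xs us] uh dis; rewrite cat_uniq uh IH//=; last first.
  by move=> a b ain bin; apply: dis; rewrite inE ?ain ?bin orbT.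
rewrite andbT; apply/hasPn => z /flatten_mapP[y ys zy]; apply/negP => zx.
have := dis x y; rewrite mem_head inE ys orbT => /(_ isT isT z zx zy) xy.
by move: xs; rewrite xy ys.
Qed.

Definition gap_energy j : R :=
  Num.min 1 (gap X j) * near_sum m X f j `^ p +
  (1 < gap X j)%R%:R * end_sum m X f (j + 1) `^ p.

Definition energy_const : R := 32 * m%:R * m%:R * m.+1%:R.

(** A window is counted by at most [m] gaps, and the stretches of length 1 that
    follow distinct long gaps have no node in common. *)
Lemma sum_gap_energy J : uniq J ->
  \sum_(j <- J) gap_energy j <= energy_const `^ p * B.
Proof.
move=> uJ; rewrite big_split/=.
have B0 := energy_bound_ge0.
have m1 : 1 <= m%:R :> R by rewrite ler1n.
set c : R := 16 * m%:R * m%:R * m.+1%:R.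
have c0 : 0 <= c by rewrite !mulr_ge0.
have H1 : \sum_(j <- J) Num.min 1 (gap X j) * near_sum m X f j `^ p <= c `^ p * B.
  apply: (@le_trans _ _ (\sum_(j <- J) (m%:R * m.+1%:R) `^ p *
      \sum_(s < m) local_energy (j - s%:Z))).
    by apply: ler_sum => j _; exact: near_sum_energy.
  rewrite -mulr_sumr exchange_big/=.
  apply: (@le_trans _ _ ((m%:R * m.+1%:R) `^ p * (m%:R `^ p * B))).
    apply: ler_wpM2l; first exact: powR_ge0.
    apply: (@le_trans _ _ (\sum_(s < m) B)).
      apply: ler_sum => s _.
      rewrite -(big_map (fun j => j - s%:Z) xpredT local_energy).
      by apply: energy_le; rewrite map_inj_uniq// => a b /addIr.
    have -> : \sum_(s < m) B = m%:R * B by rewrite sumr_const card_ord mulr_natl.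
    apply: ler_wpM2r => //.
    rewrite -[leLHS]powRr1//; exact: (ler_powR m1 (ltW p_gt1)).
  rewrite mulrA -powRM ?mulr_ge0//; apply: ler_wpM2r => //.
  apply: (ler_powR2 p_gt1); first by rewrite !mulr_ge0.
  rewrite /c -!mulrA (mulrC m.+1%:R) -[leLHS]mul1r ler_wpM2r ?mulr_ge0//.
  by rewrite ler1n.
have H2 : \sum_(j <- J) (1 < gap X j)%R%:R * end_sum m X f (j + 1) `^ p <= c `^ p * B.
  (* The stretch [h j] of the nodes that follow the long gap [j] ends before the next
     long gap. *)
  have /choice[n Hn] : forall i, exists n : nat,
      (forall s, (s < n)%N -> X (i + s%:Z) <= X i + 1) /\
      end_sum m X f i `^ p <= (16 * m%:R * m.+1%:R) `^ p * \sum_(s < n) local_energy (i + s%:Z).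
    by move=> i; have [n ? ?] := end_sum_energy i; exists n.
  pose h j := [seq j + 1 + s%:Z | s <- iota 0 (n (j + 1))].
  pose Jl := [seq j <- J | 1 < gap X j].
  apply: (@le_trans _ _ ((16 * m%:R * m.+1%:R) `^ p *
      \sum_(i <- flatten [seq h j | j <- Jl]) local_energy i)).
    rewrite big_flatten big_map big_filter mulr_sumr [leRHS]big_mkcond/=.
    apply: ler_sum => j _; case: ifP => _; last by rewrite mul0r.
    rewrite mul1r /h big_map; have [_] := Hn (j + 1).
    by rewrite -(big_mkord xpredT (fun s => local_energy (j + 1 + s%:Z))) /index_iota subn0.
  apply: (@le_trans _ _ ((16 * m%:R * m.+1%:R) `^ p * B)).
    apply: ler_wpM2l; first exact: powR_ge0.
    apply: energy_le; apply: uniq_flatten_disjoint.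
    - exact: filter_uniq.
    - by move=> j; rewrite map_inj_uniq ?iota_uniq// => a b /addrI [].
    have key j j' z : 1 < gap X j' -> (j < j')%R -> z \in h j -> z \in h j' -> False.
      move=> gj' jj' /mapP[s + ->] /mapP[s' _ e]; rewrite mem_iota add0n => /= sn.
      have [/(_ s sn) + _] := Hn (j + 1).
      have H3 : X (j + 1) <= X j' by apply: sequence_mono => //; lia.
      have H4 : X (j' + 1) <= X (j + 1 + s%:Z) by apply: sequence_mono => //; lia.
      move=> H5; have H6 := le_trans H4 H5.
      move: gj'; rewrite /gap ltrBrDr => H7; have := lt_le_trans H7 H6.
      by rewrite addrC ltrD2r ltNge H3.
    move=> j j'; rewrite !mem_filter => /andP[gj _] /andP[gj' _] z zj zj'.
    have [jj|jj|//] := ltgtP j j'.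
      by case: (key j j' z).
    by case: (key j' j z).
  apply: ler_wpM2r => //; apply: (ler_powR2 p_gt1); first by rewrite !mulr_ge0.
  by rewrite /c -!mulrA ler_wpM2l// -[leLHS]mul1r ler_wpM2r// mulr_ge0.
apply: (le_trans (lerD H1 H2)).
rewrite (_ : energy_const = 2 * c); last by rewrite /energy_const /c; ring.
have -> : c `^ p * B + c `^ p * B = 2 * (c `^ p * B) by rewrite mulr_natl mulr2n.
rewrite powRM// -mulrA; apply: ler_wpM2r.
  by rewrite mulr_ge0// powR_ge0.
rewrite -[leLHS]powRr1//; apply: ler_powR; last exact: ltW.
by rewrite ler1n.
Qed.

End DiscreteSums.

(** * Norms of the extension *)

Section IntegralBounds.
Context {R : realType}.
Local Notation mu := (@lebesgue_measure R).

Lemma integral_le_two_indic (D A E : set R) (g : R -> R) (c1 c2 : R) :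
  measurable D -> measurable A -> measurable E -> measurable_fun D g ->
  0 <= c1 -> 0 <= c2 -> (forall x, D x -> 0 <= g x) ->
  (forall x, D x -> g x <= c1 * \1_A x + c2 * \1_E x) ->
  (\int[mu]_(x in D) (g x)%:E <= c1%:E * mu A + c2%:E * mu E)%E.
Proof.
move=> mD mA mE mg c10 c20 g0 gle.
apply: (@le_trans _ _ (\int[mu]_(x in D) (c1%:E * (\1_A x)%:E + c2%:E * (\1_E x)%:E))%E).
  apply: ge0_le_integral => //.
  - exact/measurable_EFinP.
  - by apply: emeasurable_funD; apply: emeasurable_funM => //; apply/measurable_EFinP;
       apply: measurable_funTS; exact: measurable_indic.
have mI B : measurable B -> measurable_fun D (fun x => (\1_B x : R)%:E).
  by move=> mB; apply/measurable_EFinP; apply: measurable_funTS; exact: measurable_indic.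
rewrite ge0_integralD//; last 4 first.
- by move=> x _; rewrite mule_ge0// lee_fin.
- by apply: emeasurable_funM => //; exact: mI.
- by move=> x _; rewrite mule_ge0// lee_fin.
- by apply: emeasurable_funM => //; exact: mI.
rewrite !ge0_integralZl_EFin//; [|exact: mI|exact: mI].
rewrite !integral_indic//; apply: leeD; apply: lee_pmul => //.
- by apply: le_measure; rewrite ?inE//; exact: measurableI.
- by apply: le_measure; rewrite ?inE//; exact: measurableI.
Qed.

Lemma measurable_powR_norm (D : set R) (g : R -> R) (p : R) : measurable_fun D g ->
  measurable_fun D (fun x => `|g x| `^ p).
Proof.
move=> mg; apply: (@measurableT_comp _ _ _ _ _ _ (fun x : R => x `^ p)) => //.
exact: measurableT_comp.
Qed.

End IntegralBounds.

Section ExtensionNorm.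
Context {R : realType}.
Local Notation mu := (@lebesgue_measure R).
Variables (m : nat) (X : int -> R) (f : R -> R).
Hypothesis m_gt0 : (0 < m)%N.
Hypothesis XS : forall i : int, X i < X (i + 1).
Hypothesis Xcover : forall t : R, exists j : int, X j <= t < X (j + 1).
Variables (K : R) (F : R -> R).
Hypothesis K_ge0 : 0 <= K.
Hypothesis sF : smooth F.
Hypothesis F_short : forall k j t, (k <= m)%N -> gap X j <= 1 ->
  X j < t < X (j + 1) -> `|derive1n k F t| <= K * near_sum m X f j.
Hypothesis F_long : forall k j t, (k <= m)%N -> 1 < gap X j ->
  X j < t < X (j + 1) -> `|derive1n k F t| <=
    K * near_sum m X f j * (t <= X j + 1)%R%:R +
    K * end_sum m X f (j + 1) * (X (j + 1) - 1 <= t)%R%:R.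

(** The bounds inside the gaps extend to the nodes by continuity. *)
Lemma ext_bounded (S : R) : (forall k i, (k <= m)%N -> `|short_dd X f k i| <= S) ->
  forall k t, (k <= m)%N -> `|derive1n k F t| <= K * (m%:R * (m%:R + 2)) * S.
Proof.
move=> HS; have S0 : 0 <= S by apply: le_trans (HS 0%N 0 isT).
have sumc n (c : R) : \sum_(i < n) c = n%:R * c by rewrite sumr_const card_ord mulr_natl.
have near_le j : near_sum m X f j <= m%:R * (m%:R + 1) * S.
  apply: (@le_trans _ _ (\sum_(s < m) \sum_(k < m.+1) S)).
    by apply: ler_sum => s _; apply: ler_sum => k _; apply: HS; rewrite -ltnS.
  by rewrite !sumc -addn1 natrD mulrA.
have end_le j : end_sum m X f j <= m%:R * S.
  apply: (@le_trans _ _ (\sum_(k < m) S)).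
    by apply: ler_sum => k _; apply: HS; exact: ltnW.
  by rewrite sumc.
have n0 j : 0 <= near_sum m X f j by exact: near_sum_ge0.
have e0 j : 0 <= end_sum m X f j by exact: end_sum_ge0.
have inner k j t : (k <= m)%N -> X j < t < X (j + 1) ->
    `|derive1n k F t| <= K * (m%:R * (m%:R + 2)) * S.
  move=> km jt; rewrite (_ : K * _ * S = K * (m%:R * (m%:R + 1) * S) + K * (m%:R * S)); last by ring.
  have [gj|gj] := leP (gap X j) 1.
    apply: (le_trans (F_short km gj jt)); rewrite -[leLHS]addr0; apply: lerD.
      exact: ler_wpM2l.
    by rewrite mulr_ge0// mulr_ge0.
  apply: (le_trans (F_long km gj jt)); apply: lerD.
    rewrite -[leRHS]mulr1; apply: ler_pM; rewrite ?mulr_ge0//; first exact: ler_wpM2l.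
    by rewrite lern1 leq_b1.
  rewrite -[leRHS]mulr1; apply: ler_pM; rewrite ?mulr_ge0//; first exact: ler_wpM2l.
  by rewrite lern1 leq_b1.
move=> k t km; have [j /andP[]] := Xcover t.
rewrite le_eqVlt => /predU1P[<-|jt] tj; last by apply: (inner _ j); rewrite ?jt.
have cF : derive1n k F x @[x --> (X j)^'+] --> derive1n k F (X j).
  apply: cvg_at_right_filter; exact: (smooth_continuous (@smooth_derive1n R k _ sF)).
have cN : `|derive1n k F x| @[x --> (X j)^'+] --> `|derive1n k F (X j)| by apply: cvg_norm.
rewrite -(cvg_lim _ cN)//; apply: limr_le; first exact: cvgP cN.
near=> x; apply: (inner _ j) => //; apply/andP; split => //.
Unshelve. all: by end_near. Qed.

Variables (p B : R).
Hypothesis p_gt1 : 1 < p.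
Hypothesis energy_le : forall J, uniq J -> \sum_(i <- J) local_energy m X f p i <= B.

Let p_gt0 : 0 < p.
Proof. exact: lt_trans ltr01 p_gt1. Qed.

Lemma integral_gap_le k j : (k <= m)%N ->
  (\int[mu]_(t in `[X j, X (j + 1)[) (`|derive1n k F t| `^ p)%:E <=
   ((2 * K) `^ p * gap_energy m X f p j)%:E)%E.
Proof.
move=> km.
have mF D : measurable_fun D (derive1n k F).
  apply: measurable_funTS; apply: continuous_measurable_fun.
  exact: (smooth_continuous (@smooth_derive1n R k _ sF)).
have n0 : 0 <= near_sum m X f j by exact: near_sum_ge0.
have e0 : 0 <= end_sum m X f (j + 1) by exact: end_sum_ge0.
rewrite integral_itv_bndoo; last first.
  by apply/measurable_EFinP; exact: measurable_powR_norm.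
have [gj|gj] := leP (gap X j) 1.
- apply: (@le_trans _ _ (((K * near_sum m X f j) `^ p)%:E * mu `[X j, X (j + 1)] + 0%:E * mu set0)%E).
    apply: integral_le_two_indic; [exact: measurable_itv|exact: measurable_itv|
      exact: measurable0|exact: measurable_powR_norm|exact: powR_ge0|by []|
      by move=> t _; exact: powR_ge0|].
      move=> t /=; rewrite in_itv/= => jt; rewrite mul0r addr0 indicE mem_set ?mulr1.
        by apply: (ler_powR2 p_gt1) => //; exact: F_short.
      by rewrite /= in_itv/=; case/andP: jt => /ltW -> /ltW.
  rewrite mul0e adde0 lebesgue_measure_segment ?(ltW (XS j))// -EFinM lee_fin.
  rewrite /gap_energy ltNge gj mul0r addr0 min_r// -/(gap X j) !powRM ?mulr_ge0//.
  rewrite (_ : K `^ p * _ * _ = K `^ p * (gap X j * near_sum m X f j `^ p)); last by ring.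
  rewrite ler_wpM2r ?mulr_ge0 ?powR_ge0 ?(ltW (gap_gt0 XS j))//.
  rewrite -[leLHS]mul1r ler_wpM2r ?powR_ge0//.
  by rewrite -[leLHS](powRr0 2) ler_powR ?ler1n// ltW.
- pose c1 := (2 * (K * near_sum m X f j)) `^ p.
  pose c2 := (2 * (K * end_sum m X f (j + 1))) `^ p.
  apply: (@le_trans _ _ (c1%:E * mu `[X j, (X j + 1)%R] + c2%:E * mu `[(X (j + 1) - 1)%R, X (j + 1)])%E).
    apply: integral_le_two_indic; [exact: measurable_itv|exact: measurable_itv|
      exact: measurable_itv|exact: measurable_powR_norm|exact: powR_ge0|
      exact: powR_ge0|by move=> t _; exact: powR_ge0|].
      move=> t /=; rewrite in_itv/= => jt.
      have H := F_long km gj jt.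
      set i1 := (t <= X j + 1)%R in H; set i2 := (X (j + 1) - 1 <= t)%R in H.
      have I1 : \1_(`[X j, X j + 1]) t = i1%:R :> R.
        rewrite indicE; congr (_ %:R); congr nat_of_bool; apply/idP/idP.
          by rewrite inE/= in_itv/= => /andP[].
        by move=> h; rewrite inE/= in_itv/=; case/andP: jt => /ltW ->.
      have I2 : \1_(`[X (j + 1) - 1, X (j + 1)]) t = i2%:R :> R.
        rewrite indicE; congr (_ %:R); congr nat_of_bool; apply/idP/idP.
          by rewrite inE/= in_itv/= => /andP[].
        by move=> h; rewrite inE/= in_itv/=; case/andP: jt => _ /ltW ->; rewrite andbT.
      rewrite I1 I2; apply: (le_trans (ler_powR2 p_gt1 _ H)) => //.
      apply: (le_trans (powRD_le2 p_gt1 _ _)); rewrite ?mulr_ge0//.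
      rewrite mulrDr -!powRM ?mulr_ge0// /c1 /c2.
      have P0 : (0 : R) `^ p = 0 by rewrite powR0// lt0r_neq0.
      by case: i1 {H I1}; case: i2 {I2}; rewrite ?mulr1 ?mulr0 ?P0 ?addr0 ?add0r.
  rewrite !lebesgue_measure_segment ?lerDl ?lerBlDr ?lerDl//.
  rewrite (_ : X j + 1 - X j = 1); last by ring.
  rewrite (_ : X (j + 1) - (X (j + 1) - 1) = 1); last by ring.
  rewrite !mule1 -EFinD lee_fin /gap_energy gj mul1r min_l ?(ltW gj)// mul1r.
  by rewrite mulrDr -!powRM ?mulr_ge0// /c1 /c2 -!mulrA.
Qed.

Lemma integral_range_le k i n : (k <= m)%N ->
  (\int[mu]_(t in `[X i, X (i + n%:Z)[) (`|derive1n k F t| `^ p)%:E <=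
   \sum_(s < n) ((2 * K) `^ p * gap_energy m X f p (i + s%:Z))%:E)%E.
Proof.
move=> km; elim: n => [|n IH].
  by rewrite addr0 big_ord0 set_itv_ge ?integral_set0// bnd_simp ltxx.
have mF D : measurable_fun D (fun t => (`|derive1n k F t| `^ p)%:E).
  apply/measurable_EFinP; apply: measurable_powR_norm.
  apply: measurable_funTS; apply: continuous_measurable_fun.
  exact: (smooth_continuous (@smooth_derive1n R k _ sF)).
have E : i + n.+1%:Z = i + n%:Z + 1 by lia.
rewrite (_ : `[X i, X (i + n.+1%:Z)[%classic =
  `[X i, X (i + n%:Z)[%classic `|` `[X (i + n%:Z), X (i + n%:Z + 1)[%classic); last first.
  rewrite E; apply: itv_bndbnd_setU; rewrite bnd_simp.
  - exact: sequence_leD.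
  - exact: ltW.
rewrite ge0_integral_setU//; last 2 first.
- exact: mF.
- by apply: lt_disjoint => a b; rewrite !in_itv/= => /andP[_ ai] /andP[ib _]; exact: lt_le_trans ib.
rewrite big_ord_recr/=; apply: leeD; first exact: IH.
exact: integral_gap_le.
Qed.

Lemma ext_integral_le k : (k <= m)%N ->
  (\int[mu]_t (`|derive1n k F t| `^ p)%:E <= ((2 * K * energy_const m) `^ p * B)%:E)%E.
Proof.
move=> km.
pose D n : set R := `[X (- n%:Z), X (- n%:Z + (n + n)%:Z)[%classic.
have DT : \bigcup_n D n = setT.
  rewrite -subTset => t _; have [j /andP[jt tj]] := Xcover t.
  exists (absz j).+1 => //=; rewrite /D/= in_itv/=; apply/andP; split.
    by apply: le_trans jt; apply: sequence_mono => //; lia.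
  by apply: (lt_le_trans tj); apply: sequence_mono => //; lia.
have mF : measurable_fun setT (fun t => (`|derive1n k F t| `^ p)%:E).
  apply/measurable_EFinP; apply: measurable_powR_norm.
  apply: continuous_measurable_fun.
  exact: (smooth_continuous (@smooth_derive1n R k _ sF)).
have cvD : (\int[mu]_(t in D n) (`|derive1n k F t| `^ p)%:E)%E @[n --> \oo] -->
    (\int[mu]_(t in \bigcup_n D n) (`|derive1n k F t| `^ p)%:E)%E.
  apply: ge0_nondecreasing_set_cvg_integral.
  - apply/nondecreasing_seqP => n; rewrite subsetEset /D; apply: subset_itv; rewrite bnd_simp.
      by apply: sequence_mono => //; lia.
    by apply: sequence_mono => //; lia.
  - by move=> n; exact: measurable_itv.
  - by move=> n; exact: measurable_funTS mF.
  - by move=> n t _; rewrite lee_fin powR_ge0.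
rewrite DT in cvD; rewrite -(cvg_lim _ cvD)//; apply: lime_le; first exact: cvgP cvD.
near=> n; apply: (le_trans (integral_range_le _ _ km)).
rewrite sumEFin lee_fin -mulr_sumr (@powRM _ (2 * K)) ?mulr_ge0// -mulrA.
apply: ler_wpM2l; first exact: powR_ge0.
rewrite -(big_mkord xpredT (fun s => gap_energy m X f p (- n%:Z + s%:Z))).
rewrite -(big_map (fun s : nat => - n%:Z + s%:Z) xpredT (gap_energy m X f p)).
apply: (sum_gap_energy m_gt0 XS Xcover p_gt1 energy_le).
by rewrite map_inj_uniq ?iota_uniq// => a b /addrI [].
Unshelve. all: by end_near. Qed.

End ExtensionNorm.

(** * Divided differences of Sobolev functions *)

Section LocalEstimates.
Context {R : realType}.
Local Notation mu := (@lebesgue_measure R).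
Variables (m : nat) (X : int -> R) (F : R -> R) (D : nat -> R -> R).
Hypothesis m_gt0 : (0 < m)%N.
Hypothesis XS : forall i : int, X i < X (i + 1).
Hypothesis derivable_F : forall k t, (k < m.-1)%N -> derivable (derive1n k F) t 1.
Hypothesis D_F : forall k, (k < m)%N -> D k = derive1n k F.
Hypothesis measurable_D : forall k, (k <= m)%N -> measurable_fun setT (D k).
Hypothesis D_increment : forall k a b, (k < m)%N -> a <= b ->
  (`|D k b - D k a|%:E <= \int[mu]_(t in `[a, b]) `|D k.+1 t|%:E)%E.

Let measurable_normD k A : (k <= m)%N -> measurable_fun A (fun t => `|D k t|%:E).
Proof.
move=> km; apply/measurable_EFinP; apply: measurable_funTS.
by apply: measurableT_comp => //; exact: measurable_D.
Qed.

(** Average of [|D k xi| <= |D k t| + int |D (k + 1)|] over the points [t] of the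
    interval; as [d <= 1], the factor [d] of the second term can be dropped. *)
Lemma le_average k a d xi : (k < m)%N -> 0 <= d <= 1 -> xi \in `[a, a + d] ->
  ((d * `|D k xi|)%:E <= \int[mu]_(t in `[a, (a + d)%R]) `|D k t|%:E +
     \int[mu]_(t in `[a, (a + d)%R]) `|D k.+1 t|%:E)%E.
Proof.
move=> km /andP[d0 d1] xiJ.
have ad : a <= a + d by rewrite lerDl.
set I1 := (\int[mu]_(t in _) `|D k.+1 t|%:E)%E.
have I10 : (0 <= I1)%E by exact: integral_ge0.
have key t : t \in `[a, a + d] -> (`|D k xi|%:E <= `|D k t|%:E + I1)%E.
  rewrite !in_itv/= in xiJ * => tJ.
  have incr u v : a <= u -> u <= v -> v <= a + d -> (`|D k v - D k u|%:E <= I1)%E.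
    move=> au uv vd; apply: (le_trans (D_increment km uv)).
    apply: ge0_subset_integral => //; [exact: measurable_normD|].
    by apply: subset_itv; rewrite bnd_simp.
  apply: (@le_trans _ _ (`|D k t|%:E + `|D k xi - D k t|%:E)%E).
    by rewrite -EFinD lee_fin -lerBlDl; apply: le_trans (lerB_dist _ _) _; rewrite lexx.
  apply: leeD => //; case/andP: xiJ => ? ?; case/andP: tJ => ? ?.
  by have [tx|/ltW xt] := leP t xi; [|rewrite distrC]; exact: incr.
have [->|I1fin] := eqVneq I1 +oo%E.
  by rewrite addey ?leey// gt_eqF// (lt_le_trans (ltNyr 0))// integral_ge0.
have I1E : I1 = (fine I1)%:E by rewrite fineK// ge0_fin_numE// lt_neqAle I1fin leey.
have r0 : 0 <= fine I1 by exact: fine_ge0.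
apply: (@le_trans _ _ (\int[mu]_(t in `[a, (a + d)%R]) (`|D k t|%:E + (fine I1)%:E))%E).
  rewrite (_ : (_ * _)%:E = \int[mu]_(t in `[a, (a + d)%R]) (cst `|D k xi|%:E t))%E; last first.
    rewrite integral_cst//= lebesgue_measure_segment// -EFinM mulrC; congr (_ * _)%:E.
    by rewrite addrAC subrr add0r.
  apply: ge0_le_integral => //.
  - by move=> t _; rewrite lee_fin.
  - by apply: emeasurable_funD => //; exact: measurable_normD (ltnW km).
  - by move=> t /= /key; rewrite {1}I1E.
rewrite ge0_integralD//; last by apply: measurable_normD; exact: ltnW.
apply: leeD => //; rewrite integral_cst//= lebesgue_measure_segment// I1E -EFinM lee_fin.
by rewrite /= (addrAC a) subrr add0r -[leRHS]mulr1 ler_wpM2l.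
Qed.

Lemma dd_node k i : (k < m)%N ->
  exists2 xi, X i <= xi <= X (i + k%:Z) & `|dd k F (window X i)| <= `|D k xi|.
Proof.
move=> km; have [||xi xiI E] := @dd_mean_value R k F (window X i) (window_inj XS (i:=i)).
- by move=> s _; apply: sequence_incr => //; lia.
- by move=> j t jk; apply: derivable_F; lia.
exists xi; first by move: xiI; rewrite /window addr0.
rewrite D_F// E normrM (ger0_norm (ler0n _ _)) -[leLHS]mulr1; apply: ler_wpM2l => //; rewrite ler1n.
exact: fact_gt0.
Qed.

(** The interval is placed around the intermediate point of the mean value theorem,
    and is pushed to the right if it would begin before [X i]. *)
Lemma dd_le_average k i : (k < m)%N -> exists a,
  [/\ X i <= a, a + weight m X i <= X (i + m%:Z) &
  ((weight m X i * `|dd k F (window X i)|)%:E <=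
     \int[mu]_(t in `[a, (a + weight m X i)%R]) `|D k t|%:E +
     \int[mu]_(t in `[a, (a + weight m X i)%R]) `|D k.+1 t|%:E)%E].
Proof.
move=> km; have [xi /andP[xi1 xi2] H] := dd_node i km; set w := weight m X i.
have w0 : 0 <= w by exact: weight_ge0.
have w1 : w <= 1 by rewrite /w /weight ge_min lexx.
have wX : X i + w <= X (i + m%:Z) by rewrite -lerBrDl /w /weight ge_min lexx orbT.
have xi3 : xi <= X (i + m%:Z) by apply: (le_trans xi2); apply: sequence_mono => //; lia.
exists (Num.max (X i) (xi - w)); split.
- by rewrite le_max lexx.
- by rewrite maxEle; case: ifP => // _; rewrite subrK.
apply: le_trans; last first.
  apply: (@le_average k _ w xi km); first by rewrite w0.
  rewrite in_itv/= ge_max xi1 gerBl w0 /= -lerBlDr le_max lexx orbT.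
  by [].
by rewrite lee_fin ler_wpM2l.
Qed.

(** The derivative of order [m] is only a weak one, so the mean value theorem is
    applied at order [m - 1] on the two halves of the recursion. *)
Lemma dd_top_le i : (((X (i + m%:Z) - X i) * `|dd m F (window X i)|)%:E <=
  \int[mu]_(t in `[X i, X (i + m%:Z)]) `|D m t|%:E)%E.
Proof.
have m1 : (m.-1 < m)%N by rewrite prednK.
have mval j : exists2 xi, X j <= xi <= X (j + m.-1%:Z) &
    D m.-1 xi = dd m.-1 F (window X j) * (m.-1)`!%:R.
  have [||xi xiI E] := @dd_mean_value R m.-1 F (window X j) (window_inj XS (i:=j)).
  - by move=> s _; apply: sequence_incr => //; lia.
  - by move=> l t lk; apply: derivable_F.
  by exists xi; [move: xiI; rewrite /window addr0|rewrite D_F].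
have [xi /andP[a1 a2] E1] := mval i; have [xi' /andP[b1 b2] E2] := mval (i + 1).
have IS : i + 1 + m.-1%:Z = i + m%:Z by lia.
rewrite IS in b2.
have i1 : X i <= X (i + 1) by exact: ltW.
have i2 : X (i + m.-1%:Z) <= X (i + m%:Z) by apply: sequence_mono => //; lia.
have H : (X (i + m%:Z) - X i) * `|dd m F (window X i)| <= `|D m.-1 xi' - D m.-1 xi|.
  rewrite E1 E2 -mulrBl -windowS (ddS _ _ (window_inj XS (i:=i))) /window addr0 prednK//.
  rewrite !normrM (ger0_norm (x := X _ - X _)) ?subr_ge0; last by apply: sequence_mono => //; lia.
  rewrite -[leLHS]mulr1 ler_wpM2l ?mulr_ge0 ?subr_ge0//; first by apply: sequence_mono => //; lia.
  by rewrite ger0_norm// ler1n fact_gt0.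
apply: (@le_trans _ _ `|D m.-1 xi' - D m.-1 xi|%:E); first by rewrite lee_fin.
have incr u v : X i <= u -> u <= v -> v <= X (i + m%:Z) ->
    (`|D m.-1 v - D m.-1 u|%:E <= \int[mu]_(t in `[X i, X (i + m%:Z)]) `|D m t|%:E)%E.
  move=> au uv vd; apply: (le_trans (D_increment m1 uv)); rewrite prednK//.
  apply: ge0_subset_integral => //; [exact: measurable_normD|].
  by apply: subset_itv; rewrite bnd_simp.
have [tx|/ltW xt] := leP xi xi'; [|rewrite distrC]; apply: incr => //.
- exact: le_trans i1 b1.
- exact: le_trans a2 i2.
Qed.

Lemma le_integral_affine (h G : R -> R) a b c e : a <= b ->
  measurable_fun setT h -> measurable_fun setT G -> 0 <= c -> 0 <= e ->
  (forall t, 0 <= h t) -> (forall t, 0 <= G t) ->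
  {ae mu, forall t, h t <= c + e * G t} ->
  (\int[mu]_(t in `[a, b]) (h t)%:E <= (c * (b - a))%:E + e%:E * \int[mu]_(t in `[a, b]) (G t)%:E)%E.
Proof.
move=> ab mh mG c0 e0 h0 G0 hG.
have mG' : measurable_fun `[a, b] (fun t => (G t)%:E).
  by apply/measurable_EFinP; exact: measurable_funTS.
apply: (@le_trans _ _ (\int[mu]_(t in `[a, b]) (c%:E + e%:E * (G t)%:E))%E).
  apply: ae_ge0_le_integral => //.
  - by move=> t _; rewrite lee_fin.
  - by apply/measurable_EFinP; exact: measurable_funTS.
  - by move=> t _; rewrite adde_ge0// mule_ge0// lee_fin.
  - by apply: emeasurable_funD => //; exact: emeasurable_funM.
  - by move: hG; apply: filterS => t H _; rewrite -EFinM -EFinD lee_fin.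
rewrite ge0_integralD//; last 2 first.
- by move=> t _; rewrite mule_ge0// lee_fin.
- exact: emeasurable_funM.
rewrite ge0_integralZl_EFin//; last by move=> t _; rewrite lee_fin.
apply: leeD => //.
by rewrite integral_cst//= lebesgue_measure_segment.
Qed.

Lemma weight_gt0 i : 0 < weight m X i.
Proof. by rewrite /weight lt_min ltr01 subr_gt0; apply: sequence_incr => //; lia. Qed.

(** Averages of functions bounded by [S] almost everywhere are at most [S]. *)
Lemma dd_le_ess_bound S k i : 0 <= S ->
  (forall l, (l <= m)%N -> {ae mu, forall t, `|D l t| <= S}) -> (k <= m)%N ->
  `|dd k F (window X i)| <= 2 * S.
Proof.
move=> S0 HS; have w0 := weight_gt0 i.
have bound l a b : (l <= m)%N -> a <= b ->
    (\int[mu]_(t in `[a, b]) `|D l t|%:E <= (S * (b - a))%:E)%E.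
  move=> lm ab; apply: (le_trans (@le_integral_affine (fun t => `|D l t|) (cst 0) a b S 0 ab _ _ _ _ _ _ _)) => //.
  - by apply: measurableT_comp => //; exact: measurable_D.
  - by move: (HS l lm); apply: filterS => t; rewrite mul0r addr0.
  - by rewrite mul0e adde0.
rewrite leq_eqVlt => /predU1P[->|km].
  have L0 : 0 < X (i + m%:Z) - X i by rewrite subr_gt0; apply: sequence_incr => //; lia.
  have := le_trans (dd_top_le i) (bound m _ _ (leqnn m) (ltW (sequence_incr XS _))).
  rewrite lee_fin (mulrC S) ler_pM2l; last by apply: L0.
  by move=> H; apply: (le_trans (H _)); [lia|rewrite ler_peMl// ler1n].
have [a [_ _ H]] := dd_le_average i km.
have aw : a <= a + weight m X i by rewrite lerDl ltW.
have := le_trans H (leeD (bound k _ _ (ltnW km) aw) (bound k.+1 _ _ km aw)).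
rewrite (addrAC a) subrr add0r -EFinD lee_fin (_ : _ + _ = weight m X i * (2 * S)); last by ring.
by rewrite ler_pM2l.
Qed.

Variable p : R.
Hypothesis p_gt1 : 1 < p.

Let G t := \sum_(l < m.+1) `|D l t| `^ p.

Let G_ge0 t : 0 <= G t.
Proof. by apply: sumr_ge0 => l _; exact: powR_ge0. Qed.

Let measurable_G : measurable_fun setT G.
Proof.
apply: measurable_sum => l; apply: measurable_powR_norm; apply: measurable_D.
by rewrite -ltnS.
Qed.

Lemma dd_local_energy k i S : (k <= m)%N ->
  (\int[mu]_(t in `[X i, X (i + m%:Z)]) (G t)%:E = S%:E)%E ->
  weight m X i * `|dd k F (window X i)| `^ p <= 4 `^ p * S.
Proof.
move=> km SE; have w0 := weight_gt0 i; set w := weight m X i in w0 *.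
have Xm : X i < X (i + m%:Z) by apply: sequence_incr => //; lia.
have S0 : 0 <= S by rewrite -lee_fin -SE; apply: integral_ge0 => t _; rewrite lee_fin.
have bound l a b tau : (l <= m)%N -> a <= b -> X i <= a -> b <= X (i + m%:Z) -> 0 < tau ->
    (\int[mu]_(t in `[a, b]) `|D l t|%:E <= (tau * (b - a) + tau `^ (1 - p) * S)%:E)%E.
  move=> lm ab ia bi tau0.
  apply: (le_trans (@le_integral_affine (fun t => `|D l t|) G a b tau (tau `^ (1 - p)) ab _ _ _ _ _ _ _)) => //.
  - by apply: measurableT_comp => //; exact: measurable_D.
  - exact: ltW.
  - exact: powR_ge0.
  - apply: aeW => t; apply: (le_trans (young_threshold p_gt1 _ tau0)) => //.
    rewrite lerD2l ler_wpM2l ?powR_ge0//.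
    by rewrite /G (bigD1 (Ordinal (n:=m.+1) (m:=l) _))//= lerDl sumr_ge0// => j _; exact: powR_ge0.
  - rewrite EFinD EFinM; apply: leeD => //; rewrite EFinM -SE; apply: lee_pmul => //.
    + by rewrite lee_fin powR_ge0.
    + by apply: integral_ge0 => t _; rewrite lee_fin.
    + apply: ge0_subset_integral => //.
      * by apply/measurable_EFinP; exact: measurable_funTS.
      * by move=> t _; rewrite lee_fin.
      * by apply: subset_itv; rewrite bnd_simp.
set y := `|dd k F (window X i)|.
have y0 : 0 <= y by exact: normr_ge0.
move: km; rewrite leq_eqVlt => /predU1P[km|km].
  have L0 : 0 < X (i + m%:Z) - X i by rewrite subr_gt0.
  set L := X (i + m%:Z) - X i in L0.
  have Hy tau : 0 < tau -> y <= 1 * tau + tau `^ (1 - p) * (S / L).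
    move=> tau0; have := le_trans (dd_top_le i) (bound m _ _ _ (leqnn m) (ltW Xm) (lexx _) (lexx _) tau0).
    rewrite lee_fin -km -/y km -/L -ler_pdivlMl// => /le_trans; apply.
    by rewrite mul1r mulrDr (mulrC tau) mulKf ?lt0r_neq0// mulrCA (mulrC S).
  have := threshold_bound p_gt1 ltr01 y0 (divr_ge0 S0 (ltW L0)) Hy.
  rewrite mul1r mulr1 mulrA ler_pdivlMr// mulrC => H.
  apply: (@le_trans _ _ (L * y `^ p)).
    by rewrite ler_wpM2r ?powR_ge0// /w /weight ge_min lexx orbT.
  apply: (le_trans H); rewrite ler_wpM2r//.
  by apply: ler_powR2 => //; rewrite ler_nat.
have [a [ia ai H]] := dd_le_average i km.
have aw : a <= a + w by rewrite lerDl ltW.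
have Hy tau : 0 < tau -> y <= 2 * tau + tau `^ (1 - p) * (2 * (S / w)).
  move=> tau0; have := le_trans H (leeD (bound k _ _ _ (ltnW km) aw ia ai tau0) (bound k.+1 _ _ _ km aw ia ai tau0)).
  rewrite -EFinD lee_fin -/y -/w (addrAC a) subrr add0r -ler_pdivlMl// => /le_trans; apply.
  rewrite le_eqVlt; apply/orP; left; apply/eqP; field.
  exact: lt0r_neq0.
have H1 : 0 <= 2 * (S / w) by rewrite mulr_ge0// divr_ge0// ltW.
have := threshold_bound p_gt1 (ltr0Sn R 1) y0 H1 Hy.
rewrite (_ : 2 * 2 = 4); last by ring.
rewrite mulrCA ler_pM2l// mulrA ler_pdivlMr// mulrC.
by [].
Qed.

(** A window that contains [t] starts at most [m] indices before the gap of [t]. *)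
Lemma overlap_count t (J : seq int) : uniq J ->
  (forall s : R, exists j : int, X j <= s < X (j + 1)) ->
  \sum_(i <- J) (\1_(`[X i, X (i + m%:Z)]) t : R) <= m.+1%:R.
Proof.
move=> uJ /(_ t)[j /andP[jt tj]].
under eq_bigr do rewrite indicE.
rewrite -natr_sum ler_nat.
rewrite -big_mkcond/= sum1_count -size_filter -(size_iota 0 m.+1).
rewrite -(size_map (fun s : nat => j - s%:Z)); apply: uniq_leq_size.
  exact: filter_uniq.
move=> i; rewrite mem_filter => /andP[+ _]; rewrite inE/= in_itv/= => /andP[it ti].
apply/(@mapP _ _ _ (iota 0 m.+1)).
have ij : (i < j + 1)%R by apply: (sequence_lt_inv XS); exact: le_lt_trans it tj.
have ji : (j <= i + m%:Z)%R by apply: (sequence_le_inv XS); exact: le_trans jt ti.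
by exists (absz (j - i)); [rewrite mem_iota; lia|lia].
Qed.

(** The local estimates are summed under the integral sign. *)
Lemma dd_energy_le k (J : seq int) T : (k <= m)%N -> uniq J ->
  (forall s : R, exists j : int, X j <= s < X (j + 1)) ->
  (\int[mu]_t (G t)%:E <= T%:E)%E ->
  \sum_(i <- J) weight m X i * `|dd k F (window X i)| `^ p <= 4 `^ p * m.+1%:R * T.
Proof.
move=> km uJ Xc HT.
pose I (i : int) : set R := `[X i, X (i + m%:Z)]%classic.
have mGE A : measurable_fun A (fun t => (G t)%:E).
  by apply/measurable_EFinP; exact: measurable_funTS.
have fI i : exists S, (\int[mu]_(t in I i) (G t)%:E = S%:E)%E.
  have H : (\int[mu]_(t in I i) (G t)%:E <= T%:E)%E.
    apply: le_trans HT; apply: ge0_subset_integral;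
      [exact: measurable_itv|exact: measurableT|exact: mGE|by move=> t _; rewrite lee_fin|by []].
  exists (fine (\int[mu]_(t in I i) (G t)%:E)); rewrite fineK// ge0_fin_numE.
    exact: le_lt_trans H (ltry _).
  by apply: integral_ge0 => t _; rewrite lee_fin.
have mR i : measurable_fun setT ((fun t => (G t)%:E) \_ (I i)).
  by apply/(measurable_restrictT _ (measurable_itv _)); exact: mGE.
have /choice[S SE] := fI.
apply: (@le_trans _ _ (4 `^ p * \sum_(i <- J) S i)).
  by rewrite mulr_sumr; apply: ler_sum => i _; exact: (dd_local_energy km (SE i)).
rewrite -mulrA; apply: ler_wpM2l; first exact: powR_ge0.
rewrite -lee_fin -sumEFin; under eq_bigr do rewrite -SE integral_mkcond.
rewrite -ge0_integral_sum//; last first.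
  by move=> i t _; rewrite patchE; case: ifP => // _; rewrite lee_fin.
rewrite EFinM; apply: (@le_trans _ _ (m.+1%:R%:E * \int[mu]_t (G t)%:E)%E); last first.
  by rewrite lee_pmul2l ?lte_fin ?ltr0Sn.
have GE0 t : [set: R] t -> (0 <= (G t)%:E)%E by rewrite lee_fin.
rewrite -(ge0_integralZl_EFin mu measurableT GE0 (mGE _)) ?ler0n//.
apply: ge0_le_integral => //.
- by move=> t _; apply: sume_ge0 => i _; rewrite patchE; case: ifP => // _; rewrite lee_fin.
- apply: emeasurable_sum => i; exact: mR.
- by apply: emeasurable_funM => //; exact: mGE.
move=> t _; have := ler_wpM2r (G_ge0 t) (overlap_count t uJ Xc).
rewrite -lee_fin -EFinM; apply: le_trans; rewrite mulr_suml -sumEFin.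
by apply: lee_sum => i _; rewrite patchE indicE; case: ifP => _; rewrite lee_fin ?mul1r ?mul0r.
Qed.

End LocalEstimates.

(** * Bi-infinite sequences *)

Section ExtendedSequence.
Context {R : realType}.

(** A limit would be an element of [E], hence would be exceeded by the sequence. *)
Lemma increasing_closed_unbounded (E : set R) (y : nat -> R) : closed E ->
  (forall n, y n < y n.+1) -> (forall n, E (y n)) ->
  (forall e, E e -> exists n, e < y n) -> forall t, exists n, t < y n.
Proof.
move=> cE yS Ey above t; apply/not_existsP => H.
have ub n : y n <= t by rewrite leNgt; apply/negP; exact: H.
have yi : nondecreasing_seq y by apply/nondecreasing_seqP => n; exact: ltW.
have cy : cvgn y.
  by apply: nondecreasing_is_cvgn => //; exists t => _ [n _ <-].
have El : E (limn y) by exact: (closed_cvg _ cE (nearW _ Ey) _ cy).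
have [n] := above _ El; rewrite ltNge => /negP; apply.
exact: (nondecreasing_cvgn_le yi cy).
Qed.

Lemma closed_image_opp (E : set R) : closed E -> closed [set - e | e in E].
Proof.
move=> cE; rewrite (_ : [set _ | _ in _] = -%R @^-1` E); last first.
  apply/seteqP; split => [_ [e Ee <-]|e Ee]; first by rewrite /= opprK.
  by exists (- e); rewrite ?opprK.
by apply: preimage_closed => // e _; exact: opp_continuous.
Qed.

Variables (l1 l2 : \bar int) (x : int -> R) (f : R -> R).
Hypothesis hl : (l1 <= l2)%E.
Hypothesis hx : forall i j : int, index_range l1 l2 i -> index_range l1 l2 j ->
  i < j -> x i < x j.
Local Notation E := (point_set l1 l2 x).
Hypothesis hclosed : closed E.
Implicit Types (i j : int) (k : nat).

(** The missing indices are filled with points at mutual distance 2, so that no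
    window with short gaps can leave the original sequence. If there is no point at
    all, [fine] gives 0 and the sequence is arithmetic. *)
Definition extended_sequence i : R :=
  if ~~ (l1 <= i%:E)%E then x (fine l1) - 2 * (fine l1 - i)%:~R
  else if ~~ (i%:E <= l2)%E then x (fine l2) + 2 * (i - fine l2)%:~R
  else x i.

Local Notation X := extended_sequence.

Lemma extended_sequenceE i : index_range l1 l2 i -> X i = x i.
Proof. by rewrite /X => -[-> ->]. Qed.

Lemma extended_gap i : ~ (index_range l1 l2 i /\ index_range l1 l2 (i + 1)) ->
  X (i + 1) - X i = 2.
Proof.
move=> H; have {}H : ~~ [&& (l1 <= i%:E)%E, (i%:E <= l2)%E,
    (l1 <= (i + 1)%:E)%E & ((i + 1)%:E <= l2)%E].
  by apply/negP => /and4P[? ? ? ?]; apply: H.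
have two (a b : int) : a = b + 1 -> (a%:~R : R) = b%:~R + 1.
  by move=> ->; rewrite intrD.
move: H; rewrite /X; move: l1 l2 hl => [a||] [b||]; rewrite ?lee_fin ?leNye ?leye_eq ?leey//=.
- move=> ab H; have [ai|ia] := lerP a i.
    have -> : (a <= i + 1) by lia.
    have [ib|bi] := lerP i b.
      have [e1 e2] : i = b /\ (i + 1 <= b) = false by lia.
      rewrite e2 /= e1 (_ : b + 1 - b = 1); last by lia.
      by rewrite mulr1 addrAC subrr add0r.
    have -> /= : (i + 1 <= b) = false by lia.
    rewrite (two (i + 1 - b) (i - b)); last by lia.
    by ring.
  have [ai1|ia1] := lerP a (i + 1).
    have e1 : i + 1 = a by lia.
    have -> /= : i + 1 <= b by lia.
    rewrite -e1 (_ : i + 1 - i = 1); last by lia.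
    by ring.
  rewrite /= (two (a - i) (a - (i + 1))); last by lia.
  by ring.
- move=> _ H; have ia : (a <= i) = false by apply/negP => ai; move: H; rewrite ai; lia.
  rewrite ia /=; have [ai1|ia1] := lerP a (i + 1).
    have e1 : i + 1 = a by lia.
    rewrite -e1 (_ : i + 1 - i = 1); last by lia.
    by rewrite /=; ring.
  rewrite /= (two (a - i) (a - (i + 1))); last by lia.
  by ring.
- move=> _ _.
  rewrite (two (0 - i) (0 - (i + 1))); last by lia.
  by ring.
- move=> _ H; have ib : (i + 1 <= b) = false by apply/negP => bi; move: H; rewrite bi; lia.
  rewrite ib /=; have [ib1|bi1] := lerP i b.
    have e1 : i = b by lia.
    rewrite e1 (_ : b + 1 - b = 1); last by lia.
    by rewrite /=; ring.
  rewrite /= (two (i + 1 - b) (i - b)); last by lia.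
  by ring.
- move=> _ _; rewrite (two (i + 1 - 0) (i - 0)); last by lia.
  by ring.
Qed.

Lemma extended_sequenceS i : X i < X (i + 1).
Proof.
have [[I1 I2]|H] := pselect (index_range l1 l2 i /\ index_range l1 l2 (i + 1)).
  by rewrite !extended_sequenceE//; apply: hx => //; lia.
by rewrite -subr_gt0 extended_gap.
Qed.

Lemma extended_point_notin i : ~ index_range l1 l2 i -> ~ E (X i).
Proof.
move=> Hi [j Ij]; rewrite -(extended_sequenceE Ij) => XE; apply: Hi.
case: (ltgtP i j) => [ij|ji|->//].
- by have := sequence_incr extended_sequenceS ij; rewrite XE ltxx.
- by have := sequence_incr extended_sequenceS ji; rewrite XE ltxx.
Qed.

Lemma linear_unbounded (c t : R) : exists n : nat, t < c + 2 * n%:R.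
Proof.
have H := archi_boundP (normr_ge0 (t - c)); set n := Num.bound _ in H.
have := le_lt_trans (ler_norm _) H => tc; exists n.
have : (0 : R) <= n%:R by [].
by lra.
Qed.

Lemma extended_unbounded_above t : exists j, t < X j.
Proof.
have [[a Ha]|H] := pselect (exists a, forall n : nat, index_range l1 l2 (a + n%:Z)).
  have [|n|e|n] := @increasing_closed_unbounded E (fun n => X (a + n%:Z)) hclosed _ _ _ t.
  - move=> n; rewrite (_ : a + n.+1%:Z = a + n%:Z + 1); last by lia.
    exact: extended_sequenceS.
  - by exists (a + n%:Z); rewrite ?extended_sequenceE.
  - move=> [j Ij <-]; exists (absz (j + 1 - a)%R); rewrite -(extended_sequenceE Ij).
    by apply: (sequence_incr extended_sequenceS); lia.
  by exists (a + n%:Z).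
have [b Hb] : exists b, forall n : nat, ~ index_range l1 l2 (b + n%:Z).
  move: H; rewrite /index_range; move: l1 l2 hl => [a||] [b||]; rewrite ?lee_fin//= => ab H.
  - by exists (b + 1) => n; rewrite !lee_fin => -[_]; lia.
  - by exfalso; apply: H; exists a => n; rewrite leey lee_fin; split => //; lia.
  - by exists 0 => n [].
  - by exists (b + 1) => n; rewrite !lee_fin => -[_]; lia.
  - by exfalso; apply: H; exists 0 => n; rewrite leey leNye.
  - by exists 0 => n [].
have XE n : X (b + n%:Z) = X b + 2 * n%:R.
  elim: n => [|n IH]; first by rewrite addr0 mulr0 addr0.
  have := @extended_gap (b + n%:Z); rewrite IH (_ : b + n%:Z + 1 = b + n.+1%:Z); last by lia.
  move=> /(_ (fun H => Hb _ H.1)) G; rewrite -natr1.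
  by rewrite -[LHS](subrK (X b + 2 * n%:R)) G; ring.
by have [n Hn] := linear_unbounded (X b) t; exists (b + n%:Z); rewrite XE.
Qed.

Lemma extended_unbounded_below t : exists j, X j < t.
Proof.
have [[a Ha]|H] := pselect (exists a, forall n : nat, index_range l1 l2 (a - n%:Z)).
  have [|n|e|n Hn] := @increasing_closed_unbounded [set - e | e in E]
      (fun n => - X (a - n%:Z)) (closed_image_opp hclosed) _ _ _ (- t).
  - move=> n; rewrite ltrN2 (_ : a - n%:Z = a - n.+1%:Z + 1); last by lia.
    exact: extended_sequenceS.
  - exists (X (a - n%:Z)) => //.
    by exists (a - n%:Z); rewrite ?extended_sequenceE.
  - move=> [_ [j Ij <-] <-]; exists (absz (j - 1 - a)%R); rewrite -(extended_sequenceE Ij) ltrN2.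
    by apply: (sequence_incr extended_sequenceS); lia.
  by exists (a - n%:Z); rewrite -ltrN2.
have [b Hb] : exists b, forall n : nat, ~ index_range l1 l2 (b - n%:Z).
  move: H; rewrite /index_range; move: l1 l2 hl => [a||] [b||]; rewrite ?lee_fin//= => ab H.
  - by exists (a - 1) => n; rewrite !lee_fin => -[]; lia.
  - by exists (a - 1) => n; rewrite !lee_fin => -[]; lia.
  - by exists 0 => n [].
  - by exfalso; apply: H; exists b => n; rewrite leNye lee_fin; split => //; lia.
  - by exfalso; apply: H; exists 0 => n; rewrite leey leNye.
  - by exists 0 => n [].
have XE n : X (b - n%:Z) = X b - 2 * n%:R.
  elim: n => [|n IH]; first by rewrite oppr0 addr0 mulr0 subr0.
  have := @extended_gap (b - n.+1%:Z); rewrite (_ : b - n.+1%:Z + 1 = b - n%:Z); last by lia.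
  rewrite IH => /(_ (fun H => Hb _ H.1)) G; rewrite -natr1; lra.
have [n Hn] := linear_unbounded (- X b) (- t); exists (b - n%:Z); rewrite XE.
by rewrite -ltrN2 opprB addrC.
Qed.

(** The sequence is unbounded on both sides, so there is a first index beyond [t]. *)
Lemma extended_cover t : exists j, X j <= t < X (j + 1).
Proof.
have [a at_] := extended_unbounded_below t; have [b tb] := extended_unbounded_above t.
have Hex : exists n : nat, t < X (a + n%:Z).
  exists (absz (b - a)); apply: (lt_le_trans tb).
  by apply: (sequence_mono extended_sequenceS); lia.
case: (ex_minnP Hex) => -[|n] tn nmin.
  by move: tn; rewrite addr0 ltNge (ltW at_).
exists (a + n%:Z); rewrite (_ : a + n%:Z + 1 = a + n.+1%:Z) ?tn ?andbT; last by lia.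
by rewrite leNgt; apply/negP => /nmin; rewrite ltnn.
Qed.

Lemma difference_range_index k i (s : nat) : difference_range l1 l2 k i -> (s <= k)%N ->
  index_range l1 l2 (i + s%:Z).
Proof.
clear hl; move=> [H1 H2] sk; split.
  by apply: (le_trans H1); rewrite lee_fin; lia.
by apply: (le_trans _ H2); rewrite lee_fin; lia.
Qed.

(** Forgets the values of [f] outside [E], which would otherwise be interpolated at
    the added points. *)
Definition restricted t : R := if `[< E t >] then f t else 0.

Lemma restrictedE t : E t -> restricted t = f t.
Proof. by move=> Et; rewrite /restricted asboolT. Qed.

Lemma dd_extended (g : R -> R) k i : (forall t, E t -> g t = f t) ->
  difference_range l1 l2 k i -> dd k g (window X i) = consecutive_difference x f k i.
Proof.
move=> gf Hi; rewrite /dd /consecutive_difference /divided_difference /window.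
have XE (s : 'I_k.+1) : X (i + s%:Z) = x (i + s%:Z).
  by apply: extended_sequenceE; apply: (difference_range_index Hi); rewrite -ltnS.
apply: eq_bigr => s _; rewrite XE gf; last first.
  by exists (i + s%:Z) => //; apply: (difference_range_index Hi); rewrite -ltnS.
by congr (_ / _); apply: eq_bigr => j _; rewrite XE.
Qed.

(** The added gaps have length 2, so a window of several points with short gaps lies
    in the original sequence, and [restricted] vanishes at the added points. *)
Lemma short_dd_extended k i : short_dd X restricted k i != 0 ->
  difference_range l1 l2 k i /\ short_dd X restricted k i = consecutive_difference x f k i.
Proof.
move=> H0; suff Hi : difference_range l1 l2 k i.
  split=> //; move: H0; rewrite /short_dd; case: ifP => [_ _|_]; last by rewrite eqxx.
  by apply: dd_extended => // t; exact: restrictedE.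
move: H0; rewrite /short_dd; case: ifPn => [/shortP sh|]; last by rewrite eqxx.
case: k sh => [_|k sh _].
  rewrite /dd /divided_difference big_ord1 big1 ?divr1; last by move=> j; rewrite ord1 eqxx.
  rewrite /window /restricted; case: asboolP => [Ei _|]; last by rewrite eqxx.
  rewrite addr0 in Ei; have [[? ?]|] := pselect (index_range l1 l2 i).
    by split=> //; rewrite addr0.
  by move/extended_point_notin.
have pair s : (s < k.+1)%N -> index_range l1 l2 (i + s%:Z) /\ index_range l1 l2 (i + s%:Z + 1).
  move=> sk; apply: contrapT => /extended_gap E2; have := sh _ sk.
  by rewrite /gap E2; lra.
split; first by have [[]] := pair 0%N isT; rewrite addr0.
have [_ [_]] := pair k (ltnSn k).
by rewrite (_ : i + k%:Z + 1 = i + k.+1%:Z)//; lia.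
Qed.

Lemma difference_range_order m k i : (k <= m)%N -> difference_range l1 l2 k i ->
  (k <= max_difference_order m E)%N.
Proof.
move=> km Hi; rewrite /max_difference_order; case: asboolP => // fE.
rewrite leq_min km /=.
suff : (k.+1 <= #|` fset_set E|)%N by case: (#|` _|).
pose s := [seq x (i + j%:Z) | j : nat <- iota 0 k.+1].
have us : uniq s.
  rewrite map_inj_in_uniq ?iota_uniq// => a b; rewrite !mem_iota !add0n !ltnS /= => ak bk.
  rewrite -!extended_sequenceE; try exact: (difference_range_index Hi).
  by move=> /(window_inj extended_sequenceS).
have -> : k.+1 = size s by rewrite size_map size_iota.
apply: uniq_leq_size => // t /mapP[j]; rewrite mem_iota add0n ltnS /= => jk ->.
rewrite in_fset_set// inE; exists (i + j%:Z) => //.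
exact: (difference_range_index Hi).
Qed.

(** Where [x_(i + m)] is infinite the window of [X] contains an added gap of length
    2, and the minimum with 1 hides the difference. *)
Lemma extended_weight m k i : (0 < m)%N -> difference_range l1 l2 k i ->
  (mine 1 (extended_point l2 x (i + m%:Z) - (x i)%:E) = (weight m X i)%:E)%E.
Proof.
move=> m0 Hi; have I0 : index_range l1 l2 i.
  by have := difference_range_index Hi (leq0n k); rewrite addr0.
rewrite /extended_point; case: ifPn => im.
  have Im : index_range l1 l2 (i + m%:Z).
    by split=> //; apply: (le_trans I0.1); rewrite lee_fin; lia.
  rewrite -EFinB -(extended_sequenceE I0) -(extended_sequenceE Im) /weight.
  by rewrite EFin_min.
rewrite addye// min_l ?leey//; congr EFin; rewrite /weight min_l//.
have [s [sm Hs]] : exists s, (s < m)%N /\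
    ~ (index_range l1 l2 (i + s%:Z) /\ index_range l1 l2 (i + s%:Z + 1)).
  exists m.-1; split; first by rewrite prednK.
  move=> [_ [_]]; rewrite (_ : i + m.-1%:Z + 1 = i + m%:Z); last by lia.
  by apply/negP.
have := extended_gap Hs => G.
have h1 : X i <= X (i + s%:Z) by exact: (sequence_leD extended_sequenceS).
have h2 : X (i + s%:Z + 1) <= X (i + m%:Z) by apply: (sequence_mono extended_sequenceS); lia.
by lra.
Qed.

End ExtendedSequence.

(** * Smooth functions in Sobolev spaces *)

Section SobolevFunctions.
Context {R : realType}.
Local Notation mu := (@lebesgue_measure R).
Implicit Types (F G : R -> R) (p : R).

Lemma abs_continuous_continuous G : abs_continuous G -> continuous G.
Proof.
move=> acG t; apply/cvgrPdist_lt => e e0.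
have [d d0 Hd] := acG (t - 1) (t + 1) _ e0.
near=> s.
have st : `|t - s| < Num.min d 1 by near: s; apply: cvgr_dist_lt => //; rewrite lt_min d0 /=.
move: st; rewrite lt_min => /andP[std]; rewrite ltr_distlC => /andP[s1 s2].
have [ts|/ltW ts] := leP t s.
  have := Hd 1%N (fun=> t) (fun=> s); rewrite !big_ord1 distrC; apply.
  - by move=> _; split => //; [rewrite lerBlDr lerDl|exact: ltW].
  - by apply/trivIsetP => i j _ _; rewrite !ord1 eqxx.
  - by rewrite (le_lt_trans _ std)// distrC ler_norm.
have := Hd 1%N (fun=> s) (fun=> t); rewrite !big_ord1; apply.
- by move=> _; split => //; [exact: ltW|rewrite lerDl].
- by apply/trivIsetP => i j _ _; rewrite !ord1 eqxx.
- by rewrite (le_lt_trans _ std)// ler_norm.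
Unshelve. all: by end_near. Qed.

(** [G] is Lipschitz on compact intervals. *)
Lemma continuous_derivative_abs_continuous G : (forall t, derivable G t 1) ->
  continuous (derive1 G) -> abs_continuous G.
Proof.
move=> dG cG' a b e e0.
have [M M0 HM] : exists2 M : R, 0 < M & forall t, t \in `[a, b] -> `|derive1 G t| <= M.
  have [|M [_ HM]] := @compact_bounded _ R (derive1 G @` `[a, b]).
    by apply: continuous_compact; [exact: continuous_subspaceT|exact: segment_compact].
  exists (`|M| + 1); first by rewrite ltr_wpDl.
  move=> t tab; apply: (HM (`|M| + 1)); first by rewrite (le_lt_trans (ler_norm M))// ltrDl.
  by exists t.
exists (e / M); first exact: divr_gt0.
move=> n u v uv _; rewrite ltr_pdivlMr// mulr_suml; apply: le_lt_trans.
apply: ler_sum => i _; have [au uv' vb] := uv i.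
move: uv'; rewrite le_eqVlt => /predU1P[->|uv']; first by rewrite !subrr normr0 mul0r.
have [||c cI ->] := @MVT R G (derive1 G) _ _ uv'.
- by move=> t _; apply: DeriveDef; [exact: dG|rewrite derive1E].
- by apply: continuous_subspaceT => t; exact: derivable_continuous.
rewrite normrM mulrC (gtr0_norm (x := _ - _)) ?subr_gt0// ler_wpM2l ?subr_ge0 ?(ltW uv')//.
apply: HM; move: cI; rewrite !in_itv/= => /andP[c1 c2].
by rewrite (le_trans au (ltW c1)) (le_trans (ltW c2) vb).
Qed.

Lemma lebesgue_measure_setT_gt0 : (0 < mu [set: R])%E.
Proof.
apply: (@lt_le_trans _ _ (mu `[0%R, 1%R])).
  by rewrite lebesgue_measure_segment// subr0 lte01.
by apply: le_measure; rewrite ?inE.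
Qed.

Lemma LnormE p G : ('N[mu]_p%:E[EFin \o G] = (\int[mu]_t (`|G t| `^ p)%:E) `^ p^-1)%E.
Proof. by rewrite unlock; congr (_ `^ _)%E; apply: eq_integral => t _; rewrite poweR_EFin. Qed.

Lemma Lnorm_le p c G : 1 < p -> 0 <= c ->
  (\int[mu]_t (`|G t| `^ p)%:E <= (c `^ p)%:E)%E -> ('N[mu]_p%:E[EFin \o G] <= c%:E)%E.
Proof.
move=> p1 c0 H; rewrite LnormE.
have p0 : 0 < p by exact: lt_trans ltr01 p1.
have -> : c = (c `^ p) `^ p^-1 by rewrite -powRrM divff ?powRr1// lt0r_neq0.
rewrite -poweR_EFin; apply: gt0_ler_poweR => //.
- by rewrite invr_ge0 ltW.
- by rewrite in_itv/= leey andbT; apply: integral_ge0 => t _; rewrite lee_fin powR_ge0.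
- by rewrite in_itv/= leey andbT lee_fin powR_ge0.
Qed.

Lemma Lnorm_le_oo c G : 0 <= c -> (forall t, `|G t| <= c) -> ('N[mu]_+oo[EFin \o G] <= c%:E)%E.
Proof.
move=> c0 H; rewrite unlock lebesgue_measure_setT_gt0.
by apply/ess_supP; apply: aeW => t /=; rewrite lee_fin.
Qed.

Lemma eq_ae_Lnorm (p : \bar R) F G : (1 < p)%E -> measurable_fun setT F ->
  measurable_fun setT G -> F = G %[ae mu] ->
  ('N[mu]_p[EFin \o F] = 'N[mu]_p[EFin \o G])%E.
Proof.
move=> p1 mF mG FG; have mP (H : R -> R) q : measurable_fun setT H ->
    measurable_fun setT (fun t => (`|H t| `^ q)%:E).
  by move=> mH; apply/measurable_EFinP; exact: measurable_powR_norm.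
case: p p1 => [p p1|_|//].
  rewrite !LnormE; congr (poweR _ _); apply: ae_eq_integral; [exact: measurableT|exact: mP|exact: mP|].
  by move: FG; apply: filterS => t /(_ Logic.I) E _; rewrite /= E.
rewrite unlock lebesgue_measure_setT_gt0; apply: eq_ess_sup.
by move: FG; apply: filterS => t /(_ Logic.I) /= ->.
Qed.

Variable m : nat.
Hypothesis m_gt0 : (0 < m)%N.

Section SmoothSobolev.
Variables (p : \bar R) (F : R -> R) (c : R).
Hypothesis p_gt1 : (1 < p)%E.
Hypothesis sF : smooth F.
Hypothesis norm_le : forall k, (k <= m)%N -> ('N[mu]_p[EFin \o derive1n k F] <= c%:E)%E.

Let D_ae k : (k <= m)%N -> [/\ measurable_fun setT (sobolev_derive m F k) &
  sobolev_derive m F k = derive1n k F %[ae mu]].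
Proof.
rewrite leq_eqVlt => /predU1P[->|km]; rewrite /sobolev_derive; last first.
  rewrite km; split; last exact: aeW.
  by apply: continuous_measurable_fun; exact: (smooth_continuous (@smooth_derive1n R k _ sF)).
rewrite ltnn; have EF : derive1 (derive1n m.-1 F) = derive1n m F by rewrite -derive1nS prednK.
have cm : continuous (derive1 (derive1n m.-1 F)).
  by rewrite EF; exact: (smooth_continuous (@smooth_derive1n R m _ sF)).
have dm t : derivable (derive1n m.-1 F) t 1 by exact: sF.
have [_ [mw _ _] _] := weak_derive_spec (is_weak_derive_classical dm cm).
split; first exact: mw.
by have := weak_derive_classical_ae dm cm; rewrite EF.
Qed.

Let D_norm k : (k <= m)%N -> ('N[mu]_p[EFin \o sobolev_derive m F k] <= c%:E)%E.
Proof.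
move=> km; have [mD aeD] := D_ae km; rewrite (eq_ae_Lnorm p_gt1 mD _ aeD); first exact: norm_le.
by apply: continuous_measurable_fun; exact: (smooth_continuous (@smooth_derive1n R k _ sF)).
Qed.

Let D_Lfun k : (k <= m)%N -> sobolev_derive m F k \in Lfun mu p.
Proof.
move=> km; have [mD _] := D_ae km; apply/andP; split; rewrite inE /=.
  exact: mD.
by rewrite /finite_norm (le_lt_trans (D_norm km))// ltry.
Qed.

(** The weak derivative of order [m] is almost everywhere the classical one, and
    the norms do not see the difference. *)
Lemma smooth_sobolev : sobolev m p F /\ (sobolev_norm m p F <= (m.+1%:R * c)%:E)%E.
Proof.
have cm k : continuous (derive1n k F) by exact: (smooth_continuous (@smooth_derive1n R k _ sF)).
have dm t : derivable (derive1n m.-1 F) t 1 by exact: sF.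
have EF : derive1 (derive1n m.-1 F) = derive1n m F by rewrite -derive1nS prednK.
have cm' : continuous (derive1 (derive1n m.-1 F)) by rewrite EF; exact: cm.
split; last first.
  apply: (@le_trans _ _ (\sum_(k < m.+1) c%:E)%E).
    by apply: lee_sum => k _; apply: D_norm; rewrite -ltnS.
  by rewrite sumEFin lee_fin sumr_const card_ord mulr_natl.
split; last exact: D_Lfun.
split.
- by move=> k t _; exact: sF.
- exact: (continuous_derivative_abs_continuous dm cm').
- by rewrite /sobolev_derive ltnn; exact: weak_derive_spec (is_weak_derive_classical dm cm').
- exact: D_Lfun.
Qed.

End SmoothSobolev.

Section SobolevDerivatives.
Variables (p : \bar R) (F : R -> R).
Hypothesis WF : sobolev m p F.
Local Notation D := (sobolev_derive m F).

Lemma sobolev_derivable k t : (k < m.-1)%N -> derivable (derive1n k F) t 1.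
Proof. by move: WF => [[dF _ _ _] _]; exact: dF. Qed.

Lemma sobolev_continuous k : (k < m)%N -> continuous (derive1n k F).
Proof.
move=> km; have [[_ acF _ _] _] := WF.
have [k1|k1] := ltnP k m.-1.
  by move=> t; apply: derivable_continuous; exact: sobolev_derivable.
have -> : k = m.-1 by lia.
exact: abs_continuous_continuous.
Qed.

Lemma sobolev_measurable k : (k <= m)%N -> measurable_fun setT (D k).
Proof.
by move=> km; have [_ /(_ _ km)] := WF; move=> /andP[+ _]; rewrite inE.
Qed.

(** Below the top order this is the classical fundamental theorem of calculus; at
    the top order it is [weak_derive_FTC]. *)
Lemma sobolev_increment k a b : (k < m)%N -> a <= b ->
  (`|D k b - D k a|%:E <= \int[mu]_(t in `[a, b]) `|D k.+1 t|%:E)%E.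
Proof.
move=> km ab; have DE : D k = derive1n k F by rewrite /sobolev_derive km.
have E : (\int[mu]_(t in `[a, b]) (D k.+1 t)%:E = (D k b - D k a)%:E)%E.
  rewrite DE; have [km1|km1] := ltnP k.+1 m.
    rewrite {1}/sobolev_derive km1 derive1nS; apply: Rintegral_derive1 => //.
    - by move=> t; apply: sobolev_derivable; lia.
    - by rewrite -derive1nS; exact: sobolev_continuous.
  have km' : k = m.-1 by lia.
  have [[_ _ wF _] _] := WF; rewrite km' prednK//; apply: weak_derive_FTC => //.
  by apply: sobolev_continuous; rewrite prednK.
rewrite -abse_EFin -E; apply: le_abse_integral => //.
by apply/measurable_EFinP; apply: measurable_funTS; exact: sobolev_measurable.
Qed.

End SobolevDerivatives.

End SobolevFunctions.

Section UniqSums.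
Context {R : realType} {T : choiceType}.
Implicit Types (S : set T) (a : T -> \bar R) (r : seq T).

Lemma sum_uniq_le_esum S a r : uniq r -> (forall i, i \in r -> S i) ->
  (\sum_(i <- r) a i <= \esum_(i in S) a i)%E.
Proof.
move=> ur rS; apply: esum_ge; exists [set` r]; last by rewrite (fsbig_seq _ _ ur).
by split; [exact: finite_seq|].
Qed.

Lemma esum_le_uniq S a (B : \bar R) :
  (forall r, uniq r -> (forall i, i \in r -> S i) -> (\sum_(i <- r) a i <= B)%E) ->
  (\esum_(i in S) a i <= B)%E.
Proof.
move=> H; apply: ge_ereal_sup => _ [A [fA AS] <-].
rewrite fsbig_finite//; apply: H; first exact: fset_uniq.
by move=> i; rewrite in_fset_set// inE; exact: AS.
Qed.

End UniqSums.

(** * The trace criterion *)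

Section TraceCriterion.
Context {R : realType}.
Local Notation mu := (@lebesgue_measure R).
Variables (m : nat) (l1 l2 : \bar int) (x : int -> R) (f : R -> R).
Hypothesis m_gt0 : (0 < m)%N.
Hypothesis hl : (l1 <= l2)%E.
Hypothesis hx : forall i j : int, index_range l1 l2 i -> index_range l1 l2 j ->
  i < j -> x i < x j.
Local Notation E := (point_set l1 l2 x).
Hypothesis hclosed : closed E.
Local Notation X := (extended_sequence l1 l2 x).
Local Notation fE := (restricted l1 l2 x f).
Local Notation mE := (max_difference_order m E).

Let XS : forall i : int, X i < X (i + 1).
Proof. exact: extended_sequenceS. Qed.

Let Xcover : forall t : R, exists j : int, X j <= t < X (j + 1).
Proof. exact: extended_cover. Qed.

Lemma max_difference_order_le : (mE <= m)%N.
Proof. by rewrite /max_difference_order; case: asboolP => // _; exact: geq_minl. Qed.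

Definition energy_term (p : R) k i : \bar R :=
  (mine 1 (extended_point l2 x (i + m%:Z) - (x i)%:E) *
   (`|consecutive_difference x f k i| `^ p)%:E)%E.

Lemma energy_termE p k i : difference_range l1 l2 k i -> energy_term p k i =
  (weight m X i * `|consecutive_difference x f k i| `^ p)%:E.
Proof. by move=> Hi; rewrite /energy_term (extended_weight hl hx m_gt0 Hi). Qed.

Lemma energy_esum_ge0 p k : (0 <= \esum_(i in difference_range l1 l2 k) energy_term p k i)%E.
Proof.
apply: esum_ge0 => i Hi; rewrite energy_termE// lee_fin mulr_ge0 ?powR_ge0//.
exact: weight_ge0.
Qed.

(** The [p]-th power of [Wtilde_fin]. *)
Definition total_energy p : \bar R :=
  (\sum_(k < mE.+1) \esum_(i in difference_range l1 l2 k) energy_term p k i)%E.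

Lemma Wtilde_finE p : Wtilde_fin m p l1 l2 x f = (total_energy p `^ p^-1)%E.
Proof. by []. Qed.

Lemma total_energy_ge0 p : (0 <= total_energy p)%E.
Proof. by apply: sume_ge0 => k _; exact: energy_esum_ge0. Qed.

(** The nonzero truncated divided differences are divided differences of [f]. *)
Lemma sum_short_dd_le_esum p k (J : seq int) : 1 < p -> uniq J ->
  ((\sum_(i <- J) weight m X i * `|short_dd X fE k i| `^ p)%:E <=
   \esum_(i in difference_range l1 l2 k) energy_term p k i)%E.
Proof.
move=> p1 uJ; have p0 : p != 0 by rewrite lt0r_neq0// (lt_trans ltr01).
(* The other indices need not be in the range of the sum. *)
pose J' := [seq i <- J | short_dd X fE k i != 0].
have H i : i \in J' -> difference_range l1 l2 k i /\
    short_dd X fE k i = consecutive_difference x f k i.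
  by rewrite mem_filter => /andP[/(short_dd_extended hl hx) ].
apply: le_trans (sum_uniq_le_esum (r := J') _ (filter_uniq _ uJ) (fun i iJ => (H i iJ).1)).
rewrite -sumEFin /J' big_filter [leRHS]big_mkcond/=.
rewrite big_seq [leRHS]big_seq; apply: lee_sum => i iJ.
case: ifPn => [c0|/negPn/eqP ->]; last by rewrite normr0 powR0// mulr0.
have [Hi ->] : difference_range l1 l2 k i /\ short_dd X fE k i = consecutive_difference x f k i.
  by apply: H; rewrite mem_filter c0 iJ.
by rewrite energy_termE.
Qed.

(** The orders between the number of points of [E] and [m] contribute nothing,
    because no window of that size is contained in [E]. *)
Lemma local_energy_le_total p (J : seq int) : 1 < p -> uniq J ->
  ((\sum_(i <- J) local_energy m X fE p i)%:E <= total_energy p)%E.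
Proof.
move=> p1 uJ; have p0 : p != 0 by rewrite lt0r_neq0// (lt_trans ltr01).
rewrite /local_energy exchange_big/= /total_energy -sumEFin.
have -> : (\sum_(k < m.+1) (\sum_(i <- J) weight m X i * `|short_dd X fE k i| `^ p)%:E =
    \sum_(k < mE.+1) (\sum_(i <- J) weight m X i * `|short_dd X fE k i| `^ p)%:E)%E.
  rewrite (@big_ord_widen _ _ _ mE.+1 m.+1
    (fun k => (\sum_(i <- J) weight m X i * `|short_dd X fE k i| `^ p)%:E)); last first.
    by rewrite ltnS max_difference_order_le.
  rewrite [RHS]big_mkcond/=; apply: eq_bigr => k _; case: ifPn => // km.
  rewrite big1// => i _; have [->|c0] := eqVneq (short_dd X fE k i) 0.
    by rewrite normr0 powR0// mulr0.
  have [Hi _] := short_dd_extended hl hx c0.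
  by move: km; rewrite ltnS (difference_range_order hl hx _ Hi) // -ltnS.
by apply: lee_sum => k _; exact: sum_short_dd_le_esum.
Qed.

Lemma Wtilde_fin_fine p : 1 < p -> (Wtilde_fin m p l1 l2 x f < +oo)%E ->
  exists B : R, [/\ 0 <= B, total_energy p = B%:E &
    Wtilde_fin m p l1 l2 x f = (B `^ p^-1)%:E].
Proof.
move=> p1; have p0 : 0 < p by exact: lt_trans ltr01 p1.
rewrite Wtilde_finE => /lty_poweRy => /(_ (invr_neq0 (lt0r_neq0 p0))) T.
have TE : total_energy p = (fine (total_energy p))%:E.
  by rewrite fineK// ge0_fin_numE// total_energy_ge0.
exists (fine (total_energy p)); split=> //.
  by rewrite fine_ge0// total_energy_ge0.
by rewrite {1}TE poweR_EFin.
Qed.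

(** The extension of [restricted f], which is [f] on [E] and 0 at the added points. *)
Lemma extension_le_Wtilde K p : 0 <= K ->
  (exists F, controlled_extension m K X fE F) ->
  (1 < p)%E -> (Wtilde m p l1 l2 x f < +oo)%E ->
  exists2 F, extensions m p E f F &
    (sobolev_norm m p F <= (m.+1%:R * (2 * K * energy_const m +
       K * (m%:R * (m%:R + 2))))%:E * Wtilde m p l1 l2 x f)%E.
Proof.
move=> K0 [F [sF FX Fshort Flong]] p1 Wfin.
have FE t : E t -> F t = f t.
  by move=> [i Ii <-]; rewrite -(extended_sequenceE _ Ii) FX restrictedE//; exists i => //; rewrite extended_sequenceE.
set c1 := 2 * K * energy_const m; set c2 := K * (m%:R * (m%:R + 2)).
have c10 : 0 <= c1 by rewrite /c1 /energy_const; rewrite !mulr_ge0.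
have c20 : 0 <= c2 by rewrite /c2 !mulr_ge0// addr_ge0.
suff [w w0 [WE Hw]] : exists2 w, 0 <= w & Wtilde m p l1 l2 x f = w%:E /\
    forall k, (k <= m)%N -> ('N[mu]_p[EFin \o derive1n k F] <= ((c1 + c2) * w)%:E)%E.
  have [WF NF] := smooth_sobolev m_gt0 p1 sF Hw.
  by exists F => //; rewrite WE -EFinM -mulrA.
case: p p1 Wfin => [p|_|//] /=.
  rewrite lte_fin => p1 Wfin; have [B [B0 BE WE]] := Wtilde_fin_fine p1 Wfin.
  have p0 : 0 < p by exact: lt_trans ltr01 p1.
  exists (B `^ p^-1); first exact: powR_ge0.
  split=> // k km; apply: Lnorm_le => //; first by rewrite mulr_ge0 ?addr_ge0 ?powR_ge0.
  have energy_le J : uniq J -> \sum_(i <- J) local_energy m X fE p i <= B.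
    by move=> uJ; rewrite -lee_fin -BE; exact: local_energy_le_total.
  apply: (le_trans (ext_integral_le m_gt0 XS Xcover K0 sF Fshort Flong p1 energy_le km)).
  rewrite lee_fin (@powRM _ (c1 + c2)) ?addr_ge0 ?powR_ge0// powRK//.
  by apply: ler_wpM2r => //; apply: ler_powR2 => //; rewrite lerDl.
move=> Wfin; have W0 : (0 <= Wtilde_oo m l1 l2 x f)%E by rewrite /Wtilde_oo le_max lexx.
have WE : Wtilde_oo m l1 l2 x f = (fine (Wtilde_oo m l1 l2 x f))%:E.
  by rewrite fineK// ge0_fin_numE.
exists (fine (Wtilde_oo m l1 l2 x f)); first exact: fine_ge0.
split=> // k km.
have Hc k' i : (k' <= m)%N -> `|short_dd X fE k' i| <= fine (Wtilde_oo m l1 l2 x f).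
  move=> km'; have [->|c0] := eqVneq (short_dd X fE k' i) 0; first by rewrite normr0 fine_ge0.
  have [Hi ->] := short_dd_extended hl hx c0.
  rewrite -lee_fin -WE /Wtilde_oo le_max; apply/orP; right.
  apply: ereal_sup_ubound; exists k', i; split => //.
  exact: (difference_range_order hl hx km' Hi).
apply: Lnorm_le_oo => [|t]; first by rewrite mulr_ge0 ?addr_ge0 ?fine_ge0.
apply: (le_trans (ext_bounded Xcover K0 sF Fshort Flong Hc t km)).
by rewrite ler_wpM2r ?fine_ge0// lerDr.
Qed.

(** The [p]-th powers of the [m + 1] norms are bounded by the power of their sum;
    together with the [m + 1] orders of divided differences and the overlap this
    gives the cube in the constant. *)
Lemma Wtilde_le p F : (1 < p)%E -> extensions m p E f F ->
  (Wtilde m p l1 l2 x f <= (4 * m.+1%:R ^+ 3)%:E * sobolev_norm m p F)%E /\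
  (sobolev_norm m p F < +oo)%E.
Proof.
move=> p1 [WF FE]; set D := sobolev_derive m F.
have mD k : (k <= m)%N -> measurable_fun setT (D k) by exact: (sobolev_measurable WF).
have D_F k : (k < m)%N -> D k = derive1n k F by rewrite /D /sobolev_derive => ->.
have incr := sobolev_increment m_gt0 WF; rewrite -/D in incr.
have dF := sobolev_derivable WF.
have N0 k : (0 <= 'N[mu]_p[EFin \o D k])%E by exact: Lnorm_ge0.
have [n Hn] : exists n : nat -> R, forall k, (k <= m)%N -> ('N[mu]_p[EFin \o D k] = (n k)%:E)%E.
  exists (fun k => fine ('N[mu]_p[EFin \o D k])%E) => k km; rewrite fineK// ge0_fin_numE//.
  by have [_ /(_ _ km)] := WF; move=> /andP[_]; rewrite inE.
have n0 k : (k <= m)%N -> 0 <= n k by move=> km; rewrite -lee_fin -Hn.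
set s := \sum_(k < m.+1) n k.
have SE : sobolev_norm m p F = s%:E.
  by rewrite /sobolev_norm -sumEFin; apply: eq_bigr => k _; rewrite Hn// -ltnS.
have s0 : 0 <= s by apply: sumr_ge0 => k _; apply: n0; rewrite -ltnS.
have ns k : (k <= m)%N -> n k <= s.
  move=> km; rewrite /s (bigD1 (Ordinal (n:=m.+1) (m:=k) km))//= lerDl.
  by apply: sumr_ge0 => j _; apply: n0; rewrite -ltnS.
rewrite SE; split; last exact: ltry.
have M1 : 1 <= m.+1%:R :> R by rewrite ler1n.
have M0 : 0 <= m.+1%:R :> R by [].
case: p p1 WF N0 Hn SE => [p|_|//] /=.
  rewrite lte_fin => p1 WF N0 Hn SE; have p0 : 0 < p by exact: lt_trans ltr01 p1.
  have intD k : (k <= m)%N -> (\int[mu]_t (`|D k t| `^ p)%:E = (n k `^ p)%:E)%E.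
    move=> km; rewrite -poweR_EFin -(Hn _ km) LnormE -poweRrM mulVf ?lt0r_neq0// poweRe1//.
    by apply: integral_ge0 => t _; rewrite lee_fin powR_ge0.
  have HT : (\int[mu]_t (\sum_(l < m.+1) `|D l t| `^ p)%:E <= (m.+1%:R * s `^ p)%:E)%E.
    under eq_integral do rewrite -sumEFin.
    rewrite ge0_integral_sum//; last first.
      move=> l; apply/measurable_EFinP; apply: measurable_powR_norm; apply: mD.
      by rewrite -ltnS.
    apply: (@le_trans _ _ (\sum_(l < m.+1) (s `^ p)%:E)%E).
      apply: lee_sum => l _; have lm : (l <= m)%N := ltn_ord l.
      rewrite (intD _ lm) lee_fin; exact: (ler_powR2 p1 (n0 _ lm) (ns _ lm)).
    by rewrite sumEFin lee_fin sumr_const card_ord mulr_natl.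
  have esum_le k : (k <= m)%N -> (\esum_(i in difference_range l1 l2 k) energy_term p k i <=
      (4 `^ p * m.+1%:R * (m.+1%:R * s `^ p))%:E)%E.
    move=> km; apply: esum_le_uniq => r ur rD.
    apply: (@le_trans _ _ (\sum_(i <- r) weight m X i * `|dd k F (window X i)| `^ p)%:E).
      rewrite -sumEFin big_seq [leRHS]big_seq; apply: lee_sum => i ir.
      by rewrite (energy_termE _ (rD _ ir)) (dd_extended FE (rD _ ir)).
    rewrite lee_fin; exact: (dd_energy_le m_gt0 XS dF D_F mD incr p1 km ur Xcover HT).
  rewrite Wtilde_finE -EFinM.
  have TE : (total_energy p <= (((4 * m.+1%:R ^+ 3) * s) `^ p)%:E)%E.
    apply: (@le_trans _ _ (\sum_(k < mE.+1) (4 `^ p * m.+1%:R * (m.+1%:R * s `^ p))%:E)%E).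
      apply: lee_sum => k _; apply: esum_le.
      by rewrite (leq_trans _ max_difference_order_le)// -ltnS.
    rewrite sumEFin lee_fin sumr_const card_ord -[leLHS]mulr_natl.
    rewrite (_ : mE.+1%:R * _ = 4 `^ p * (mE.+1%:R * m.+1%:R * m.+1%:R) * s `^ p); last by ring.
    rewrite (@powRM _ (_ * _) s) ?(@powRM _ 4 (_ ^+ 3)) ?mulr_ge0 ?exprn_ge0//.
    apply: ler_wpM2r; first exact: powR_ge0.
    apply: ler_wpM2l; first exact: powR_ge0.
    apply: (@le_trans _ _ (m.+1%:R ^+ 3)).
      rewrite !exprS expr0 mulr1 -mulrA ler_wpM2r ?mulr_ge0// ler_nat ltnS.
      exact: max_difference_order_le.
    rewrite -[leLHS]powRr1 ?exprn_ge0//; apply: ler_powR; last exact: ltW.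
    exact: exprn_ege1.
  rewrite -[X in (_ <= X%:E)%E](_ : ((4 * m.+1%:R ^+ 3 * s) `^ p) `^ p^-1 = _); last first.
    by rewrite -powRrM divff ?lt0r_neq0// powRr1// !mulr_ge0// exprn_ge0.
  rewrite -poweR_EFin; apply: gt0_ler_poweR => //.
  - by rewrite invr_ge0 ltW.
  - by rewrite in_itv/= leey andbT total_energy_ge0.
  - by rewrite in_itv/= leey andbT lee_fin powR_ge0.
move=> WF N0 Hn SE.
have Hs l : (l <= m)%N -> {ae mu, forall t, `|D l t| <= s}.
  move=> lm; have : ('N[mu]_+oo[EFin \o D l] <= s%:E)%E by rewrite Hn// lee_fin ns.
  rewrite unlock lebesgue_measure_setT_gt0 => /ess_supP.
  by apply: filterS => t /=; rewrite lee_fin.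
rewrite /Wtilde_oo -EFinM ge_max lee_fin !mulr_ge0 ?exprn_ge0//=.
apply: ge_ereal_sup => _ [k [i [km Hi ->]]].
rewrite lee_fin -(dd_extended FE Hi).
apply: (le_trans (dd_le_ess_bound m_gt0 XS dF D_F mD incr i s0 Hs (leq_trans km max_difference_order_le))).
apply: ler_wpM2r => //; rewrite -[leLHS]mulr1; apply: ler_pM => //.
- by rewrite ler_nat.
- exact: exprn_ege1.
Qed.

End TraceCriterion.

Theorem theorem1p3 (R : realType) (m : nat) (hm : (0 < m)%N) :
  exists2 C : R, 1 <= C &
  forall (l1 l2 : \bar int) (hl : (l1 <= l2)%E) (x : int -> R)
    (hx : forall i j : int, index_range l1 l2 i -> index_range l1 l2 j ->
      i < j -> x i < x j)
    (E : set R) (hE : E = point_set l1 l2 x) (hclosed : closed E) (f : R -> R),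
  [/\ forall p : R, 1 < p ->
        (in_trace_space m p%:E E f <-> (Wtilde_fin m p l1 l2 x f < +oo)%E),
      in_trace_space m +oo%E E f <-> (Wtilde_oo m l1 l2 x f < +oo)%E &
      forall p : \bar R, (1 < p)%E ->
        (C^-1%:E * Wtilde m p l1 l2 x f <= trace_norm m p E f)%E /\
        (trace_norm m p E f <= C%:E * Wtilde m p l1 l2 x f)%E].
Proof.
have [K K0 HK] := @smooth_extension R m hm.
set c := m.+1%:R * (2 * K * energy_const m + K * (m%:R * (m%:R + 2))).
have c0 : 0 <= c.
  by rewrite /c mulr_ge0// addr_ge0// ?mulr_ge0 ?addr_ge0// /energy_const !mulr_ge0.
set d : R := 4 * m.+1%:R ^+ 3.
have d0 : 1 <= d.
  rewrite /d -[leLHS]mulr1; apply: ler_pM => //; first by rewrite ler1n.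
  by rewrite exprn_ege1// ler1n.
exists (c + d); first by rewrite (le_trans d0)// lerDr.
move=> l1 l2 hl x hx _ -> hclosed f; set E := point_set l1 l2 x.
have C0 : 0 < c + d by rewrite ltr_wpDl// (lt_le_trans ltr01).
have extend p : (1 < p)%E -> (Wtilde m p l1 l2 x f < +oo)%E ->
    exists2 F, extensions m p E f F & (sobolev_norm m p F <= c%:E * Wtilde m p l1 l2 x f)%E.
  move=> p1; apply: (extension_le_Wtilde hm hl hx hclosed K0 _ p1).
  apply: HK => [i|t]; [exact: extended_sequenceS|exact: extended_cover].
have restrict p F : (1 < p)%E -> extensions m p E f F ->
    (Wtilde m p l1 l2 x f <= d%:E * sobolev_norm m p F)%E /\ (sobolev_norm m p F < +oo)%E.
  by move=> p1; exact: (Wtilde_le hm hl hx hclosed p1).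
have Wge0 p : (1 < p)%E -> (0 <= Wtilde m p l1 l2 x f)%E.
  case: p => [p||]//= p1; first exact: poweR_ge0.
  by rewrite /Wtilde_oo le_max lexx.
have criterion p : (1 < p)%E ->
    in_trace_space m p E f <-> (Wtilde m p l1 l2 x f < +oo)%E.
  move=> p1; split=> [[F /(restrict _ _ p1)[WF NF]]|/(extend _ p1)[F EF _]]; last by exists F.
  by apply: (le_lt_trans WF); rewrite lte_mul_pinfty// lee_fin (le_trans ler01).
split.
- by move=> p p1; exact: (criterion p%:E).
- exact: (criterion +oo%E (ltry 1)).
- move=> p p1; split.
    apply: le_ereal_inf_tmp => _ [F EF <-]; have [WF _] := restrict _ _ p1 EF.
    have S0 : (0 <= sobolev_norm m p F)%E by apply: sume_ge0 => k _; exact: Lnorm_ge0.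
    rewrite lee_pdivrMl//; apply: (le_trans WF); apply: lee_wpmul2r => //.
    by rewrite lee_fin lerDr.
  have [Wfin|] := ltP (Wtilde m p l1 l2 x f) +oo%E; last first.
    by rewrite leye_eq => /eqP ->; rewrite gt0_muley ?leey ?lte_fin.
  have [F EF NF] := extend _ p1 Wfin.
  apply: (@le_trans _ _ (sobolev_norm m p F)); first by apply: ereal_inf_lbound; exists F.
  apply: (le_trans NF); apply: lee_wpmul2r; first exact: Wge0.
  by rewrite lee_fin lerDl (le_trans ler01).
Qed.
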